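(* Let $\mathbb K\in\{\mathbb R,\mathbb C\}$ and let $\theta\subset\Delta=\{\alpha_1,\dots,\alpha_{d-1}\}$ be symmetric. Suppose $\Gamma\subset\mathsf{PSL}(d,\mathbb K)$ is Zariski dense and $\mathsf P_\theta$-transverse, $\phi_1,\phi_2\in\mathfrak a_\theta^*$, $\phi_1\neq\phi_2$ and $\delta^{\phi_1}(\Gamma)=\delta^{\phi_2}(\Gamma)=1$. If $\phi=\lambda\phi_1+(1-\lambda)\phi_2$ where $\lambda\in(0,1)$ and $Q_\Gamma^\phi$ diverges at its critical exponent (i.e. $Q_\Gamma^\phi(\delta^\phi(\Gamma))=+\infty$), then $\delta^\phi(\Gamma)<1$.
   Context: $\mathsf{PSL}(d,\mathbb K)$ is regarded as a real Lie group, and Zariski density is with respect to its structure as a real algebraic group. $\mathfrak a=\{\mathrm{diag}(a_1,\dots,a_d): a_i\in\mathbb R,\ \sum a_i=0\}$. The Cartan projection of $g\in\mathsf{PSL}(d,\mathbb K)$ is $\kappa(g)=\mathrm{diag}(\log\sigma_1(g),\dots,\log\sigma_d(g))$, where $\sigma_1(g)\ge\dots\ge\sigma_d(g)$ are the singular values of a lift of $g$ to $\mathsf{SL}(d,\mathbb K)$. The simple roots are $\alpha_j(\mathrm{diag}(a_1,\dots,a_d))=a_j-a_{j+1}$, $\Delta=\{\alpha_1,\dots,\alpha_{d-1}\}$, with fundamental weights $\omega_{\alpha_j}(\mathrm{diag}(a_1,\dots,a_d))=a_1+\dots+a_j$. A subset $\theta\subset\Delta$ is symmetric if $\alpha_k\in\theta\iff\alpha_{d-k}\in\theta$.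 Set $\mathfrak a_\theta=\{\mathrm{diag}(a_1,\dots,a_d)\in\mathfrak a: a_j=a_{j+1}\text{ for all }\alpha_j\notin\theta\}$; the restrictions $\omega_\alpha|_{\mathfrak a_\theta}$, $\alpha\in\theta$, form a basis of $\mathfrak a_\theta^*$. The partial Cartan projection $\kappa_\theta:\mathsf{PSL}(d,\mathbb K)\to\mathfrak a_\theta$ is defined by $\omega_\alpha(\kappa_\theta(g))=\omega_\alpha(\kappa(g))$ for all $\alpha\in\theta$. $\mathcal F_\theta$ is the manifold of partial flags $F=(F^j)_{\alpha_j\in\theta}$ in $\mathbb K^d$ with $\dim F^j=j$ (nested). Flags $F,G\in\mathcal F_\theta$ are transverse if $F^j\oplus G^{d-j}=\mathbb K^d$ for all $\alpha_j\in\theta$. A subgroup $\Gamma$ is $\mathsf P_\theta$-divergent if $\min_{\alpha\in\theta}\alpha(\kappa(\gamma_n))\to+\infty$ for every sequence $\{\gamma_n\}$ of distinct elements of $\Gamma$. If $\alpha(\kappa(g))>0$ for all $\alpha\in\theta$, then $U_\theta(g)\in\mathcal F_\theta$ is the flag whose $j$-dimensional part is $k\langle e_1,\dots,e_j\rangle$, where $g=k\,e^{\kappa(g)}\,\ell$ is a singular value decomposition. For $\Gamma$ $\mathsf P_\theta$-divergent, the limit set $\Lambda_\theta(\Gamma)\subset\mathcal F_\theta$ is the set of limits of convergent sequences $U_\theta(\gamma_n)$ with $\gamma_n\in\Gamma$ distinct. $\Gamma$ is $\mathsf P_\theta$-transverse if it is $\mathsf P_\theta$-divergent and any two distinct flags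 in $\Lambda_\theta(\Gamma)$ are transverse. For a discrete subgroup $\Gamma$ and $\phi\in\mathfrak a_\theta^*$, $Q_\Gamma^\phi(s)=\sum_{\gamma\in\Gamma}e^{-s\phi(\kappa_\theta(\gamma))}$ and $\delta^\phi(\Gamma)=\inf\{s>0: Q_\Gamma^\phi(s)<+\infty\}\in[0,+\infty]$ is its critical exponent. *)

(* Defs.v *)
From HB Require Import structures.
From mathcomp Require Import all_boot all_order all_algebra.
From mathcomp Require Import complex.
From mathcomp Require mpoly.
From mathcomp Require Import all_classical all_reals all_analysis.
Import Order.TTheory GRing.Theory Num.Theory.
Import numFieldNormedType.Exports.

Set Implicit Arguments.
Unset Strict Implicit.
Unset Printing Implicit Defensive.

Local Open Scope classical_set_scope.
Local Open Scope ring_scope.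
Local Open Scope sesquilinear_scope.
Local Open Scope quotient_scope.

(* Throughout, the dimension is d = n.+1, and i : 'I_n stands for the simple
   root alpha_(i+1); thus alpha_(d-(i+1)) is the root of index rev_ord i. *)

Section ProjectiveSpecialLinear.
Variables (K : fieldType) (n : nat).

Definition SL := {A : 'M[K]_n.+1 | \det A == 1}.

Lemma SL_det (A : SL) : \det (val A) = 1. Proof. exact/eqP/(valP A). Qed.

Lemma SL_unit (A : SL) : val A \in unitmx.
Proof. by rewrite unitmxE SL_det unitr1. Qed.

Lemma SL_one_subproof : \det (1%:M : 'M[K]_n.+1) == 1.
Proof. by rewrite det1. Qed.
Lemma SL_mul_subproof (A B : SL) : \det (val A *m val B) == 1.
Proof. by rewrite det_mulmx !SL_det mulr1. Qed.
Lemma SL_inv_subproof (A : SL) : \det (invmx (val A)) == 1.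
Proof. by rewrite det_inv SL_det invr1. Qed.

Definition SL_one : SL := Sub 1%:M SL_one_subproof.
Definition SL_mul (A B : SL) : SL := Sub (val A *m val B) (SL_mul_subproof A B).
Definition SL_inv (A : SL) : SL := Sub (invmx (val A)) (SL_inv_subproof A).

(* The center of SL(d, K) consists of the c%:M with c a d-th root of unity. *)
Definition SL_eqmod_center (A B : SL) : bool :=
  `[< exists2 c : K, c ^+ n.+1 = 1 & val B = c *: val A >].

Lemma SL_eqmod_center_refl : reflexive SL_eqmod_center.
Proof. by move=> A; apply/asboolP; exists 1; rewrite ?expr1n ?scale1r. Qed.

Lemma SL_eqmod_center_sym : symmetric SL_eqmod_center.
Proof.
suff sub A B : SL_eqmod_center A B -> SL_eqmod_center B A.
  by move=> A B; apply/idP/idP; apply: sub.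
move=> /asboolP[c c1 eB]; apply/asboolP; exists c^-1; first by rewrite exprVn c1 invr1.
have c0 : c != 0 by apply/eqP => c0; move: c1; rewrite c0 expr0n => /esym/eqP; rewrite oner_eq0.
by rewrite eB scalerA mulVf ?scale1r.
Qed.

Lemma SL_eqmod_center_trans : transitive SL_eqmod_center.
Proof.
move=> B A C /asboolP[c c1 eB] /asboolP[e e1 eC]; apply/asboolP.
by exists (e * c); rewrite ?exprMn ?c1 ?e1 ?mulr1// eC eB scalerA.
Qed.

Canonical SL_eqmod_center_equiv := EquivRel SL_eqmod_center
  SL_eqmod_center_refl SL_eqmod_center_sym SL_eqmod_center_trans.

Definition PSL := {eq_quot SL_eqmod_center_equiv}.
HB.instance Definition _ : EqQuotient _ SL_eqmod_center_equiv PSL :=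
  EqQuotient.on PSL.
HB.instance Definition _ := Choice.on PSL.

Definition PSL_one : PSL := \pi_PSL SL_one.
Definition PSL_mul (x y : PSL) : PSL := \pi_PSL (SL_mul (repr x) (repr y)).
Definition PSL_inv (x : PSL) : PSL := \pi_PSL (SL_inv (repr x)).

Lemma PSL_piP (A B : SL) :
  (\pi_PSL A = \pi_PSL B) <->
  (exists2 c : K, c ^+ n.+1 = 1 & val B = c *: val A).
Proof.
split=> [/eqmodP/asboolP //|cAB].
by apply/eqmodP; apply/asboolP.
Qed.

Lemma PSL_piM (A B : SL) :
  PSL_mul (\pi_PSL A) (\pi_PSL B) = \pi_PSL (SL_mul A B).
Proof.
apply/PSL_piP.
have /PSL_piP[c c1 eA] := reprK (\pi_PSL A).
have /PSL_piP[e e1 eB] := reprK (\pi_PSL B).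
exists (c * e); first by rewrite exprMn c1 e1 mulr1.
by rewrite /= eA eB -scalemxAl -scalemxAr scalerA.
Qed.

Lemma PSL_piV (A : SL) : PSL_inv (\pi_PSL A) = \pi_PSL (SL_inv A).
Proof.
apply/PSL_piP.
have /PSL_piP[c c1 eA] := reprK (\pi_PSL A).
exists c^-1; first by rewrite exprVn c1 invr1.
have cu : c \is a GRing.unit by rewrite -(unitrX_pos c (ltn0Sn n)) c1 unitr1.
by rewrite /= eA invmxZ // -eA SL_unit.
Qed.

Lemma PSL_surj (x : PSL) : exists A, x = \pi_PSL A.
Proof. by exists (repr x); rewrite reprK. Qed.

Lemma PSL_mulA : associative PSL_mul.
Proof.
move=> x y z; have [A ->] := PSL_surj x; have [B ->] := PSL_surj y.
have [C ->] := PSL_surj z.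
rewrite (PSL_piM B C) (PSL_piM A (SL_mul B C)) (PSL_piM A B) (PSL_piM (SL_mul A B) C).
by apply: (congr1 \pi_PSL); apply: val_inj; rewrite /= mulmxA.
Qed.

Lemma PSL_mul1g : left_id PSL_one PSL_mul.
Proof.
move=> x; have [A ->] := PSL_surj x; rewrite (PSL_piM SL_one A).
by apply: (congr1 \pi_PSL); apply: val_inj; rewrite /= mul1mx.
Qed.

Lemma PSL_mulg1 : right_id PSL_one PSL_mul.
Proof.
move=> x; have [A ->] := PSL_surj x; rewrite (PSL_piM A SL_one).
by apply: (congr1 \pi_PSL); apply: val_inj; rewrite /= mulmx1.
Qed.

Lemma PSL_mulVg : left_inverse PSL_one PSL_inv PSL_mul.
Proof.
move=> x; have [A ->] := PSL_surj x; rewrite PSL_piV (PSL_piM (SL_inv A) A).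
by apply: (congr1 \pi_PSL); apply: val_inj; rewrite /= mulVmx // SL_unit.
Qed.

Lemma PSL_mulgV : right_inverse PSL_one PSL_inv PSL_mul.
Proof.
move=> x; have [A ->] := PSL_surj x; rewrite PSL_piV (PSL_piM A (SL_inv A)).
by apply: (congr1 \pi_PSL); apply: val_inj; rewrite /= mulmxV // SL_unit.
Qed.

HB.instance Definition _ := isGroup.Build PSL
  PSL_mulA PSL_mul1g PSL_mulg1 PSL_mulVg PSL_mulgV.

End ProjectiveSpecialLinear.

Definition is_subgroup (G : groupType) (A : set G) : Prop :=
  [/\ A 1%g, forall x y, A x -> A y -> A (x * y)%g & forall x, A x -> A (x^-1)%g].

Variant base_field := RealNumbers | ComplexNumbers.

Definition field_of (R : realType) (b : base_field) : numFieldType :=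
  match b with RealNumbers => R | ComplexNumbers => R[i] end.

Definition toC (R : realType) (b : base_field) : field_of R b -> R[i] :=
  match b with RealNumbers => fun x : R => x%:C%C | ComplexNumbers => id end.

Section CartanSubspace.
Variables (R : realType) (n : nat).
Implicit Types (a : 'rV[R]_n.+1) (i : 'I_n) (theta : {set 'I_n}).

Definition simple_root i a : R :=
  a 0 (widen_ord (leqnSn n) i) - a 0 (lift ord0 i).

Definition fund_weight i a : R := \sum_(j < n.+1 | (j <= i)%N) a 0 j.

Definition symmetric_roots theta := forall i, (rev_ord i \in theta) = (i \in theta).

Definition entry_sum a : R^o := \sum_j a 0 j.

Lemma simple_root_is_linear i : linear (simple_root i : _ -> R^o).
Proof. by move=> k u v; rewrite /simple_root !mxE scalerBr addrACA opprD. Qed.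
HB.instance Definition _ i := GRing.isLinear.Build R 'rV[R]_n.+1 R^o _
  (simple_root i : _ -> R^o) (simple_root_is_linear i).

Lemma entry_sum_is_linear : linear entry_sum.
Proof.
move=> k u v; rewrite /entry_sum scaler_sumr -big_split /=.
by apply: eq_bigr => j _; rewrite !mxE.
Qed.
HB.instance Definition _ := GRing.isLinear.Build R 'rV[R]_n.+1 R^o _
  entry_sum entry_sum_is_linear.

(* The subspace a_theta; memv_a_sub characterizes its elements. *)
Definition a_sub theta : {vspace 'rV[R]_n.+1} :=
  (lker (linfun entry_sum) :&:
   \bigcap_(i | i \notin theta) lker (linfun (simple_root i : _ -> R^o)))%VS.

Lemma memv_a_sub theta a : reflect
  (\sum_j a 0 j = 0 /\
   forall i, i \notin theta -> a 0 (widen_ord (leqnSn n) i) = a 0 (lift ord0 i))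
  (a \in a_sub theta).
Proof.
rewrite memv_cap memv_ker lfunE /= -[\sum_j a 0 j]/(entry_sum a).
apply: (iffP andP) => -[/eqP a0 ha]; split=> //.
  move=> i it; apply/eqP; rewrite -subr_eq0.
  move: ha; rewrite memvE => /subv_bigcapP/(_ i it).
  by rewrite -memvE memv_ker lfunE.
rewrite memvE; apply/subv_bigcapP => i it.
by rewrite -memvE memv_ker lfunE /= /simple_root ha // subrr.
Qed.

Definition a_dual theta := 'Hom(subvs_of (a_sub theta), R^o).

End CartanSubspace.

Section Flags.
Variables (K : fieldType) (n : nat) (theta : {set 'I_n}).

Definition theta_root := {i : 'I_n | i \in theta}.

Record flag := Flag {
  flag_part :> theta_root -> {vspace 'cV[K]_n.+1};
  flag_dim : forall i : theta_root, \dim (flag_part i) = (val i).+1;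
  flag_nested : forall i j : theta_root,
    (val i <= val j)%N -> (flag_part i <= flag_part j)%VS
}.

(* rev_ord i is the index of the root alpha_(d-j) when i is that of alpha_j; it
   belongs to theta as soon as theta is symmetric. *)
Definition transverse (F G : flag) : Prop :=
  forall i j : theta_root, val j = rev_ord (val i) ->
    directv (F i + G j)%VS /\ (F i + G j)%VS = fullv.

Definition flag_of_frame (g : 'M[K]_n.+1) (F : flag) : Prop :=
  forall i : theta_root,
    F i = <<[seq col j g | j : 'I_n.+1 <- enum 'I_n.+1 & (j <= val i)%N]>>%VS.

End Flags.

Section TransverseGroups.
Variables (R : realType) (b : base_field) (n : nat) (theta : {set 'I_n}).
Local Notation K := (field_of R b).
Implicit Types (g : PSL K n) (Gamma : set (PSL K n)) (F G : flag K theta).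

(* The flag variety has the quotient topology of GL(d, K) / P_theta; GL(d, K) is
   open in the space of matrices. *)
Definition flag_open (U : set (flag K theta)) : Prop :=
  open [set g : 'M[K]_n.+1 | g \in unitmx /\ exists2 F, U F & flag_of_frame g F].

Definition flag_cvg (u : nat -> flag K theta) F : Prop :=
  forall U, flag_open U -> U F -> \forall m \near \oo, U (u m).

(* The square roots of the eigenvalues of A^* A, in nonincreasing order. *)
Definition sing_vals (A : 'M[K]_n.+1) : seq R :=
  let A' := map_mx (@toC R b) A in
  sort >=%R
    [seq Num.sqrt (complex.Re (spectral_diag (A'^t* *m A') 0 i)) | i <- enum 'I_n.+1].

(* Two lifts of g differ by a scalar of modulus 1, hence the choice of the lift
   repr g affects neither cartan nor is_Utheta. *)
Definition cartan g : 'rV[R]_n.+1 := \row_i ln (nth 0 (sing_vals (val (repr g))) i).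

(* The fund_weight i, i in theta, restrict to a basis of the dual of a_theta, so
   that the set below is a singleton. *)
Definition pcartan g : subvs_of (a_sub R theta) :=
  xget 0 [set v : subvs_of (a_sub R theta) |
    forall i, i \in theta -> fund_weight i (vsval v) = fund_weight i (cartan g)].

(* The relation F = U_theta(g). *)
Definition is_Utheta g F : Prop :=
  (forall i, i \in theta -> 0 < simple_root i (cartan g)) /\
  exists k l : 'M[K]_n.+1,
  [/\ map_mx (@toC R b) k \is unitarymx, map_mx (@toC R b) l \is unitarymx,
      map_mx (@toC R b) (val (repr g)) =
        map_mx (@toC R b) k
          *m diag_mx (\row_i (expR (cartan g 0 i))%:C%C) *m map_mx (@toC R b) l
    & flag_of_frame k F].

Definition divergent Gamma : Prop :=
  forall u : nat -> PSL K n, injective u -> (forall m, Gamma (u m)) ->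
    \big[Order.min/+oo%E]_(i in theta) (simple_root i (cartan (u m)))%:E
      @[m --> \oo] --> +oo%E.

Definition limit_set Gamma : set (flag K theta) :=
  [set F | exists (u : nat -> PSL K n) (v : nat -> flag K theta),
    [/\ injective u, forall m, Gamma (u m), forall m, is_Utheta (u m) (v m)
      & flag_cvg v F]].

Definition transverse_subgroup Gamma : Prop :=
  [/\ is_subgroup Gamma, divergent Gamma &
      forall F G, limit_set Gamma F -> limit_set Gamma G -> F <> G -> transverse F G].

Definition poincare Gamma (phi : a_dual R theta) (s : R) : \bar R :=
  \esum_(g in Gamma) (expR (- s * phi (pcartan g)))%:E.

Definition critical_exponent Gamma (phi : a_dual R theta) : \bar R :=
  ereal_inf [set s%:E | s in [set s : R | 0 < s /\ (poincare Gamma phi s < +oo)%E]].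

Definition diverges_at_critical_exponent Gamma (phi : a_dual R theta) : Prop :=
  exists2 s : R, critical_exponent Gamma phi = s%:E & poincare Gamma phi s = +oo%E.

End TransverseGroups.

Section Zariski.
Variables (R : realType) (b : base_field) (n : nat).
Local Notation K := (field_of R b).

Definition coord_index := (bool * 'I_n.+1 * 'I_n.+1)%type.
Definition real_coord (A : 'M[K]_n.+1) (x : coord_index) : R :=
  let z := toC (A x.1.2 x.2) in if x.1.1 then complex.Im z else complex.Re z.

Definition real_poly := mpoly.mpoly #|{: coord_index}| R.
Definition real_poly_eval (p : real_poly) (A : 'M[K]_n.+1) : R :=
  mpoly.meval (fun k => real_coord A (enum_val k)) p.

(* Real polynomials in the real and imaginary parts of the entries are the
   regular functions of the real algebraic group SL(d, K); the Zariski topology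
   of PSL(d, K) is the quotient topology. *)
Definition zariski_closed (Z : set (PSL K n)) : Prop :=
  exists I : set real_poly, forall A : SL K n,
    Z (\pi_(PSL K n) A) <-> (forall p, I p -> real_poly_eval p (val A) = 0).

Definition zariski_dense (Gamma : set (PSL K n)) : Prop :=
  forall Z, zariski_closed Z -> Gamma `<=` Z -> Z = setT.

End Zariski.

(* Main.v *)
From HB Require Import structures.
Require Import Defs.
From mathcomp Require Import all_boot all_order all_algebra.
From mathcomp Require Import perm complex.
From mathcomp Require mpoly.
From mathcomp Require Import all_classical all_reals all_analysis.
From mathcomp Require Import ring lra zify.
Import Order.TTheory GRing.Theory Num.Theory.
Import numFieldNormedType.Exports.
Import -(notations) mpoly.

Set Implicit Arguments.
Unset Strict Implicit.
Unset Printing Implicit Defensive.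
Local Open Scope ring_scope.
Local Open Scope sesquilinear_scope.
Local Open Scope quotient_scope.

(** Let W_i(g) be the logarithm of the norm of the (i+1)-st compound matrix of a lift
    of g. It is subadditive and differs by a bounded amount from the fundamental weight
    omega_i of kappa(g). Call (g, h) good if W_i(g) + W_i(h) - W_i(gh) is bounded for i
    in theta. Zariski density and the compactness of the unitary group give a finite
    subset F of Gamma such that, for all g and h, (g, f h) is good for some f in F. The
    transversality of the limit flags gives a form of hyperbolicity: if (a^-1, c) is
    good then, for each b in Gamma, (a^-1, b) or (b^-1, c) is good. With these two facts
    the shadows {gh | (g, h) good}, weighted by exp(- s phi), satisfy the shadow lemma
    and a Vitali covering lemma, and only finite sums are needed.

    If delta^phi >= 1 then delta^phi = 1 by convexity, and Q^phi(1) is infinite. As s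
    decreases to 1, a second moment estimate shows that, for b in Gamma, the shadows of
    the elements g f b (g in Gamma, f in F with (g, f b) good) carry a proportion c0 of
    the mass, where c0 does not depend on b. Let psi = phi_1 - phi_2. If psi(b) is large
    then so is psi at g or at g f b, hence there exp(- s phi) is much smaller than one of
    the exp(- s phi_j); as disjoint shadows have bounded total exp(- s phi_j)-weight,
    this contradicts the bound c0. So psi is bounded on Gamma.

    It remains to see that a combination of the W_i, with coefficients c_i, that is
    bounded on a Zariski dense group is zero. Let h_m = k_m a_m l_m go to infinity in
    Gamma with k_m -> k and l_m -> l, and let Delta_i be the leading minors. For a
    suitable constant, Psi(g) = const + sum_i c_i log |Delta_i(l g k)| is bounded on
    Gamma and Psi(g h_m g') tends to Psi(g) + Psi(g'), hence Psi vanishes on Gamma. The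
    terms of first order in the singular value gaps of h_m then give an identity between
    quotients of minors of l g k and l g' k, which extends to SL(d, K) by density; at
    elementary unipotent matrices it reads c_i = 0. *)

(** * Shadows of coarsely additive functions *)

(** Where Patterson-Sullivan measures would be compared, the weights exp(- s phi) on Gamma are used
    at exponents s > 1; the total mass is the supremum Q of the finite sums, and a finite set E
    carries half of it. As s must tend to 1, all constants have to be uniform for s in (1, 2]: they
    depend only on a bound L for the defect of additivity and on a bound V for the values on F. The
    order of choices matters: c0 precedes b, b precedes the threshold imposed on Q, and this
    threshold precedes s.

    W_i replaces omega_i(kappa) because its subadditivity is the Cauchy-Binet formula and because it
    involves g through finitely many minors, whose limits are easy to take.

    In the final step an escaping sequence only sees the roots for which exp(- alpha_i) is not
    negligible against the other gaps, so it kills one coefficient; applied to the support of c,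
    this kills all of them. Mixed differences in (g, g') isolate the first-order terms, as
    everything else depends on g alone or on g' alone. *)

Section SeqSums.
Variable R : realType.

Lemma ler_sum_subset (T : eqType) (s t : seq T) (P : pred T) (F : T -> R) :
  uniq s -> uniq t -> {subset s <= t} -> (forall x, x \in s -> P x) ->
  (forall x, 0 <= F x) ->
  \sum_(x <- s) F x <= \sum_(x <- t | P x) F x.
Proof.
move=> us ut st sP F0.
rewrite [leRHS](bigID (mem s)) /=.
have -> : \sum_(x <- s) F x = \sum_(x <- t | P x && (x \in s)) F x.
  rewrite -[RHS]big_filter; apply/perm_big/uniq_perm; rewrite ?filter_uniq// => x.
  rewrite mem_filter; case xs: (x \in s); rewrite ?andbF //.
  by rewrite st // sP.
by rewrite lerDl sumr_ge0.
Qed.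

Lemma ler_sum_inj (S T : eqType) (s : seq S) (t : seq T) (u : S -> T)
    (P : pred S) (P' : pred T) (F : T -> R) :
  uniq s -> uniq t -> injective u ->
  (forall x, x \in s -> P x -> u x \in t /\ P' (u x)) ->
  (forall x, 0 <= F x) ->
  \sum_(x <- s | P x) F (u x) <= \sum_(y <- t | P' y) F y.
Proof.
move=> us ut iu st F0.
rewrite -big_filter -(big_map u predT).
apply: ler_sum_subset => //.
- by rewrite map_inj_uniq ?filter_uniq.
- by move=> y /mapP[x]; rewrite mem_filter => /andP[Px xs] ->; have [] := st x xs Px.
- by move=> y /mapP[x]; rewrite mem_filter => /andP[Px xs] ->; have [] := st x xs Px.
Qed.

Lemma sum_indicator_le (T : eqType) (s : seq T) (P : pred T) (c : R) m :
  0 <= c -> uniq s -> (forall t, uniq t -> {subset t <= s} -> all P t -> (size t <= m)%N) ->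
  \sum_(x <- s | P x) c <= m%:R * c.
Proof.
move=> c0 us H; rewrite -big_filter big_const_seq count_predT.
rewrite iter_addr_0 -[X in X <= _]mulr_natl.
rewrite ler_wpM2r // ler_nat; apply: H; rewrite ?filter_uniq //.
- by move=> x; rewrite mem_filter => /andP[].
- exact: filter_all.
Qed.

End SeqSums.

Section CoarselyAdditive.
Variables (R : realType) (G : groupType) (I : finType) (Gamma : set G).
Variable om : I -> G -> R.
Hypothesis Gsub : is_subgroup Gamma.
Hypothesis om_sub : forall i g h, om i (g * h)%g <= om i g + om i h.

(** A bound on the Gromov product of g^-1 and h, one for each i: the path from 1 to gh passes near
    g. *)
Definition good (C : R) (g h : G) : Prop :=
  forall i, om i g + om i h - om i (g * h)%g <= C.

(** The error is linear in C so that one L serves every C; the + 1 leaves room at C = 0 for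
    functions that are only boundedly close to combinations of the [om i]. *)
Definition quasi (L : R) (v : G -> R) : Prop :=
  forall C g h, 0 <= C -> Gamma g -> Gamma h -> good C g h ->
    `|v (g * h)%g - v g - v h| <= L * (C + 1).

(** The cost of inserting f in a product: it bounds the defect of every pair that contains f, on
    either side. *)
Definition gcst (f : G) : R := \sum_i (om i f + om i f^-1%g).

Lemma subgroupM g h : Gamma g -> Gamma h -> Gamma (g * h)%g.
Proof. by case: Gsub => _ H _; apply: H. Qed.
Lemma subgroupV g : Gamma g -> Gamma (g^-1)%g.
Proof. by case: Gsub => _ _; apply. Qed.

Lemma om1 i : 0 <= om i 1%g.
Proof. by have := om_sub i 1%g 1%g; rewrite mulg1; lra. Qed.

Lemma omV i f : 0 <= om i f + om i f^-1%g.
Proof. by have := om_sub i f f^-1%g; rewrite mulgV; have := om1 i; lra. Qed.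

Lemma gcst_ge i f : om i f + om i f^-1%g <= gcst f.
Proof. by rewrite /gcst (bigD1 i) //= lerDl sumr_ge0 // => j _; apply: omV. Qed.

Lemma gcst_ge0 f : 0 <= gcst f.
Proof. by apply: sumr_ge0 => j _; apply: omV. Qed.

Lemma gcstV f : gcst f^-1%g = gcst f.
Proof. by apply: eq_bigr => j _; rewrite invgK addrC. Qed.

Lemma goodW C C' g h : C <= C' -> good C g h -> good C' g h.
Proof. by move=> CC H i; apply: le_trans (H i) CC. Qed.

Lemma good_finl f g : good (gcst f) f g.
Proof.
move=> i; have := om_sub i f^-1%g (f * g)%g; rewrite mulKg.
by have := gcst_ge i f; lra.
Qed.

Lemma good_finr f g : good (gcst f) g f.
Proof.
move=> i; have := om_sub i (g * f)%g f^-1%g; rewrite mulgK.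
by have := gcst_ge i f; lra.
Qed.

(** Subadditivity at hk turns the sum of the two defects into the defect at (g, hk). *)
Lemma good_trans C1 C2 g h k :
  good C1 g h -> good C2 (g * h)%g k -> good (C1 + C2) g (h * k)%g.
Proof.
move=> H1 H2 i; have := H1 i; have := H2 i; have := om_sub i h k.
by rewrite mulgA; lra.
Qed.

Lemma quasi_fin L v f g : quasi L v -> Gamma f -> Gamma g ->
  `|v (f * g)%g - v f - v g| <= L * (gcst f + 1).
Proof. by move=> q Gf Gg; apply: q => //; [exact: gcst_ge0|exact: good_finl]. Qed.

Definition finG (E : seq G) := uniq E /\ (forall x, x \in E -> Gamma x).
Definition wsum (v : G -> R) (E : seq G) : R := \sum_(x <- E) expR (- v x).
Definition wbound v (Q : R) := forall E, finG E -> wsum v E <= Q.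
Definition shad C g x := `[< good C g (g^-1 * x)%g >].

Lemma shadE C g h : shad C g (g * h)%g = `[< good C g h >].
Proof. by rewrite /shad mulKg. Qed.

(** Translation by g^-1 maps the shadow injectively into Gamma, and there v (g y) is v g + v y up to
    L (C + 1). *)
Lemma shadow_upper L v Q C g Y : quasi L v -> wbound v Q -> 0 <= C ->
  Gamma g -> finG Y ->
  \sum_(x <- Y | shad C g x) expR (- v x) <=
    expR (L * (C + 1)) * expR (- v g) * Q.
Proof.
move=> q bQ C0 Gg [uY GY].
have -> : Q = 1 * Q by rewrite mul1r.
apply: (@le_trans _ _ (\sum_(x <- Y) expR (L * (C + 1)) * expR (- v g)
           * expR (- v (g^-1 * x)%g))).
  rewrite big_mkcond big_seq [leRHS]big_seq /=; apply: ler_sum => x xY.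
  case: ifPn => [/asboolP gx|_]; last first.
    by rewrite !mulr_ge0 ?expR_ge0.
  rewrite -!expRD ler_expR.
  have := q C g (g^-1 * x)%g C0 Gg (subgroupM (subgroupV Gg) (GY _ xY)) gx.
  by rewrite mulVKg ler_norml => /andP[]; lra.
rewrite mul1r -mulr_sumr ler_wpM2l ?mulr_ge0 ?expR_ge0 //.
have := bQ (map (fun y => (g^-1 * y)%g) Y); rewrite /wsum big_map; apply.
split; first by rewrite map_inj_uniq //; apply: mulgI.
by move=> x /mapP[y yY ->]; apply: subgroupM (GY _ yY); apply: subgroupV.
Qed.

Variables (F : seq G) (Cf : R).
Hypothesis FG : forall f, f \in F -> Gamma f.
Hypothesis Cf0 : 0 <= Cf.
Hypothesis F_good : forall g h, Gamma g -> Gamma h ->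
  exists2 f, f \in F & good Cf g (f * h)%g.

(** The summand at f is the price of passing from exp(- v g - v z) to exp(- v (g f z)) when (g, f z)
    is good. *)
Definition Klow (L V : R) : R :=
  \sum_(f <- F) expR (L * (Cf + 1)) * expR (V + L * (gcst f + 1)).

(** Every z in E enters the shadow of g as g f z for some f in F. For a fixed f the map is injective
    in z, so the multiplicity is absorbed by the sum over F in [Klow]. *)
Lemma shadow_lower L V v g E Y :
  quasi L v -> (forall f, f \in F -> v f <= V) -> Gamma g -> finG E -> finG Y ->
  (forall f z, f \in F -> z \in E -> (g * (f * z))%g \in Y) ->
  expR (- v g) * wsum v E <=
  Klow L V * \sum_(x <- Y | shad Cf g x) expR (- v x).
Proof.
move=> q vV Gg [uE GE] [uY GY] H.
apply: (@le_trans _ _ (\sum_(z <- E) \sum_(f <- F | `[< good Cf g (f * z)%g >])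
     expR (L * (Cf + 1)) * expR (V + L * (gcst f + 1)) * expR (- v (g * (f * z))%g))).
  rewrite /wsum mulr_sumr big_seq [leRHS]big_seq; apply: ler_sum => z zE.
  have [f fF gf] := F_good Gg (GE _ zE).
  rewrite (big_rem f) //= ifT; last exact/asboolP.
  rewrite -[leLHS]addr0; apply: lerD; last first.
    by apply: sumr_ge0 => i _; rewrite !mulr_ge0 ?expR_ge0.
  rewrite -!expRD ler_expR.
  have := vV _ fF.
  have := quasi_fin q (FG fF) (GE _ zE).
  have := q Cf g (f * z)%g Cf0 Gg (subgroupM (FG fF) (GE _ zE)) gf.
  by rewrite !ler_norml => /andP[? ?] /andP[? ?]; lra.
rewrite (eq_bigr _ (fun z _ => big_mkcond _ _)) exchange_big /= mulr_suml.
rewrite big_seq [leRHS]big_seq; apply: ler_sum => f fF.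
rewrite -big_mkcond /= -mulr_sumr ler_wpM2l ?mulr_ge0 ?expR_ge0 //.
apply: (@ler_sum_inj R _ _ E Y (fun z => (g * (f * z))%g) _ _ (fun x => expR (- v x))) => //.
- by move=> x y /mulgI /mulgI.
- by move=> z zE /asboolP gz; split; [exact: H|rewrite shadE; apply/asboolP].
Qed.

End CoarselyAdditive.

(** * Nesting of shadows and the Vitali covering lemma *)

Section Shadows.
Variables (R : realType) (G : groupType) (I : finType) (Gamma : set G).
Variable om : I -> G -> R.
Hypothesis Gsub : is_subgroup Gamma.
Hypothesis om_sub : forall i g h, om i (g * h)%g <= om i g + om i h.
Hypothesis hyperb : forall C, exists C', forall a b c, Gamma a -> Gamma b -> Gamma c ->
  good om C a^-1%g c -> good om C' a^-1%g b \/ good om C' b^-1%g c.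

Let GM := subgroupM Gsub.
Let GV := subgroupV Gsub.

(** Hyperbolicity for the translates by g2^-1 of 1, g1 and x. The first alternative puts g1 in the
    shadow of g2. The second aligns g1, g2 and x, which puts g2 in the shadow of g1 because x is in
    it. *)
Lemma shadow_nested C : 0 <= C -> exists2 C', C <= C' &
  forall g1 g2 x, Gamma g1 -> Gamma g2 -> Gamma x -> shad om C g1 x -> shad om C g2 x ->
  shad om C' g1 g2 \/ shad om C' g2 g1.
Proof.
move=> C0; have [C1 H] := hyperb C; exists (C + `|C1|); first by rewrite lerDl.
move=> g1 g2 x G1 G2 Gx /asboolP S1 /asboolP S2.
have := H (g2^-1)%g (g2^-1 * g1)%g (g2^-1 * x)%g (GV G2) (GM (GV G2) G1) (GM (GV G2) Gx).
have C1C : C1 <= C + `|C1| by have := ler_norm C1; lra.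
rewrite !invgK => /(_ S2) [H1|H1]; [right|left]; apply/asboolP.
  exact: goodW H1.
move=> i; have := H1 i; have := S1 i; have := om_sub i g2 (g2^-1 * x)%g.
rewrite invgM invgK !mulVKg [(_ * (g2^-1 * x))%g]mulgA mulgK.
by have := ler_norm C1; lra.
Qed.

Lemma shad_sub C C1 g1 g2 x : shad om C1 g1 g2 -> shad om C g2 x ->
  shad om (C1 + C) g1 x.
Proof.
move=> /asboolP S1 /asboolP S2; apply/asboolP.
have := @good_trans _ _ _ om om_sub C1 C g1 (g1^-1 * g2)%g (g2^-1 * x)%g S1.
by rewrite mulVKg mulgA mulgK; apply.
Qed.

Variables (phi : G -> R) (Lphi : R).
Hypothesis phi_quasi : quasi Gamma om Lphi phi.
Hypothesis phi_proper : forall T, exists X : seq G, forall x, Gamma x -> phi x <= T -> x \in X.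
Hypothesis Lphi0 : 0 <= Lphi.

Lemma gcst_proper T : exists c, forall x, Gamma x -> phi x <= T -> gcst om x <= c.
Proof.
have [X XP] := phi_proper T; exists (\sum_(x <- X) gcst om x) => x Gx xT.
rewrite (big_rem x) ?XP //= lerDl sumr_ge0 // => y _.
exact: gcst_ge0 om_sub _.
Qed.

Lemma phi_lbound : exists2 c, 0 <= c & forall x, Gamma x -> - c <= phi x.
Proof.
have [X XP] := phi_proper 0; exists (\sum_(x <- X) `|phi x|); first exact: sumr_ge0.
move=> x Gx; have s0 : 0 <= \sum_(x <- X) `|phi x| by apply: sumr_ge0.
have [px|px] := leP (phi x) 0; last by lra.
rewrite (big_rem x) ?XP //=; have := ler_norm (- phi x); rewrite normrN.
by have : 0 <= \sum_(y <- rem x X) `|phi y|; [apply: sumr_ge0|lra].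
Qed.

(** If g lies in the shadow of g0, the two shadows compose. Otherwise g0 lies in that of g; since
    phi g0 <= phi g, this bounds phi (g^-1 g0), and properness then bounds the cost of g^-1 g0. *)
Lemma shadow_absorb C : 0 <= C -> exists2 C', C <= C' &
  forall g0 g y x, Gamma g0 -> Gamma g -> Gamma x -> Gamma y -> phi g0 <= phi g ->
  shad om C g0 y -> shad om C g y -> shad om C g x -> shad om C' g0 x.
Proof.
move=> C0; have [C1 CC1 H] := shadow_nested C0.
have [c cP] := gcst_proper (Lphi * (C1 + 1)).
exists (C1 + C + `|c|); first by have := normr_ge0 c; lra.
move=> g0 g y x G0 Gg Gx Gy le0 S0 Sg Sx.
case: (H g0 g y G0 Gg Gy S0 Sg) => S1.
  have /asboolP := shad_sub S1 Sx; move=> S2; apply/asboolP.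
  by apply: goodW S2; rewrite lerDl.
have C10 : 0 <= C1 by lra.
have G1 : Gamma (g^-1 * g0)%g by apply: GM => //; apply: GV.
move: S1 => /asboolP S1.
have := phi_quasi C10 Gg G1 S1; rewrite mulVKg ler_norml => /andP[q _].
have {}cP : gcst om (g^-1 * g0)%g <= c by apply: cP => //; lra.
move: Sx => /asboolP Sx; apply/asboolP => i.
have := Sx i; rewrite !mulVKg.
have := om_sub i g (g^-1 * g0)%g; rewrite mulVKg.
have := om_sub i (g^-1 * g0)^-1%g (g^-1 * x)%g.
rewrite invgM invgK mulgA mulgK.
have := gcst_ge om_sub i (g^-1 * g0)%g; rewrite invgM invgK.
by have := ler_norm c; lra.
Qed.

(** Greedy selection: keep an element of least phi, discard those whose shadows meet its own, which
    [shadow_absorb] places in its enlarged shadow, and continue with the rest. *)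
Lemma vitali C : 0 <= C -> exists2 C', C <= C' &
  forall s : seq G, (forall g, g \in s -> Gamma g) ->
  exists A : seq G, [/\ uniq A, {subset A <= s},
    forall g g' y, Gamma y -> g \in A -> g' \in A -> g != g' ->
       ~~ (shad om C g y && shad om C g' y)
    & forall g x, Gamma x -> g \in s -> shad om C g x ->
        exists2 g', g' \in A & shad om C' g' x].
Proof.
move=> C0; have [C' CC' H] := shadow_absorb C0; exists C' => //.
move=> s; have [m] := ubnP (size s); elim: m s => // m IH s sm sG.
have [->|s0] := eqVneq s [::].
  by exists [::]; split.
have [g0 g0s g0min] : exists2 g0, g0 \in s & forall g, g \in s -> phi g0 <= phi g.
  case: s s0 {sm sG} => // a s _; elim: s a => [|c s IHs] a.
    by exists a; rewrite ?mem_seq1 // => g; rewrite mem_seq1 => /eqP ->.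
  have [g0 g0s gm] := IHs c; have [le|lt] := leP (phi a) (phi g0).
    exists a; rewrite ?mem_head // => g; rewrite inE => /predU1P[->//|/gm].
    exact: le_trans.
  exists g0; first by rewrite inE g0s orbT.
  by move=> g; rewrite inE => /predU1P[->|/gm//]; apply: ltW.
pose meets g := `[< exists2 y, Gamma y & shad om C g0 y && shad om C g y >].
pose s' := [seq g <- s | (g != g0) && ~~ meets g].
have s's : {subset s' <= s} by move=> g; rewrite mem_filter => /andP[].
case: (IH s').
- suff lt : (size s' < size s)%N by exact: leq_trans lt sm.
  rewrite size_filter -(count_predC (fun g => (g != g0) && ~~ meets g) s).
  rewrite -[X in (X < _)%N]addn0 ltn_add2l -has_count; apply/hasP; exists g0 => //=.
  by rewrite eqxx.
- by move=> g /s's; apply: sG.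
move=> A [uA As dA cA]; exists (g0 :: A); split.
- rewrite /= uA andbT; apply/negP => /As; rewrite mem_filter eqxx //.
- by move=> g; rewrite inE => /predU1P[->//|/As/s's].
- move=> g g' y Gy; rewrite !inE => /predU1P[->|gA] /predU1P[->|g'A]; rewrite ?eqxx //.
  + move=> _; apply/negP => my; have := As _ g'A; rewrite mem_filter => /andP[/andP[_]].
    by move/asboolP => + _; apply; exists y.
  + move=> _; apply/negP => my; have := As _ gA; rewrite mem_filter => /andP[/andP[_]].
    by move/asboolP => + _; apply; exists y; rewrite // andbC.
  + exact: dA.
- move=> g x Gx gs Sx.
  have [gs'|] := boolP (g \in s').
    by have [g' g'A ?] := cA _ _ Gx gs' Sx; exists g' => //; rewrite inE g'A orbT.
  rewrite mem_filter gs andbT negb_and !negbK => /orP[/eqP gg0|/asboolP[y Gy /andP[y1 y2]]].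
    exists g0; rewrite ?mem_head // -gg0; move: Sx => /asboolP Sx; apply/asboolP.
    exact: goodW Sx.
  exists g0; rewrite ?mem_head //; apply: (H g0 g y x) => //; try exact: sG.
  exact: g0min.
Qed.

End Shadows.

(** * Second moment estimate for the shadows of the elements g f b *)

Lemma indicator_or4 (R : realType) (a b c d : bool) :
  (a || b) || (c || d) -> 1 <= (a%:R + b%:R) + (c%:R + d%:R) :> R.
Proof. by case: a; case: b; case: c; case: d => //= _; lra. Qed.

Section Conical.
Variables (R : realType) (G : groupType) (I : finType) (Gamma : set G).
Variable om : I -> G -> R.
Hypothesis Gsub : is_subgroup Gamma.
Hypothesis om_sub : forall i g h, om i (g * h)%g <= om i g + om i h.
Hypothesis hyperb : forall C, exists C', forall a b c, Gamma a -> Gamma b -> Gamma c ->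
  good om C a^-1%g c -> good om C' a^-1%g b \/ good om C' b^-1%g c.
Variables (F : seq G) (Cf : R).
Hypothesis FG : forall f, f \in F -> Gamma f.
Hypothesis Cf0 : 0 <= Cf.
Hypothesis F_good : forall g h, Gamma g -> Gamma h ->
  exists2 f, f \in F & good om Cf g (f * h)%g.
Variables (phi : G -> R) (Lphi : R).
Hypothesis phi_quasi : quasi Gamma om Lphi phi.
Hypothesis phi_proper : forall T, exists X : seq G, forall x, Gamma x -> phi x <= T -> x \in X.
Hypothesis Lphi0 : 0 <= Lphi.

Let GM := subgroupM Gsub.
Let GV := subgroupV Gsub.

Lemma quasi_insert (L V : R) v f g b : 0 <= L -> quasi Gamma om L v ->
  (forall f, f \in F -> `|v f| <= V) -> Gamma g -> Gamma b -> f \in F ->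
  good om Cf g (f * b)%g ->
  `|v (g * (f * b))%g - v g - v b| <= L * (Cf + 1) + V + L * (\sum_(f <- F) gcst om f + 1).
Proof.
move=> L0 q vV Gg Gb fF gf.
have Gf := FG fF.
have := q Cf g (f * b)%g Cf0 Gg (GM Gf Gb) gf.
have := quasi_fin om_sub q Gf Gb.
have := vV _ fF.
have : L * gcst om f <= L * \sum_(f <- F) gcst om f.
  apply: ler_wpM2l => //; rewrite (big_rem f) //= lerDl sumr_ge0 // => y _.
  exact: gcst_ge0 om_sub _.
rewrite !ler_norml => ? /andP[? ?] /andP[? ?] /andP[? ?]; apply/andP; split; lra.
Qed.

(** Let N x be the number of g in E whose [h g] has x in its shadow. The union of these shadows has
    mass at least (sum of N)^2 / (sum of N^2). The first moment is at least of order exp(- v b) Q^2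
    and the second at most of order exp(- 2 v b) Q^3, so v b cancels: only the threshold m depends
    on b. *)
Lemma conical (L V : R) : 0 <= L -> 0 <= V -> exists2 c0, 0 < c0 &
  forall b, Gamma b -> exists m : nat, forall (v : G -> R) (Q : R) (E : seq G),
  quasi Gamma om L v -> (forall f, f \in F -> `|v f| <= V) ->
  wbound Gamma v Q -> finG Gamma E -> Q <= 2 * wsum v E -> 0 < Q ->
  m%:R * expR (v b) <= Q ->
  exists (h : G -> G) (Y : seq G), [/\ finG Gamma Y,
    forall g, Gamma g -> exists f, [/\ f \in F, h g = (g * (f * b))%g
       & good om Cf g (f * b)%g]
    & c0 * Q <= \sum_(x <- Y | has (fun g => shad om Cf (h g) x) E) expR (- v x)].
Proof.
move=> L0 V0.
pose C2 := Cf + Cf.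
have C20 : 0 <= C2 by rewrite addr_ge0.
have CfC2 : Cf <= C2 by rewrite lerDl.
have [C3 C23 H3] := shadow_nested Gsub om_sub hyperb C20.
have C30 : 0 <= C3 by lra.
set cF := \sum_(f <- F) gcst om f.
have cF0 : 0 <= cF by apply: sumr_ge0 => y _; exact: gcst_ge0 om_sub _.
pose a1 := L * (Cf + 1) + V + L * (cF + 1).
pose a2 := L * (Cf + 1); pose a3 := L * (C3 + 1).
have a10 : 0 <= a1 by rewrite /a1 !addr_ge0 ?mulr_ge0 ?addr_ge0.
have a30 : 0 <= a3 by rewrite /a3 mulr_ge0 ?addr_ge0.
pose K0 := Klow om F Cf L V.
have K00 : 0 < K0.
  have [f fF _] := F_good (let: And3 H _ _ := Gsub in H) (let: And3 H _ _ := Gsub in H).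
  rewrite /K0 /Klow (big_rem f) //= ltr_pwDl ?mulr_gt0 ?expR_gt0 //.
  by apply: sumr_ge0 => y _; rewrite mulr_ge0 ?expR_ge0.
pose K5 := expR (a2 + 2 * a1 + a3).
have K50 : 0 < K5 by exact: expR_gt0.
pose k1 := expR (- a1) / (4 * K0).
have k10 : 0 < k1 by rewrite divr_gt0 ?expR_gt0 // mulr_gt0.
(* The value that optimizes the use of 2 m N <= m^2 + N^2 with m = tau y Q; the resulting c0 is k1^2
   / (4 K5). *)
pose tau := 4 * K5 / k1.
have tau0 : 0 < tau by rewrite divr_gt0 // mulr_gt0.
exists (4 * K5 / tau ^+ 2); first by rewrite divr_gt0 ?exprn_gt0 // mulr_gt0.
move=> b Gb.
have [pm pm0 pmP] := phi_lbound phi_proper.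
pose Vphi := \sum_(f <- F) `|phi f|.
have Vphi0 : 0 <= Vphi by apply: sumr_ge0.
have VphiP f : f \in F -> `|phi f| <= Vphi.
  by move=> fF; rewrite /Vphi (big_rem f) //= lerDl sumr_ge0.
(* Bounds phi (g2^-1 h g1) when g2 lies between g1 and h g1: phi b, the errors of one insertion and
   of two shadows, and the lower bound of phi at g1^-1 g2. *)
pose Tb := phi b + (Lphi * (Cf + 1) + Vphi + Lphi * (cF + 1)) + 2 * (Lphi * (C3 + 1)) + pm.
have [Xb XbP] := phi_proper Tb.
(* Bounds the number of g such that g'^-1 (g f b) is in Xb for some f in F, when g' is fixed. *)
exists (size Xb * size F)%N => v Q E q vV bQ [uE GE] QE Q0 mQ.
have [h hP] : exists h : G -> G, forall g, Gamma g -> exists f, [/\ f \in F,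
    h g = (g * (f * b))%g & good om Cf g (f * b)%g].
  have : forall g, exists x, Gamma g -> exists f, [/\ f \in F,
    x = (g * (f * b))%g & good om Cf g (f * b)%g].
    move=> g; have [Gg|nG] := pselect (Gamma g); last by exists g => /nG.
    by have [f fF gf] := F_good Gg Gb; exists (g * (f * b))%g => _; exists f.
  by move=> /choice[h hP]; exists h.
have Gh g : Gamma g -> Gamma (h g).
  by move=> Gg; have [f [fF -> _]] := hP g Gg; apply: GM => //; apply: GM => //; apply: FG.
pose Y := undup [seq (h g * z)%g | g <- E, z <- [seq (f * z)%g | f <- F, z <- E]].
have YP g f z : g \in E -> f \in F -> z \in E -> (h g * (f * z))%g \in Y.
  by move=> gE fF zE; rewrite mem_undup; apply/allpairsP; exists (g, (f * z)%g);
  split => //=; apply/allpairsP; exists (f, z).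
have finY : finG Gamma Y.
  split; first exact: undup_uniq.
  move=> x; rewrite mem_undup => /allpairsP[[g w] /= [gE + ->]].
  move=> /allpairsP[[f z] /= [fF zE ->]].
  by apply: GM; [apply/Gh/GE|apply: GM; [exact: FG|exact: GE]].
have [uY GY] := finY.
exists h, Y; split => //.
pose s g x := shad om Cf (h g) x.
pose S g := \sum_(x <- Y | s g x) expR (- v x).
pose W := wsum v E.
pose y := expR (- v b).
have y0 : 0 < y by exact: expR_gt0.
have hv g : Gamma g -> `|v (h g) - v g - v b| <= a1.
  move=> Gg; have [f [fF -> gf]] := hP g Gg.
  exact: (quasi_insert L0 q vV Gg Gb fF gf).
have W0 : 0 <= W by apply: sumr_ge0 => z _; exact: expR_ge0.
have WQ : W <= Q by apply: bQ.
have first_moment : k1 * y * Q ^+ 2 <= \sum_(g <- E) S g.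
  have A g : g \in E -> expR (- a1) * y * expR (- v g) * W <= K0 * S g.
    move=> gE; have Gg := GE _ gE.
    apply: (@le_trans _ _ (expR (- v (h g)) * W)).
      rewrite ler_wpM2r // -!expRD ler_expR; have := hv g Gg.
      by rewrite ler_norml => /andP[? ?]; lra.
    apply: (shadow_lower Gsub om_sub FG Cf0 F_good q _ (Gh _ Gg) _ finY _).
    - by move=> f fF; apply: le_trans (vV f fF); exact: ler_norm.
    - by split.
    - by move=> f z fF zE; apply: YP.
  have B : expR (- a1) * y * W ^+ 2 <= K0 * \sum_(g <- E) S g.
    have -> : expR (- a1) * y * W ^+ 2 = \sum_(g <- E) expR (- a1) * y * expR (- v g) * W.
      by rewrite -mulr_suml -mulr_sumr -/(wsum v E) -/W expr2 mulrA.
    by rewrite mulr_sumr big_seq [leRHS]big_seq; apply: ler_sum => g /A.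
  have C : Q ^+ 2 <= 4 * W ^+ 2.
    have -> : 4 * W ^+ 2 = (2 * W) ^+ 2 by ring.
    by rewrite ler_sqr ?nnegrE ?mulr_ge0 // ltW.
  rewrite -(ler_pM2l K00); apply: le_trans B.
  have -> : K0 * (k1 * y * Q ^+ 2) = expR (- a1) * y * (Q ^+ 2 / 4).
    rewrite /k1; field; exact/lt0r_neq0.
  by rewrite ler_wpM2l ?mulr_ge0 ?expR_ge0 //; lra.
(* If g' comes after g, then either g' lies beyond h g ([main]), or it lies between g and h g
   ([near]), which leaves boundedly many g for each g'. *)
pose main g g' := shad om C3 (h g) g'.
pose near g g' := (g'^-1 * h g)%g \in Xb.
have hshad g x : Gamma g -> s g x -> shad om C2 g x /\ shad om C2 (h g) x.
  move=> Gg sx; split.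
    rewrite /C2; apply: (shad_sub om_sub) sx; have [f [_ -> gf]] := hP g Gg.
    by rewrite shadE; apply/asboolP.
  by move: sx => /asboolP sx; apply/asboolP; exact: (goodW CfC2 sx).
have pair g g' x : g \in E -> g' \in E -> x \in Y -> s g x -> s g' x ->
    (main g g' || near g g') || (main g' g || near g' g).
  have key g1 g2 x1 : Gamma g1 -> Gamma g2 -> Gamma x1 -> s g1 x1 -> s g2 x1 ->
     shad om C3 g1 g2 -> main g1 g2 || near g1 g2.
    move=> G1 G2 Gx s1 s2 S12.
    have [_ s1'] := hshad _ _ G1 s1; have [s2' _] := hshad _ _ G2 s2.
    case: (H3 _ _ _ (Gh _ G1) G2 Gx s1' s2') => T12; first by rewrite /main T12.
    apply/orP; right; apply: XbP; first by apply: GM => //; [exact: GV|exact: Gh].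
    move: T12 => /asboolP T12; move: S12 => /asboolP S12.
    have := phi_quasi C30 G2 (GM (GV G2) (Gh _ G1)) T12.
    have := phi_quasi C30 G1 (GM (GV G1) G2) S12.
    have [f [fF hE gf]] := hP g1 G1.
    have := quasi_insert Lphi0 phi_quasi VphiP G1 Gb fF gf.
    rewrite -hE !mulVKg.
    have := pmP (g1^-1 * g2)%g (GM (GV G1) G2).
    by rewrite !ler_norml -/cF => ? /andP[? ?] /andP[? ?] /andP[? ?]; rewrite /Tb; lra.
  move=> gE g'E xY s1 s2; have Gg := GE _ gE; have Gg' := GE _ g'E; have Gx := GY _ xY.
  have [t1 _] := hshad _ _ Gg s1; have [t2 _] := hshad _ _ Gg' s2.
  case: (H3 _ _ _ Gg Gg' Gx t1 t2) => T12.
    by rewrite (key g g' x).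
  by rewrite (key g' g x) ?orbT.
have Sle g : g \in E -> S g <= expR (a2 + a1) * y * expR (- v g) * Q.
  move=> gE; have Gg := GE _ gE.
  apply: le_trans (shadow_upper Gsub q bQ Cf0 (Gh _ Gg) finY) _.
  rewrite ler_wpM2r ?(ltW Q0) // -!expRD ler_expR; have := hv g Gg.
  by rewrite ler_norml /a2 => /andP[? ?]; lra.
have S0 g : 0 <= S g by apply: sumr_ge0 => z _; exact: expR_ge0.
pose X2 := \sum_(x <- Y) expR (- v x) * (\sum_(g <- E) (s g x)%:R) ^+ 2.
have X2_split : X2 <= 2 * (\sum_(g <- E) \sum_(g' <- E | main g g') S g'
                         + \sum_(g <- E) \sum_(g' <- E | near g g') S g').
  have -> : X2 = \sum_(g <- E) \sum_(g' <- E) \sum_(x <- Y) expR (- v x) * ((s g x)%:R * (s g' x)%:R).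
    under [RHS]eq_bigr do rewrite exchange_big /=.
    rewrite exchange_big /=; apply: eq_bigr => x _.
    by rewrite expr2 mulr_suml mulr_sumr; apply: eq_bigr => g _; rewrite -mulr_sumr -mulr_sumr.
  (* Symmetrization: a pair with a common point is [main] or [near] in one of the two orders, and
     the double sum over E is symmetric. *)
  pose Z g g' := ((main g g')%:R + (near g g')%:R) * S g' : R.
  have -> : 2 * (\sum_(g <- E) \sum_(g' <- E | main g g') S g'
                         + \sum_(g <- E) \sum_(g' <- E | near g g') S g')
     = \sum_(g <- E) \sum_(g' <- E) (Z g g' + Z g' g).
    have -> : \sum_(g <- E) \sum_(g' <- E) (Z g g' + Z g' g)
       = 2 * \sum_(g <- E) \sum_(g' <- E) Z g g'.
      under eq_bigr do rewrite big_split /=.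
      rewrite big_split /= [X in _ + X]exchange_big /=; ring.
    congr (_ * _); rewrite -big_split /=; apply: eq_bigr => g _.
    rewrite big_mkcond [X in _ + X]big_mkcond -big_split /=; apply: eq_bigr => g' _.
    by rewrite /Z mulrDl; congr (_ + _); case: ifP; rewrite ?mul1r ?mul0r.
  rewrite big_seq [leRHS]big_seq; apply: ler_sum => g gE.
  rewrite big_seq [leRHS]big_seq; apply: ler_sum => g' g'E.
  have SE a : S a = \sum_(x <- Y) expR (- v x) * (s a x)%:R.
    rewrite /S big_mkcond; apply: eq_bigr => x _.
    by case: ifP; rewrite ?mulr1 ?mulr0.
  rewrite /Z !SE !mulr_sumr -big_split /= [leLHS]big_seq [leRHS]big_seq.
  apply: ler_sum => x xY.
  rewrite [X in _ <= X + _]mulrCA [X in _ <= _ + X]mulrCA -mulrDr ler_wpM2l ?expR_ge0 //.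
  case sg: (s g x); case sg': (s g' x); rewrite ?mulr0 ?mul0r ?mulr1 //;
    rewrite ?addr_ge0 ?ler0n //.
  have := pair _ _ _ gE g'E xY sg sg'.
  by move/(indicator_or4 R).
have Xmain : \sum_(g <- E) \sum_(g' <- E | main g g') S g' <= K5 * y ^+ 2 * Q ^+ 3.
  have A g : g \in E -> \sum_(g' <- E | main g g') S g'
     <= K5 * y ^+ 2 * Q ^+ 2 * expR (- v g).
    move=> gE; have Gg := GE _ gE.
    apply: (@le_trans _ _ (expR (a2 + a1) * y * Q * \sum_(g' <- E | main g g') expR (- v g'))).
      rewrite mulr_sumr big_seq_cond [leRHS]big_seq_cond; apply: ler_sum => g' /andP[g'E _].
      by apply: le_trans (Sle _ g'E) _; rewrite -!mulrA [Q * _]mulrC.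
    have := shadow_upper Gsub q bQ C30 (Gh _ Gg) (conj uE GE).
    rewrite -/(main g) => U.
    apply: le_trans (ler_wpM2l _ U) _.
      by rewrite !mulr_ge0 ?expR_ge0 // ltW.
    have -> : K5 * y ^+ 2 * Q ^+ 2 * expR (- v g)
        = expR (a2 + a1) * y * Q * (expR (a3 + a1) * y * expR (- v g) * Q).
      have -> : K5 = expR (a2 + a1) * expR (a3 + a1) by rewrite -expRD; congr expR; ring.
      by ring.
    rewrite ler_wpM2l ?mulr_ge0 ?expR_ge0 // ?(ltW Q0) //.
    rewrite ler_wpM2r ?(ltW Q0) // -!expRD ler_expR.
    by have := hv g Gg; rewrite ler_norml => /andP[? ?]; rewrite /a3; lra.
  apply: (@le_trans _ _ (K5 * y ^+ 2 * Q ^+ 2 * W)).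
    by rewrite /W /wsum mulr_sumr big_seq [leRHS]big_seq; apply: ler_sum => g /A.
  by rewrite [Q ^+ 3]exprSr mulrA ler_wpM2l // !mulr_ge0 ?exprn_ge0 ?(ltW Q0) ?(ltW y0) ?(ltW K50).
have Xnear : \sum_(g <- E) \sum_(g' <- E | near g g') S g' <= K5 * y ^+ 2 * Q ^+ 3.
  rewrite (eq_bigr _ (fun g _ => big_mkcond _ _)) exchange_big /=.
  set mb := (size Xb * size F)%N in mQ *.
  have A g' : g' \in E -> \sum_(g <- E) (if near g g' then S g' else 0) <= mb%:R * S g'.
    move=> g'E; rewrite -big_mkcond /=; apply: sum_indicator_le => // t ut tE tn.
    rewrite /mb -(size_allpairs (fun xi f => (g' * xi * b^-1 * f^-1)%g)).
    apply: uniq_leq_size => // g gt.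
    have gn := allP tn _ gt; have [f [fF hg _]] := hP _ (GE _ (tE _ gt)).
    apply/allpairsP; exists ((g'^-1 * h g)%g, f); split => //=.
    by rewrite mulVKg hg !mulgA !mulgK.
  apply: (@le_trans _ _ (\sum_(g' <- E) (mb%:R * (expR (a2 + a1) * y * Q)) * expR (- v g'))).
    rewrite big_seq [leRHS]big_seq; apply: ler_sum => g' g'E.
    apply: le_trans (A _ g'E) _; rewrite -mulrA ler_wpM2l //.
    by apply: le_trans (Sle _ g'E) _; rewrite -!mulrA [Q * _]mulrC.
  rewrite -mulr_sumr -/(wsum v E) -/W.
  apply: (@le_trans _ _ ((mb%:R * (expR (a2 + a1) * y * Q)) * Q)).
    by rewrite ler_wpM2l // !mulr_ge0 ?expR_ge0 // ltW.
  (* The only use of the size of Q: it makes the near pairs contribute no more than the main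
     ones. *)
  have mQ' : mb%:R <= Q * y by rewrite -ler_pdivrMr // /y expRN invrK.
  apply: (@le_trans _ _ (((Q * y) * (expR (a2 + a1) * y * Q)) * Q)).
    by rewrite ler_wpM2r ?(ltW Q0) // ler_wpM2r // !mulr_ge0 ?expR_ge0 // ltW.
  have -> : Q * y * (expR (a2 + a1) * y * Q) * Q = expR (a2 + a1) * y ^+ 2 * Q ^+ 3 by ring.
  by rewrite ler_wpM2r ?exprn_ge0 ?(ltW Q0) // ler_wpM2r ?exprn_ge0 ?(ltW y0) // ler_expR; lra.
have X2_le : X2 <= 4 * K5 * y ^+ 2 * Q ^+ 3 by lra.
set U := \sum_(x <- Y | _) _.
pose m := tau * y * Q.
(* Cauchy-Schwarz in the form 2 m N <= m^2 + N^2, the term m^2 being counted only where N > 0. *)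
have cs : 2 * m * \sum_(g <- E) S g <= m ^+ 2 * U + X2.
  have -> : \sum_(g <- E) S g = \sum_(x <- Y) expR (- v x) * \sum_(g <- E) (s g x)%:R.
    under [RHS]eq_bigr do rewrite mulr_sumr.
    rewrite exchange_big /=; apply: eq_bigr => g _.
    rewrite /S big_mkcond; apply: eq_bigr => x _; by case: ifP; rewrite ?mulr1 ?mulr0.
  rewrite /U /X2 [X in _ <= _ * X + _]big_mkcond /= !mulr_sumr -big_split /=; apply: ler_sum => x _.
  case: ifPn => [_|/hasPn nh].
    rewrite -subr_ge0.
    set N := \sum_(g <- E) _; set e := expR _.
    have -> : m ^+ 2 * e + e * N ^+ 2 - 2 * m * (e * N) = e * (m - N) ^+ 2 by ring.
    by rewrite mulr_ge0 ?expR_ge0 ?sqr_ge0.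
  rewrite [X in _ * (_ * X) <= _]big_seq big1 ?mulr0; last first.
    by move=> g /nh; rewrite -/(s g x) => /negbTE ->.
  by rewrite add0r mulr_ge0 ?expR_ge0 ?sqr_ge0.
have m0 : 0 < m by exact: (mulr_gt0 (mulr_gt0 tau0 y0) Q0).
have yQ : 0 < y ^+ 2 * Q ^+ 2 by rewrite mulr_gt0 ?exprn_gt0.
rewrite [leLHS]mulrAC ler_pdivrMr ?exprn_gt0 //.
rewrite -(ler_pM2r yQ).
have e1 : 2 * m * (k1 * y * Q ^+ 2) = 8 * K5 * Q * (y ^+ 2 * Q ^+ 2).
  rewrite /m /tau; field; exact/lt0r_neq0.
have e2 : m ^+ 2 * U = U * tau ^+ 2 * (y ^+ 2 * Q ^+ 2) by rewrite /m; ring.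
have e3 : 4 * K5 * y ^+ 2 * Q ^+ 3 = 4 * K5 * Q * (y ^+ 2 * Q ^+ 2) by ring.
have : 2 * m * (k1 * y * Q ^+ 2) <= 2 * m * \sum_(g <- E) S g.
  by rewrite ler_wpM2l // mulr_ge0 // ltW.
rewrite e1 -e2; rewrite e3 in X2_le.
have -> : 4 * K5 * Q * (y ^+ 2 * Q ^+ 2) = 8 * K5 * Q * (y ^+ 2 * Q ^+ 2)
    - 4 * K5 * Q * (y ^+ 2 * Q ^+ 2) by ring.
lra.
Qed.

End Conical.

(** * Boundedness of psi on the group *)

Lemma norm_ge_insert (R : realDomainType) (x y z B K : R) :
  `|x - y - z| <= K -> 2 * B + K < `|z| -> `|y| < B -> B <= `|x|.
Proof.
move=> xK zB yB; have := ler_normD (x - y - z) (- x).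
have := ler_normD (x - y - z - x) y.
have -> : x - y - z - x + y = - z by ring.
by rewrite !normrN; lra.
Qed.

Lemma expR_scale_le (R : realType) (s r y a c : R) : 1 <= s -> 0 <= a -> a <= c ->
  expR (- a) <= r -> expR (- (s * (y + c))) <= r * expR (- (s * y)).
Proof.
move=> s1 a0 ac ar; apply: (@le_trans _ _ (expR (- a) * expR (- (s * y)))).
  rewrite -expRD ler_expR; have : 0 <= (s - 1) * c by rewrite mulr_ge0 //; lra.
  by move=> ?; lra.
by rewrite ler_wpM2r ?expR_ge0.
Qed.

Section Rigidity.
Variables (R : realType) (G : groupType) (I : finType) (Gamma : set G).
Variable om : I -> G -> R.
Hypothesis Gsub : is_subgroup Gamma.
Hypothesis om_sub : forall i g h, om i (g * h)%g <= om i g + om i h.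

(** Q is the least upper bound of the finite sums and E attains half of it; this makes the upper
    estimates, in Q, comparable with the lower ones, in the sum over E. *)
Lemma wbound_sup (v : G -> R) Q0 : wbound Gamma v Q0 ->
  exists Q E, [/\ wbound Gamma v Q, finG Gamma E, Q <= 2 * wsum v E & 0 < Q :> R].
Proof.
move=> bQ0; pose A := [set wsum v E | E in finG Gamma]%classic.
have G1 : finG Gamma [:: 1%g].
  by split => // x; rewrite inE => /eqP ->; case: Gsub.
have w1 : 0 < wsum v [:: 1%g] by rewrite /wsum big_seq1 expR_gt0.
have supA : has_sup A.
  split; first by exists (wsum v [:: 1%g]), [:: 1%g].
  by exists Q0 => _ [E fE <-]; apply: bQ0.
have bs : wbound Gamma v (sup A).
  by move=> E fE; apply: ub_le_sup; [case: supA|exists E].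
have s0 : 0 < sup A by apply: lt_le_trans w1 (bs _ G1).
have s20 : 0 < sup A / 2 by rewrite divr_gt0.
have [_ [E fE <-] lt] := sup_adherent s20 supA.
by exists (sup A), E; split => //; lra.
Qed.

(** k elements with phi <= T would contribute at least k exp(- T) to the sum. *)
Lemma wbound_proper (phi : G -> R) Q : wbound Gamma phi Q -> forall T, exists X : seq G,
  forall x, Gamma x -> phi x <= T -> x \in X.
Proof.
move=> bQ T; apply: contrapT => nX.
have H (k : nat) : exists E, [/\ finG Gamma E, size E = k & forall x, x \in E -> phi x <= T].
  elim: k => [|k [E [[uE GE] sE TE]]]; first by exists [::]; split.
  have [x [Gx xT xE]] : exists x, [/\ Gamma x, phi x <= T & x \notin E].
    apply: contrapT => nx; apply: nX; exists E => x Gx xT; apply/negPn/negP => xE.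
    by apply: nx; exists x.
  exists (x :: E); split; rewrite /= ?sE //.
    split; first by rewrite /= xE.
    by move=> y; rewrite inE => /predU1P[->//|/GE].
  by move=> y; rewrite inE => /predU1P[->//|/TE].
pose k := Num.bound `|Q * expR T|.
have [E [fE sE TE]] := H k.
have := bQ E fE; apply/negP; rewrite -ltNge.
apply: (@lt_le_trans _ _ (k%:R * expR (- T))).
  rewrite expRN ltr_pdivlMr ?expR_gt0 //.
  by apply: le_lt_trans (ler_norm _) _; apply: archi_boundP.
rewrite /wsum -sE big_seq.
apply: (@le_trans _ _ (\sum_(i <- E | i \in E) expR (- T))).
  rewrite -big_seq big_const_seq count_predT iter_addr_0 -[X in _ <= X]mulr_natl.
  by rewrite ler_wpM2r ?expR_ge0.
by apply: ler_sum => x /TE; rewrite ler_expR; lra.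
Qed.

Variables (F : seq G) (Cf : R).
Hypothesis FG : forall f, f \in F -> Gamma f.
Hypothesis Cf0 : 0 <= Cf.
Hypothesis F_good : forall g h, Gamma g -> Gamma h ->
  exists2 f, f \in F & good om Cf g (f * h)%g.

(** Each shadow carries at least exp(- v p) / Klow times the mass of E, and disjoint shadows share a
    mass at most twice that of E. The mass cancels, so the bound stays uniform as the exponent tends
    to the critical one. *)
Lemma disjoint_shadows_sum (L V : R) v Q0 A : quasi Gamma om L v ->
  (forall f, f \in F -> v f <= V) -> wbound Gamma v Q0 -> finG Gamma A ->
  (forall g g' y, Gamma y -> g \in A -> g' \in A -> g != g' ->
       ~~ (shad om Cf g y && shad om Cf g' y)) ->
  \sum_(p <- A) expR (- v p) <= 2 * Klow om F Cf L V.
Proof.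
move=> q vV bQ0 [uA GA] dA.
have [Q [E [bQ fE QE Q0p]]] := wbound_sup bQ0; have [uE GE] := fE.
have W0 : 0 < wsum v E by lra.
have K0 : 0 <= Klow om F Cf L V.
  by apply: sumr_ge0 => f _; rewrite mulr_ge0 ?expR_ge0.
pose Y := undup [seq (p * z)%g | p <- A, z <- [seq (f * z)%g | f <- F, z <- E]].
have fY : finG Gamma Y.
  split; first exact: undup_uniq.
  move=> x; rewrite mem_undup => /allpairsP[[p w] /= [pA + ->]].
  move=> /allpairsP[[f z] /= [fF zE ->]].
  by apply: (subgroupM Gsub); [exact: GA|apply: (subgroupM Gsub); [exact: FG|exact: GE]].
rewrite -(ler_pM2r W0) mulr_suml.
apply: (@le_trans _ _ (Klow om F Cf L V * Q)); last first.
  by rewrite [2 * _]mulrC -mulrA ler_wpM2l.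
apply: (@le_trans _ _ (\sum_(p <- A) Klow om F Cf L V * \sum_(x <- Y | shad om Cf p x) expR (- v x))).
  rewrite big_seq [leRHS]big_seq; apply: ler_sum => p pA.
  apply: (shadow_lower Gsub om_sub FG Cf0 F_good q vV (GA _ pA) fE fY) => f z fF zE.
  rewrite mem_undup; apply/allpairsP; exists (p, (f * z)%g); split => //=.
  by apply/allpairsP; exists (f, z).
rewrite -mulr_sumr ler_wpM2l //; apply: le_trans (bQ _ fY).
rewrite (eq_bigr _ (fun p _ => big_mkcond _ _)) exchange_big /= /wsum.
rewrite big_seq [leRHS]big_seq; apply: ler_sum => x xY; rewrite -big_mkcond /=.
have [/hasP[p pA px]|/hasPn n] := boolP (has (fun p => shad om Cf p x) A); last first.
  by rewrite big_seq_cond big_pred0 ?expR_ge0 // => p; apply/negP => /andP[/n/negP].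
rewrite big_mkcond (bigD1_seq p) //= px big_seq_cond big1 ?addr0 // => p' /andP[p'A p'p].
case: ifP => // p'x; have := dA _ _ _ (fY.2 _ xY) pA p'A; rewrite eq_sym p'p px p'x.
by move=> /(_ isT).
Qed.

Hypothesis hyperb : forall C, exists C', forall a b c, Gamma a -> Gamma b -> Gamma c ->
  good om C a^-1%g c -> good om C' a^-1%g b \/ good om C' b^-1%g c.

Variables (phi1 phi2 : G -> R) (L lam : R).
Hypothesis L0 : 0 <= L.
Hypothesis q1 : quasi Gamma om L phi1.
Hypothesis q2 : quasi Gamma om L phi2.
Hypothesis lam01 : 0 < lam < 1.
Let phi g := lam * phi1 g + (1 - lam) * phi2 g.
Hypothesis sum1 : forall s, 1 < s -> exists Q, wbound Gamma (fun g => s * phi1 g) Q.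
Hypothesis sum2 : forall s, 1 < s -> exists Q, wbound Gamma (fun g => s * phi2 g) Q.
Hypothesis diverges : forall M, exists2 E, finG Gamma E & M <= wsum phi E.

Lemma quasi_comb a c : `|a| + `|c| <= 2 ->
  quasi Gamma om (2 * L) (fun g => a * phi1 g + c * phi2 g).
Proof.
move=> ac C g h C0 Gg Gh gh.
have A1 := q1 C0 Gg Gh gh; have A2 := q2 C0 Gg Gh gh.
have -> : a * phi1 (g * h)%g + c * phi2 (g * h)%g - (a * phi1 g + c * phi2 g)
   - (a * phi1 h + c * phi2 h) = a * (phi1 (g * h)%g - phi1 g - phi1 h)
    + c * (phi2 (g * h)%g - phi2 g - phi2 h) by ring.
apply: le_trans (ler_normD _ _) _; rewrite !normrM.
apply: (@le_trans _ _ ((`|a| + `|c|) * (L * (C + 1)))).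
  by rewrite mulrDl lerD // ler_wpM2l.
by rewrite -mulrA ler_wpM2r // mulr_ge0 // addr_ge0.
Qed.

(** A convex combination is at least the minimum, hence exp(- s phi) <= exp(- s phi1) + exp(- s
    phi2). *)
Lemma phi_summable s : 1 < s -> exists Q, wbound Gamma (fun g => s * phi g) Q.
Proof.
move=> s1; have /andP[l1 l2] := lam01; have [Q1 b1] := sum1 s1; have [Q2 b2] := sum2 s1.
exists (Q1 + Q2) => E fE; apply: le_trans (lerD (b1 _ fE) (b2 _ fE)).
rewrite /wsum -big_split /=; apply: ler_sum => x _.
have [le|le] := leP (phi1 x) (phi2 x).
  apply: ler_wpDr; rewrite ?expR_ge0 // ler_expR lerN2 ler_wpM2l //; first by lra.
  have : (1 - lam) * phi1 x <= (1 - lam) * phi2 x by rewrite ler_wpM2l //; lra.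
  by rewrite /phi; lra.
apply: ler_wpDl; rewrite ?expR_ge0 // ler_expR lerN2 ler_wpM2l //; first by lra.
have : lam * phi2 x <= lam * phi1 x by rewrite ler_wpM2l //; lra.
by rewrite /phi; lra.
Qed.

Lemma ratio_bounded : exists B, forall b, Gamma b -> `|phi1 b - phi2 b| <= B.
Proof.
pose V0 := \sum_(f <- F) (`|phi1 f| + `|phi2 f|).
have V00 : 0 <= V0 by apply: sumr_ge0 => f _; rewrite addr_ge0.
have V0P f : f \in F -> `|phi1 f| + `|phi2 f| <= V0.
  by move=> fF; rewrite /V0 (big_rem f) //= lerDl sumr_ge0 // => g _; rewrite addr_ge0.
have VP a c f : f \in F -> `|a| + `|c| <= 2 -> `|a * phi1 f + c * phi2 f| <= 2 * V0.
  move=> fF ac; apply: le_trans (ler_normD _ _) _; rewrite !normrM.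
  have := V0P f fF; have := normr_ge0 (phi1 f); have := normr_ge0 (phi2 f).
  have := normr_ge0 a; have := normr_ge0 c; nra.
have sphi s : (fun g => s * phi g) = (fun g => (s * lam) * phi1 g + (s * (1 - lam)) * phi2 g).
  by apply: funext => g; rewrite /phi; ring.
have l1 : 0 < lam by case/andP: lam01.
have l2 : 0 < 1 - lam by case/andP: lam01; lra.
have sle s : 0 <= s <= 2 -> `|s * lam| + `|s * (1 - lam)| <= 2.
  case/andP => s0 s2; rewrite !ger0_norm ?mulr_ge0 ?(ltW l1) ?(ltW l2) //; lra.
have q s : 0 <= s <= 2 -> quasi Gamma om (2 * L) (fun g => s * phi g).
  by move=> /sle sl; rewrite sphi; apply: quasi_comb.
have L20 : 0 <= 2 * L by rewrite mulr_ge0.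
have V20 : 0 <= 2 * V0 by rewrite mulr_ge0.
have qphi : quasi Gamma om (2 * L) phi.
  have -> : phi = (fun g => 1 * phi g) by apply: funext => g; rewrite mul1r.
  by apply: q; rewrite ler01 ler1n.
have proper : forall T, exists X : seq G, forall x, Gamma x -> phi x <= T -> x \in X.
  move=> T; have [Q bQ] := @phi_summable 2 ltac:(lra).
  have [X XP] := wbound_proper bQ (2 * T); exists X => x Gx xT; apply: XP => //; lra.
have [c0 c00 cone] := @conical R G I Gamma om Gsub om_sub hyperb F Cf FG Cf0 F_good
   phi (2 * L) qphi proper L20 (2 * L) (2 * V0) L20 V20.
pose C2 := Cf + Cf.
have C20 : 0 <= C2 by rewrite addr_ge0.
have CfC2 : Cf <= C2 by rewrite lerDl.
have [C' CC' vit] := @vitali R G I Gamma om Gsub om_sub hyperb phi (2 * L) qphi proper _ C20.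
have C'0 : 0 <= C' by lra.
pose K := expR (2 * L * (C' + 1)).
pose K0 := 1 + Klow om F Cf (2 * L) (2 * V0).
have K0p : 0 < K0.
  rewrite /K0 ltr_pwDl //.
  by apply: sumr_ge0 => f _; rewrite mulr_ge0 ?expR_ge0.
have Kp : 0 < K by exact: expR_gt0.
(* Makes twice the bound of [half], one for each sign of psi, smaller than c0 Q. *)
pose r := c0 / (8 * K * K0).
have rp : 0 < r by rewrite divr_gt0 // !mulr_gt0.
pose mu := Num.min lam (1 - lam).
have mup : 0 < mu by rewrite lt_min l1 l2.
(* Where |psi| >= Bs, phi exceeds the smaller of phi1 and phi2 by at least mu Bs, which gains the
   factor r on the exponentials. *)
pose Bs := `|ln r| / mu.
have Bs0 : 0 <= Bs by rewrite divr_ge0 // ltW.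
have muBs : expR (- (mu * Bs)) <= r.
  rewrite -[leRHS](lnK rp) ler_expR /Bs mulrCA divff ?mulr1 ?lt0r_neq0 //.
  by have := ler_norm (- ln r); rewrite normrN; lra.
pose K6 := 2 * L * (Cf + 1) + 2 * V0 + 2 * L * (\sum_(f <- F) gcst om f + 1).
exists (2 * Bs + K6) => b Gb; rewrite leNgt; apply/negP => psib.
have [m {}cone] := cone b Gb.
(* 2 |phi b| dominates s phi b for all s in (1, 2], so the threshold can be fixed before s. *)
pose M := m%:R * expR (2 * `|phi b|) + 1.
have M0 : 0 < M by rewrite /M ltr_wpDl ?mulr_ge0 ?expR_ge0.
have [E0 fE0 ME0] := diverges (2 * M).
(* With s = 1 + 1 / dd, (s - 1) phi <= 1 / 2 on E0, so the sum over E0 keeps at least half of its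
   value at exponent 1. *)
pose dd := 2 * (1 + \sum_(x <- E0) `|phi x|).
have dd2 : 2 <= dd.
  have : 0 <= \sum_(x <- E0) `|phi x| by apply: sumr_ge0.
  by rewrite /dd => ?; lra.
pose s := 1 + dd^-1.
have dd0 : 0 < dd by exact: lt_le_trans dd2.
have ddV : 0 < dd^-1 <= 1 by rewrite invr_gt0 dd0 invf_le1 // (le_trans _ dd2) // ler1n.
have s1 : 1 < s by rewrite /s ltrDl; case/andP: ddV.
have s02 : 0 <= s <= 2.
  rewrite (le_trans ler01 (ltW s1)) /= /s mulr2n lerD2l; by case/andP: ddV.
have ME : M <= wsum (fun g => s * phi g) E0.
  have p2 : 0 < 2 :> R by [].
  rewrite -(ler_pM2l p2).
  apply: le_trans ME0 _; rewrite /wsum mulr_sumr big_seq [leRHS]big_seq.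
  apply: ler_sum => x xE.
  have -> : - (s * phi x) = - (dd^-1 * phi x) + - phi x by rewrite /s; ring.
  rewrite expRD mulrA -[leLHS]mul1r ler_wpM2r ?expR_ge0 //.
  have : dd^-1 * phi x <= 1 / 2.
    rewrite mulrC ler_pdivrMr // /dd mulrA mul1r mulVf // mul1r.
    have le : `|phi x| <= \sum_(x <- E0) `|phi x| by rewrite (big_rem x) //= lerDl sumr_ge0.
    by apply: le_trans (ler_norm _) (le_trans le _); rewrite lerDr.
  by have := expR_ge1Dx (- (dd^-1 * phi x)); lra.
have [Q00 bQ00] := phi_summable s1.
have [Q [E [bQ fE QE Q0]]] := wbound_sup bQ00.
have MQ : M <= Q by apply: le_trans ME (bQ _ fE0).
have mQ : m%:R * expR (s * phi b) <= Q.
  apply: le_trans MQ; rewrite /M; apply: (@le_trans _ _ (m%:R * expR (2 * `|phi b|))); last by rewrite lerDl.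
  rewrite ler_wpM2l // ler_expR; have := ler_norm (phi b); have := normr_ge0 (phi b).
  by case/andP: s02; nra.
have vV f : f \in F -> `|s * phi f| <= 2 * V0.
  move=> fF; have -> : s * phi f = (s * lam) * phi1 f + (s * (1 - lam)) * phi2 f by rewrite /phi; ring.
  by apply: VP => //; apply: sle.
have [h [Y [fY hP big]]] := cone _ _ _ (q _ s02) vV bQ fE QE Q0 mQ.
have Gh g : Gamma g -> Gamma (h g).
  move=> Gg; have [f [fF -> _]] := hP g Gg.
  by apply: (subgroupM Gsub) => //; apply: (subgroupM Gsub) => //; apply: FG.
pose psi g := phi1 g - phi2 g.
have psiE g : psi g = 1 * phi1 g + (-1) * phi2 g by rewrite /psi; ring.
have n11 : `|1| + `|-1| <= 2 :> R by rewrite normrN1 normr1.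
pose Gs := E ++ map h E.
have GsG p : p \in Gs -> Gamma p.
  rewrite mem_cat => /orP[/(fE.2)//|/mapP[g gE ->]]; exact/Gh/fE.2.
(* psi (h g) is psi g + psi b up to K6 and |psi b| > 2 Bs + K6, so |psi| cannot be below Bs at both
   g and h g. *)
have cover x : x \in Y -> has (fun g => shad om Cf (h g) x) E ->
  exists p, [/\ p \in Gs, shad om C2 p x & Bs <= `|psi p|].
  move=> xY /hasP[g gE sx]; have Gg := fE.2 _ gE.
  have [f [fF hE gf]] := hP g Gg.
  have qpsi : quasi Gamma om (2 * L) psi.
    have -> : psi = (fun g => 1 * phi1 g + (-1) * phi2 g) by apply: funext.
    exact: quasi_comb.
  have psiV f' : f' \in F -> `|psi f'| <= 2 * V0 by move=> f'F; rewrite psiE; apply: VP.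
  have := quasi_insert Gsub om_sub FG Cf0 L20 qpsi psiV Gg Gb fF gf.
  rewrite -hE -/K6 => ins.
  have [le|lt] := leP Bs `|psi g|.
    exists g; rewrite mem_cat gE; split => //.
    rewrite /C2; apply: (shad_sub om_sub) sx.
    by rewrite hE shadE; apply/asboolP.
  exists (h g); rewrite mem_cat map_f ?orbT //; split => //.
    by move: sx => /asboolP sx; apply/asboolP; exact: (goodW CfC2 sx).
  exact: (norm_ge_insert ins psib lt).
(* The shadows of one sign of psi: a disjoint subfamily has enlarged shadows that cover them, the
   hypothesis trades phi for the smaller phi_j with the gain r, and [disjoint_shadows_sum] bounds
   what remains. *)
have half (P : pred G) (j : bool) :
   (forall p, p \in Gs -> P p -> expR (- (s * phi p)) <= r * expR (- (s * (if j then phi1 p else phi2 p)))) ->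
   \sum_(x <- Y | has (fun p => P p && shad om C2 p x) Gs) expR (- (s * phi x))
     <= K * r * (2 * Klow om F Cf (2 * L) (2 * V0)) * Q.
  move=> HP.
  have GPs p : p \in [seq p <- Gs | P p] -> Gamma p by rewrite mem_filter => /andP[_ /GsG].
  have [A [uA As dA cA]] := vit _ GPs.
  have GA p : p \in A -> Gamma p by move=> /As /GPs.
  apply: (@le_trans _ _ (\sum_(p <- A) \sum_(x <- Y | shad om C' p x) expR (- (s * phi x)))).
    rewrite [leRHS](eq_bigr _ (fun p _ => big_mkcond _ _)) exchange_big /=.
    rewrite big_mkcond big_seq [leRHS]big_seq; apply: ler_sum => x xY.
    case: ifPn => [/hasP[p pG /andP[Pp sp]]|_]; last first.
      by apply: sumr_ge0 => p _; case: ifP; rewrite ?expR_ge0.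
    have [p' p'A sp'] := cA p x (fY.2 _ xY) ltac:(by rewrite mem_filter Pp) sp.
    rewrite (big_rem p') //= sp' lerDl; apply: sumr_ge0 => p2 _.
    by case: ifP; rewrite ?expR_ge0.
  apply: (@le_trans _ _ (\sum_(p <- A) K * expR (- (s * phi p)) * Q)).
    rewrite big_seq [leRHS]big_seq; apply: ler_sum => p pA.
    by have := shadow_upper Gsub (q _ s02) bQ C'0 (GA _ pA) fY.
  rewrite -mulr_suml ler_wpM2r ?(ltW Q0) // -mulr_sumr -mulrA ler_wpM2l ?(ltW Kp) //.
  apply: (@le_trans _ _ (\sum_(p <- A) r * expR (- (s * (if j then phi1 p else phi2 p))))).
    rewrite big_seq [leRHS]big_seq; apply: ler_sum => p /As.
    by rewrite mem_filter => /andP[Pp pG]; apply: HP.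
  rewrite -mulr_sumr ler_wpM2l ?(ltW rp) //.
  have [Qj bQj] : exists Qj, wbound Gamma (fun p => s * (if j then phi1 p else phi2 p)) Qj.
    by case: (j); [exact: sum1|exact: sum2].
  have eqj : (fun p => s * (if j then phi1 p else phi2 p)) =
     (fun p => (if j then s else 0) * phi1 p + (if j then 0 else s) * phi2 p).
    by apply: funext => p; case: (j); rewrite mul0r ?addr0 ?add0r.
  have j2 : `|if j then s else 0| + `|if j then 0 else s| <= 2.
    by case/andP: s02 => ? ?; case: (j); rewrite normr0 ger0_norm // ?addr0 ?add0r.
  apply: (@disjoint_shadows_sum (2 * L) (2 * V0) _ Qj A) => //.
  - by rewrite eqj; apply: quasi_comb.
  - move=> f fF; have := congr1 (fun u => u f) eqj; rewrite /= => ->.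
    by apply: le_trans (ler_norm _) _; apply: VP.
  - move=> g g' y Gy gA g'A gg'; apply: contra (dA g g' y Gy gA g'A gg').
    by move=> /andP[/asboolP S1 /asboolP S2]; apply/andP; split; apply/asboolP; apply: goodW CfC2 _.
have mu1 : mu * Bs <= lam * Bs by rewrite ler_wpM2r // ge_min lexx.
have mu2 : mu * Bs <= (1 - lam) * Bs by rewrite ler_wpM2r // ge_min lexx orbT.
have muB0 : 0 <= mu * Bs by rewrite mulr_ge0 // ltW.
have scale x y c : Bs <= x -> 0 < c -> mu * Bs <= c * Bs ->
    expR (- (s * (y + c * x))) <= r * expR (- (s * y)).
  move=> Bx cp mc; apply: (expR_scale_le y (ltW s1) muB0 _ muBs).
  by apply: le_trans mc _; rewrite ler_wpM2l // ltW.
have hp : \sum_(x <- Y | has (fun p => (Bs <= psi p) && shad om C2 p x) Gs) expR (- (s * phi x))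
     <= K * r * (2 * Klow om F Cf (2 * L) (2 * V0)) * Q.
  apply: (half (fun p => Bs <= psi p) false) => p _ Bp /=.
  have -> : phi p = phi2 p + lam * psi p by rewrite /phi /psi; ring.
  exact: scale.
have hn : \sum_(x <- Y | has (fun p => (Bs <= - psi p) && shad om C2 p x) Gs) expR (- (s * phi x))
     <= K * r * (2 * Klow om F Cf (2 * L) (2 * V0)) * Q.
  apply: (half (fun p => Bs <= - psi p) true) => p _ Bp /=.
  have -> : phi p = phi1 p + (1 - lam) * (- psi p) by rewrite /phi /psi; ring.
  exact: scale.
have : c0 * Q <= K * r * (2 * Klow om F Cf (2 * L) (2 * V0)) * Q +
     K * r * (2 * Klow om F Cf (2 * L) (2 * V0)) * Q.
  apply: le_trans big _; apply: le_trans (lerD hp hn).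
  rewrite big_mkcond [X in _ <= X + _]big_mkcond [X in _ <= _ + X]big_mkcond -big_split /=.
  rewrite big_seq [leRHS]big_seq; apply: ler_sum => x xY.
  case: ifPn => [/(cover _ xY)[p [pG sp Bp]]|_]; last first.
    by rewrite addr_ge0 //; case: ifP; rewrite ?expR_ge0.
  have : (Bs <= psi p) || (Bs <= - psi p).
    by move: Bp; rewrite ler_normr.
  case/orP => Bp'.
    rewrite ifT; last by apply/hasP; exists p => //; rewrite Bp' sp.
    by rewrite lerDl; case: ifP; rewrite ?expR_ge0.
  rewrite [X in _ + X]ifT; last by apply/hasP; exists p => //; rewrite Bp' sp.
  by rewrite lerDr; case: ifP; rewrite ?expR_ge0.
rewrite -mulrDl ler_pM2r //; apply/negP; rewrite -ltNge.
have -> : c0 = K * r * (8 * K0).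
  by rewrite /r; field; rewrite !lt0r_neq0.
have -> : K * r * (2 * Klow om F Cf (2 * L) (2 * V0)) + K * r * (2 * Klow om F Cf (2 * L) (2 * V0))
   = K * r * (4 * (K0 - 1)) by rewrite /K0; ring.
rewrite (ltr_pM2l (mulr_gt0 Kp rp)); apply: (@lt_trans _ _ (4 * K0)).
  by rewrite ltr_pM2l // gtrBl.
by rewrite (ltr_pM2r K0p) ltr_nat.
Qed.

End Rigidity.

(** * Compound matrices and singular values *)

Section Compound.
Variables (C : fieldType) (d k : nat).
Local Notation T := {ffun 'I_k -> 'I_d}.

(** Rows and columns are selected by arbitrary maps, so Cauchy-Binet is a sum over all maps;
    noninjective ones give 0 and rearrangements only change the sign. *)
Definition minor (A : 'M[C]_d) (f g : T) : C := \det (\matrix_(i, j) A (f i) (g j)).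

Lemma minor_ninjl A (f g : T) : ~~ injectiveb f -> minor A f g = 0.
Proof.
case/injectivePn => i [j ij e].
by apply: (determinant_alternate ij) => l; rewrite !mxE e.
Qed.

Lemma minor_tr A (f g : T) : minor A^T f g = minor A g f.
Proof. by rewrite /minor -det_tr; congr (\det _); apply/matrixP => i j; rewrite !mxE. Qed.

Lemma minor_ninjr A (f g : T) : ~~ injectiveb g -> minor A f g = 0.
Proof. by move=> ng; rewrite -minor_tr minor_ninjl. Qed.

Lemma minor_perml A (f g : T) (s : 'S_k) :
  minor A [ffun i => f (s i)] g = (-1) ^+ s * minor A f g.
Proof.
rewrite /minor -det_perm -det_mulmx -row_permE; congr (\det _).
by apply/matrixP => i j; rewrite !mxE ffunE.
Qed.

Lemma minor_permr A (f g : T) (s : 'S_k) :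
  minor A f [ffun i => g (s i)] = (-1) ^+ s * minor A f g.
Proof. by rewrite -minor_tr minor_perml minor_tr. Qed.

(* The Cauchy-Binet formula, summed over all the maps from 'I_k to 'I_d rather
   than over the k-element subsets, hence the factor k`!. *)
Lemma minorM A B (f h : T) :
  (k`!)%:R * minor (A *m B) f h = \sum_g minor A f g * minor B g h.
Proof.
have E : minor (A *m B) f h = \sum_(g : T) (\prod_i A (f i) (g i)) * minor B g h.
  rewrite /minor.
  have -> : \matrix_(i, j) (A *m B) (f i) (h j) =
     (\matrix_(i < k, j < d) A (f i) j) *m (\matrix_(i < d, j < k) B i (h j)).
    by apply/matrixP => i j; rewrite !mxE; apply: eq_bigr => l _; rewrite !mxE.
  transitivity (\sum_(g : T) \sum_(s : 'S_k) (-1) ^+ s * \prod_i (A (f i) (g i) * B (g i) (h (s i)))).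
    rewrite exchange_big; apply: eq_bigr => /= s _; rewrite -big_distrr /=.
    congr (_ * _); rewrite -(bigA_distr_bigA (fun i j => A (f i) j * B j (h (s i)))) /=.
    by apply: eq_bigr => x _; rewrite mxE; apply: eq_bigr => l _; rewrite !mxE.
  apply: eq_bigr => g _; rewrite big_distrr /=; apply: eq_bigr => s _.
  rewrite mulrCA big_split //=; congr (_ * (_ * _)).
  by apply: eq_bigr => x _; rewrite !mxE.
(* The expansion E involves one product of entries of A for each g. Reindexing by s and summing over
   all s rebuilds the determinant of A, at the price of the factor k!. *)
have E' (s : 'S_k) : minor (A *m B) f h =
    \sum_(g : T) (-1) ^+ s * (\prod_i A (f i) (g (s i))) * minor B g h.
  pose u (g : T) : T := [ffun i => g (s i)].
  rewrite E (reindex u) /=; last first.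
    exists (fun g : T => [ffun i => g ((s^-1)%g i)]) => g _;
      by apply/ffunP => i; rewrite !ffunE ?permK ?permKV.
  apply: eq_bigr => g _; rewrite minor_perml mulrCA -mulrA.
  by congr (_ * (_ * _)); apply: eq_bigr => i _; rewrite ffunE.
have -> : (k`!)%:R * minor (A *m B) f h = \sum_(s : 'S_k) minor (A *m B) f h.
  by rewrite sumr_const card_Sn mulr_natl.
rewrite (eq_bigr _ (fun s _ => E' s)) exchange_big /=; apply: eq_bigr => g _.
rewrite -mulr_suml; congr (_ * _).
rewrite /minor; apply: eq_bigr => s _; congr (_ * _).
by apply: eq_bigr => i _; rewrite !mxE.
Qed.

Lemma minor_scale c A (f g : T) : minor (c *: A) f g = c ^+ k * minor A f g.
Proof.
by rewrite /minor -detZ; congr (\det _); apply/matrixP => i j; rewrite !mxE.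
Qed.

Lemma minor_diagl (a : 'rV[C]_d) A (f g : T) :
  minor (diag_mx a *m A) f g = (\prod_i a 0 (f i)) * minor A f g.
Proof.
rewrite /minor.
have -> : \matrix_(i, j) (diag_mx a *m A) (f i) (g j) =
   diag_mx (\row_i a 0 (f i)) *m \matrix_(i, j) A (f i) (g j).
  by apply/matrixP => i j; rewrite !mul_diag_mx !mxE.
rewrite det_mulmx det_diag; congr (_ * _).
by apply: eq_bigr => i _; rewrite mxE.
Qed.

Lemma minor_diagr (a : 'rV[C]_d) A (f g : T) :
  minor (A *m diag_mx a) f g = (\prod_i a 0 (g i)) * minor A f g.
Proof. by rewrite -minor_tr trmx_mul tr_diag_mx minor_diagl minor_tr. Qed.

Lemma minor1 (f : T) : injective f -> minor 1%:M f f = 1.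
Proof.
move=> fi; rewrite /minor.
have -> : \matrix_(i, j) (1%:M : 'M[C]_d) (f i) (f j) = 1%:M.
  by apply/matrixP => i j; rewrite !mxE (inj_eq fi).
exact: det1.
Qed.

Lemma same_image (f p : T) : injective f -> injective p ->
  [forall i, f i \in codom p] -> exists s : 'S_k, f = [ffun i => p (s i)].
Proof.
move=> fi pi /forallP im; pose u i := iinv (im i).
have uP i : p (u i) = f i by rewrite /u f_iinv.
have ui : injective u by move=> i j e; apply: fi; rewrite -!uP e.
by exists (perm ui); apply/ffunP => i; rewrite ffunE permE uP.
Qed.

End Compound.

Lemma map_minor (C C' : fieldType) (u : {rmorphism C -> C'}) d k (A : 'M[C]_d)
   (f g : {ffun 'I_k -> 'I_d}) : minor (map_mx u A) f g = u (minor A f g).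
Proof.
by rewrite /minor -det_map_mx; congr (\det _); apply/matrixP => i j; rewrite !mxE.
Qed.

Notation normc := ComplexField.Normc.normc.

Section ComplexModulus.
Variable R : realType.
Local Notation C := R[i].
Implicit Types z : C.

Lemma normc_ge0 z : 0 <= normc z.
Proof. by case: z => a b; rewrite sqrtr_ge0. Qed.

Lemma normc_eq0 z : (normc z == 0) = (z == 0).
Proof.
apply/eqP/eqP => [/(@ComplexField.Normc.eq0_normc R)//|->]; exact: ComplexField.Normc.normc0.
Qed.

Lemma normc_gt0 z : (0 < normc z) = (z != 0).
Proof. by rewrite lt_def normc_ge0 andbT normc_eq0. Qed.

Lemma normcM z z' : normc (z * z') = normc z * normc z'.
Proof. exact: ComplexField.Normc.normcM. Qed.

Lemma normc1 : normc (1 : C) = 1.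
Proof. exact: ComplexField.Normc.normc1. Qed.

Lemma normcX z m : normc (z ^+ m) = normc z ^+ m.
Proof. by elim: m => [|m IH]; rewrite ?expr0 ?normc1 // !exprS normcM IH. Qed.

Lemma normcR (x : R) : normc x%:C%C = `|x|.
Proof. by rewrite /= expr0n /= addr0 sqrtr_sqr. Qed.

Lemma normc_nat m : normc (m%:R : C) = m%:R.
Proof.
have -> : (m%:R : C) = (m%:R : R)%:C%C by rewrite rmorph_nat.
by rewrite normcR normr_nat.
Qed.

Lemma normcV z : normc z^-1 = (normc z)^-1.
Proof. exact: ComplexField.Normc.normcV. Qed.

Lemma normc_sign (s : bool) : normc ((-1) ^+ s : C) = 1.
Proof. by rewrite normcX (@complex.normcN R 1) normc1 expr1n. Qed.

Lemma normc_sum (I : Type) (r : seq I) (P : pred I) (F : I -> C) :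
  normc (\sum_(i <- r | P i) F i) <= \sum_(i <- r | P i) normc (F i).
Proof.
elim/big_ind2: _ => // [|x1 x2 y1 y2 H1 H2].
  by rewrite ComplexField.Normc.normc0.
by apply: le_trans (complex.le_normcD _ _) (lerD H1 H2).
Qed.

Lemma normc_prod (I : Type) (r : seq I) (P : pred I) (F : I -> C) :
  normc (\prod_(i <- r | P i) F i) = \prod_(i <- r | P i) normc (F i).
Proof. by apply: (big_morph _ normcM); exact: normc1. Qed.

Lemma normc_root1 z m : z ^+ m.+1 = 1 -> normc z = 1.
Proof.
move=> /(congr1 (@normc R)); rewrite normcX normc1 => /eqP.
by rewrite pexpr_eq1 ?normc_ge0 // => /eqP.
Qed.

Lemma mulJc z : z * z^* = ((normc z) ^+ 2)%:C%C.
Proof.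
case: z => a b /=; rewrite sqr_sqrtr ?addr_ge0 ?sqr_ge0 //.
by apply/eqP; rewrite eq_complex /=; apply/andP; split; apply/eqP; ring.
Qed.

Lemma Re_le_normc z : `|complex.Re z| <= normc z.
Proof.
case: z => a b /=; rewrite -sqrtr_sqr; apply: ler_wsqrtr.
by rewrite lerDl sqr_ge0.
Qed.

Lemma Im_le_normc z : `|complex.Im z| <= normc z.
Proof.
case: z => a b /=; rewrite -sqrtr_sqr; apply: ler_wsqrtr.
by rewrite lerDr sqr_ge0.
Qed.

Lemma unitary_entry d (U : 'M[C]_d) i j : U \is unitarymx -> normc (U i j) <= 1.
Proof.
move=> /unitarymxP /matrixP /(_ i i); rewrite !mxE eqxx => /(congr1 (@complex.Re R)) /= H.
have e : \sum_j (normc (U i j)) ^+ 2 = 1.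
  rewrite -[RHS]H raddf_sum; apply: eq_bigr => l _.
  by rewrite !mxE -[X in _ * X]/((U i l)^*) mulJc.
rewrite -(@expr_le1 _ 2) ?normc_ge0 // -e (bigD1 j) //= lerDl sumr_ge0 // => l _.
exact: sqr_ge0.
Qed.

End ComplexModulus.

Section CompoundNorm.
Variables (R : realType) (d k : nat).
Local Notation C := R[i].
Local Notation T := {ffun 'I_k -> 'I_d}.
Implicit Types (A B : 'M[C]_d) (f g : T).

(** A multiple of the entrywise 1-norm of the k-th compound matrix; with this factor, [minorM] makes
    it submultiplicative with constant 1. *)
Definition cnorm A : R := (k`!)%:R^-1 * \sum_(f : T) \sum_(g : T) normc (minor A f g).

Lemma fact_gt0R : 0 < (k`!)%:R :> R.
Proof. by rewrite ltr0n fact_gt0. Qed.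

Lemma cnorm_ge A f g : (k`!)%:R^-1 * normc (minor A f g) <= cnorm A.
Proof.
rewrite /cnorm ler_wpM2l ?invr_ge0 ?ler0n // (bigD1 f) //= (bigD1 g) //=.
rewrite -addrA lerDl addr_ge0 //; apply: sumr_ge0 => i _; first exact: normc_ge0.
by apply: sumr_ge0 => j _; exact: normc_ge0.
Qed.

Lemma cnorm_ge0 A : 0 <= cnorm A.
Proof.
rewrite mulr_ge0 ?invr_ge0 ?ler0n //; apply: sumr_ge0 => i _.
by apply: sumr_ge0 => j _; exact: normc_ge0.
Qed.

Lemma cnormM A B : cnorm (A *m B) <= cnorm A * cnorm B.
Proof.
have f0 := fact_gt0R.
rewrite /cnorm mulrACA -mulrA ler_wpM2l ?invr_ge0 ?ler0n //.
rewrite ler_pdivlMl // mulr_sumr.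
apply: (@le_trans _ _ (\sum_(f : T) \sum_(h : T) \sum_(g : T)
    normc (minor A f g) * normc (minor B g h))).
  apply: ler_sum => f _; rewrite mulr_sumr; apply: ler_sum => h _.
  rewrite -(normc_nat R) -normcM minorM.
  apply: le_trans (normc_sum _ _ _) _.
  by apply: ler_sum => g _; rewrite normcM.
under eq_bigr do rewrite exchange_big /=.
rewrite mulr_suml; apply: ler_sum => f _; rewrite mulr_suml; apply: ler_sum => g _.
rewrite -mulr_sumr ler_wpM2l ?normc_ge0 // [leRHS](bigD1 g) //= lerDl.
by apply: sumr_ge0 => i _; apply: sumr_ge0 => j _; exact: normc_ge0.
Qed.

Lemma cnormZ c A : normc c = 1 -> cnorm (c *: A) = cnorm A.
Proof.
move=> c1; congr (_ * _); apply: eq_bigr => f _; apply: eq_bigr => g _.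
by rewrite minor_scale normcM normcX c1 expr1n mul1r.
Qed.

Lemma cnorm_gt0 A : (k <= d)%N -> A \in unitmx -> 0 < cnorm A.
Proof.
move=> kd Au; rewrite lt_def cnorm_ge0 andbT; apply/eqP => A0.
have := cnormM A (invmx A); rewrite A0 mul0r mulmxV // leNgt => /negP; apply.
pose f : T := [ffun i => widen_ord kd i].
have fi : injective f by move=> i j; rewrite !ffunE => /(congr1 val) /= /val_inj.
apply: lt_le_trans (cnorm_ge _ f f); rewrite minor1 // normc1 mulr1 invr_gt0.
exact: fact_gt0R.
Qed.

Definition nT : R := #|{: T}|%:R.

Lemma sum_nT (x : R) : \sum_(f : T) \sum_(g : T) x = nT ^+ 2 * x.
Proof. by rewrite !sumr_const -mulrnA -mulr_natl natrM expr2. Qed.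

Lemma normc_minor_unitary A f g : A \is unitarymx -> normc (minor A f g) <= (k`!)%:R.
Proof.
move=> uA; apply: le_trans (normc_sum _ _ _) _.
rewrite -card_Sn -sumr_const; apply: ler_sum => s _.
rewrite normcM normc_sign mul1r normc_prod.
by apply: prodr_ile1 => i _; rewrite normc_ge0 /= mxE unitary_entry.
Qed.

Lemma cnorm_unitary A : A \is unitarymx -> cnorm A <= nT ^+ 2.
Proof.
move=> uA; rewrite /cnorm ler_pdivrMl ?fact_gt0R //.
apply: (@le_trans _ _ (\sum_(f : T) \sum_(g : T) (k`!)%:R)).
  by apply: ler_sum => f _; apply: ler_sum => g _; exact: normc_minor_unitary.
by rewrite sum_nT mulrC.
Qed.

Lemma trmxC_unitaryE A : A \is unitarymx -> A^t* \is unitarymx.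
Proof. by rewrite trmxC_unitary. Qed.

Lemma cnorm_unitary_le U A V : U \is unitarymx -> V \is unitarymx ->
  cnorm (U *m A *m V) <= nT ^+ 4 * cnorm A.
Proof.
move=> uU uV; apply: le_trans (cnormM _ _) _.
have n0 : 0 <= nT by rewrite ler0n.
have -> : nT ^+ 4 * cnorm A = nT ^+ 2 * cnorm A * nT ^+ 2 by ring.
apply: ler_pM; rewrite ?cnorm_ge0 ?cnorm_unitary //.
apply: le_trans (cnormM _ _) _.
exact: (ler_wpM2r (cnorm_ge0 A) (cnorm_unitary uU)).
Qed.

Lemma cnorm_unitary_ge U A V : U \is unitarymx -> V \is unitarymx ->
  cnorm A <= nT ^+ 4 * cnorm (U *m A *m V).
Proof.
move=> uU uV.
have := cnorm_unitary_le (U *m A *m V) (trmxC_unitaryE uU) (trmxC_unitaryE uV).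
have -> : U^t* *m (U *m A *m V) *m V^t* = (U^t* *m U) *m A *m (V *m V^t*).
  by rewrite !mulmxA.
have -> : U^t* *m U = 1%:M by rewrite -invmx_unitary // mulVmx // unitarymx_unit.
by rewrite mul1mx (unitarymxP uV) mulmx1.
Qed.

Definition dg (a : 'rV[R]_d) : 'M[C]_d := diag_mx (\row_i (a 0 i)%:C%C).
Definition pr (a : 'rV[R]_d) (f : T) : R := \prod_i a 0 (f i).
Definition onto_image (p f : T) : bool := [forall i, f i \in codom p].

(* For the exponential of kappa(g) and the inclusion p of the first k indices,
   eps is the exponential of - alpha_k(kappa(g)); see dominant_sorted. *)
Definition dominant (a : 'rV[R]_d) (p : T) (eps : R) : Prop :=
  [/\ forall j, 0 < a 0 j, injective p,
   0 <= eps & forall f, injective f -> pr a f <= pr a p /\ (~~ onto_image p f -> pr a f <= eps * pr a p)].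

Lemma pr_gt0 (a : 'rV[R]_d) f : (forall j, 0 < a 0 j) -> 0 < pr a f.
Proof. by move=> a0; apply: prodr_gt0. Qed.

Lemma minor_dg a Z b f g :
  minor (dg a *m Z *m dg b) f g = (pr a f)%:C%C * minor Z f g * (pr b g)%:C%C.
Proof.
rewrite /dg minor_diagr minor_diagl mulrC /pr !rmorph_prod.
by congr (_ * _ * _); apply: eq_bigr => i _; rewrite mxE.
Qed.

Lemma normc_minor_dg (a : 'rV[R]_d) Z (b : 'rV[R]_d) f g : (forall j, 0 < a 0 j) -> (forall j, 0 < b 0 j) ->
  normc (minor (dg a *m Z *m dg b) f g) = pr a f * normc (minor Z f g) * pr b g.
Proof.
move=> a0 b0; rewrite minor_dg !normcM !normcR !ger0_norm //.
  by rewrite ltW // pr_gt0.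
by rewrite ltW // pr_gt0.
Qed.

Lemma cnorm_dg_ge a Z b p q e e' : dominant a p e -> dominant b q e' ->
  (k`!)%:R^-1 * (pr a p * pr b q * normc (minor Z p q)) <= cnorm (dg a *m Z *m dg b).
Proof.
move=> [a0 _ _ _] [b0 _ _ _]; rewrite [X in _ * X <= _]mulrAC -(normc_minor_dg Z p q a0 b0).
exact: cnorm_ge.
Qed.

(** When f and g rearrange p and q, the minor has the modulus of the one at (p, q); otherwise the
    dominance of p or of q gains a factor e or e'. *)
Lemma cnorm_dg_le a Z b p q e e' M : dominant a p e -> dominant b q e' ->
  0 <= M -> (forall f g, normc (minor Z f g) <= (k`!)%:R * M) ->
  cnorm (dg a *m Z *m dg b) <=
   nT ^+ 2 * (pr a p * pr b q * (normc (minor Z p q) + M * e + M * e')).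
Proof.
move=> [a0 pi e0 aP] [b0 qi e'0 bP] M0 ZM.
have pa := pr_gt0 p a0; have qb := pr_gt0 q b0.
have f0 := fact_gt0R.
rewrite /cnorm ler_pdivrMl //.
set M' := _ * (_ + _ + _).
have M'0 : 0 <= M'.
  by rewrite mulr_ge0 ?mulr_ge0 ?(ltW pa) ?(ltW qb) // !addr_ge0 ?normc_ge0 ?mulr_ge0.
suff H f g : normc (minor (dg a *m Z *m dg b) f g) <= (k`!)%:R * M'.
  apply: (@le_trans _ _ (\sum_(f : T) \sum_(g : T) ((k`!)%:R * M'))).
    by apply: ler_sum => f _; apply: ler_sum => g _; exact: H.
  rewrite sum_nT mulrCA; exact: lexx.
have k1 : 1 <= (k`!)%:R :> R by rewrite ler1n fact_gt0.
have [fi|nf] := boolP (injectiveb f); last first.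
  by rewrite minor_ninjl // ComplexField.Normc.normc0 mulr_ge0 // ltW.
have [gi|ng] := boolP (injectiveb g); last first.
  by rewrite minor_ninjr // ComplexField.Normc.normc0 mulr_ge0 // ltW.
move/injectiveP: fi => fi; move/injectiveP: gi => gi.
have [af af'] := aP f fi; have [bg bg'] := bP g gi.
rewrite normc_minor_dg //.
have af0 := pr_gt0 f a0; have bg0 := pr_gt0 g b0.
have mk := ZM f g.
have kM : 0 <= (k`!)%:R * M by rewrite mulr_ge0 // ltW.
have mz := normc_ge0 (minor Z f g).
have [pf|npf] := boolP (onto_image p f); last first.
  have := af' npf; move=> {}af'.
  apply: (@le_trans _ _ ((e * pr a p) * ((k`!)%:R * M) * pr b q)).
    by rewrite ler_pM ?ler_pM // ?mulr_ge0 // ltW.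
  have -> : e * pr a p * ((k`!)%:R * M) * pr b q = (k`!)%:R * (pr a p * pr b q * (M * e)) by ring.
  rewrite ler_wpM2l ?(ltW f0) // ler_wpM2l ?mulr_ge0 ?(ltW pa) ?(ltW qb) //.
  by rewrite addrAC lerDr addr_ge0 ?normc_ge0 ?mulr_ge0.
have [qg|nqg] := boolP (onto_image q g); last first.
  have := bg' nqg; move=> {}bg'.
  apply: (@le_trans _ _ (pr a p * ((k`!)%:R * M) * (e' * pr b q))).
    by rewrite ler_pM ?ler_pM // ?mulr_ge0 // ltW.
  have -> : pr a p * ((k`!)%:R * M) * (e' * pr b q) = (k`!)%:R * (pr a p * pr b q * (M * e')) by ring.
  rewrite ler_wpM2l ?(ltW f0) // ler_wpM2l ?mulr_ge0 ?(ltW pa) ?(ltW qb) //.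
  by rewrite lerDr addr_ge0 ?normc_ge0 ?mulr_ge0.
have [s fE] := same_image fi pi pf; have [t gE] := same_image gi qi qg.
have -> : normc (minor Z f g) = normc (minor Z p q).
  by rewrite fE gE minor_perml minor_permr !normcM !normc_sign !mul1r.
apply: (@le_trans _ _ (pr a p * normc (minor Z p q) * pr b q)).
  apply: ler_pM _ (ltW bg0) _ bg; first exact: mulr_ge0 (ltW af0) (normc_ge0 _).
  exact: ler_wpM2r (normc_ge0 _) _ _ af.
apply: (@le_trans _ _ (1 * M')); last by rewrite ler_wpM2r.
rewrite mul1r /M' mulrAC ler_wpM2l ?mulr_ge0 ?(ltW pa) ?(ltW qb) //.
by rewrite -addrA lerDl addr_ge0 ?mulr_ge0.
Qed.

End CompoundNorm.

Section Dominance.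
Variables (R : realType) (n : nat).
Implicit Types (a : 'rV[R]_n.+1) (i : 'I_n).

Definition iota_ k : {ffun 'I_k -> 'I_n.+1} := [ffun x : 'I_k => inord x].
Definition rev_ k (f : {ffun 'I_k -> 'I_n.+1}) : {ffun 'I_k -> 'I_n.+1} :=
  [ffun x => rev_ord (f x)].

Lemma rev_K k : involutive (@rev_ k).
Proof. by move=> f; apply/ffunP => x; rewrite !ffunE rev_ordK. Qed.

Lemma iota_val i (x : 'I_i.+1) : iota_ i.+1 x = x :> nat.
Proof. by rewrite ffunE inordK // (leq_trans (ltn_ord x)) // ltnS ltnW. Qed.

Lemma iota_inj i : injective (iota_ i.+1).
Proof. by move=> x y /(congr1 val) /=; rewrite !iota_val => /val_inj. Qed.

Lemma codom_iota i (j : 'I_n.+1) : (j \in codom (iota_ i.+1)) = (j <= i)%N.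
Proof.
apply/codomP/idP => [[x ->]|ji]; first by rewrite iota_val -ltnS.
exists (Ordinal (ji : (j < i.+1)%N)); apply/val_inj.
by rewrite [RHS]iota_val.
Qed.

(** Compare the image S of f with the initial segment P. The sets S \ P and P \ S have the same
    size, the entries over the first are at most t and those over the second at least u; if S is not
    P, at least one factor t / u is gained. *)
Lemma dominant_sorted a i : (forall j, 0 < a 0 j) ->
  (forall j j' : 'I_n.+1, (j <= j')%N -> a 0 j' <= a 0 j) ->
  dominant a (iota_ i.+1) (a 0 (lift ord0 i) / a 0 (widen_ord (leqnSn n) i)).
Proof.
move=> a0 adec.
set t := a 0 (lift ord0 i); set u := a 0 (widen_ord (leqnSn n) i).
have t0 : 0 < t by exact: a0.
have u0 : 0 < u by exact: a0.
have tu : t <= u by apply: adec; rewrite /= /bump; apply: leq_addl.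
split => //; [exact: iota_inj|by rewrite divr_ge0 ?ltW|].
move=> f fi.
pose S := [set f x | x in 'I_i.+1]; pose P := [set iota_ i.+1 x | x in 'I_i.+1].
have prS (g : {ffun 'I_i.+1 -> 'I_n.+1}) : injective g ->
    pr a g = \prod_(j in [set g x | x in 'I_i.+1]) a 0 j.
  by move=> gi; rewrite big_imset //; move=> x y _ _; apply: gi.
have inP j : (j \in P) = (j <= i)%N.
  rewrite -codom_iota; apply/imsetP/codomP => [[x _ ->]|[x ->]]; by exists x.
rewrite (prS f fi) (prS _ (@iota_inj i)) -/S -/P.
rewrite (big_setID P) /= [\prod_(j in P) _](big_setID S) /= [P :&: S]finset.setIC.
have cSP : #|S :\: P| = #|P :\: S|.
  apply/eqP; rewrite -(eqn_add2l #|S :&: P|) cardsID [S :&: P]finset.setIC cardsID.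
  by rewrite !card_imset //; exact: iota_inj.
set X := \prod_(j in S :&: P) _.
have X0 : 0 < X by apply: prodr_gt0.
have H1 : \prod_(j in S :\: P) a 0 j <= t ^+ #|S :\: P|.
  rewrite -prodr_const; apply: ler_prod => j; rewrite inE inP -ltnNge => /andP[ij _].
  by rewrite ltW //= adec //= /bump.
have H2 : u ^+ #|S :\: P| <= \prod_(j in P :\: S) a 0 j.
  rewrite cSP -prodr_const; apply: ler_prod => j; rewrite inE inP => /andP[_ ji].
  by rewrite ltW //= adec.
have XE y : 0 <= y -> \prod_(j in S :\: P) a 0 j <= y * \prod_(j in P :\: S) a 0 j ->
   X * \prod_(j in S :\: P) a 0 j <= y * (X * \prod_(j in P :\: S) a 0 j).
  by move=> y0 le; rewrite mulrCA ler_wpM2l // ltW.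
split.
  rewrite -[leRHS]mul1r; apply: XE => //; rewrite mul1r.
  by apply: le_trans H1 (le_trans _ H2); apply: lerXn2r; rewrite ?nnegrE ?(ltW t0) ?(ltW u0).
move=> /forallPn[x]; rewrite codom_iota => nx.
have : (0 < #|S :\: P|)%N.
  apply/card_gt0P; exists (f x); rewrite inE inP nx /=.
  by apply/imsetP; exists x.
move: H1 H2; case: #|S :\: P| => // m H1 H2 _.
have tu0 : 0 <= t / u by rewrite divr_ge0 ?ltW.
apply: XE => //; apply: le_trans H1 _; apply: le_trans (ler_wpM2l tu0 H2).
rewrite !exprS mulrA divfK ?lt0r_neq0 // ler_wpM2l ?(ltW t0) //.
by apply: lerXn2r; rewrite ?nnegrE ?(ltW t0) ?(ltW u0).
Qed.

Lemma dominant_rev a k p e : dominant (\row_j a 0 (rev_ord j)) p e ->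
  dominant a (@rev_ k p) e.
Proof.
have E (g : {ffun 'I_k -> 'I_n.+1}) : pr (\row_j a 0 (rev_ord j)) g = pr a (rev_ g).
  by apply: eq_bigr => x _; rewrite mxE ffunE.
have ri (g : {ffun 'I_k -> 'I_n.+1}) : injective g -> injective (rev_ g).
  by move=> gi x y; rewrite !ffunE => /rev_ord_inj /gi.
case=> a0 pi e0 H; split => //; last 1 first.
- move=> f fi; have := H (rev_ f) (ri _ fi); rewrite !E rev_K => -[H1 H2].
  split => // nf; apply: H2; apply: contra nf => /forallP op; apply/forallP => x.
  have := op x; rewrite ffunE => /codomP[y ey]; apply/codomP; exists y.
  by rewrite ffunE -ey rev_ordK.
- by move=> j; have := a0 (rev_ord j); rewrite mxE rev_ordK.
- exact: ri.
Qed.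

Lemma dominant_inv_sorted a i : (forall j, 0 < a 0 j) ->
  (forall j j' : 'I_n.+1, (j <= j')%N -> a 0 j' <= a 0 j) ->
  dominant (\row_j (a 0 j)^-1) (rev_ (iota_ i.+1))
    (a 0 (lift ord0 (rev_ord i)) / a 0 (widen_ord (leqnSn n) (rev_ord i))).
Proof.
move=> a0 adec; apply: dominant_rev.
set b := \row_j _.
have bE j : b 0 j = (a 0 (rev_ord j))^-1 by rewrite !mxE.
have -> : a 0 (lift ord0 (rev_ord i)) / a 0 (widen_ord (leqnSn n) (rev_ord i)) =
   b 0 (lift ord0 i) / b 0 (widen_ord (leqnSn n) i).
  rewrite !bE invrK mulrC; congr (_^-1 * a 0 _) => //; last first.
    by apply/val_inj; rewrite /= /bump /= add1n subSS subnSK.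
  by congr (a 0 _); apply/val_inj; rewrite /= /bump /= subSS.
apply: dominant_sorted => [j|j j' jj']; rewrite !bE ?invr_gt0 // lef_pV2 ?posrE //.
by apply: adec; rewrite /= leq_sub2l.
Qed.

End Dominance.

(** * Spectral theorem and singular value decomposition over both fields *)

Section RealSpectral.
Variable R : realType.

(** The complex spectral theorem yields a real eigenvalue; as a root of the characteristic
    polynomial over R it has a real eigenvector. Real frames are required when K = R, since the
    flags live in K^d. *)
Lemma real_sym_eigenvector m (H : 'M[R]_m.+1) : H^T = H ->
  exists v x, [/\ v *m H = x *: v & v *m v^T = 1%:M :> 'M[R]_1].
Proof.
move=> Hs; pose H' := map_mx (real_complex R) H.
have Hh : H' \is hermsymmx.
  apply: realsym_hermsym; first by apply/is_hermitianmxP; rewrite expr0 scale1r map_mx_id // /H' map_trmx Hs.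
  apply/mxOverP => i j; rewrite mxE complex_real //.
have /orthomx_spectralP HE := hermitian_normalmx Hh.
set P := spectralmx H' in HE; set D := spectral_diag H' in HE.
have Pu : P \in unitmx by exact: spectral_unit.
have := hermitian_spectral_diag_real Hh; move=> /mxOverP/(_ 0 0).
rewrite -/D => /complex_realP[x Dx].
have ev : eigenvalue H' x%:C%C.
  apply/eigenvalueP; exists (row 0 P).
    rewrite -row_mul HE !mulmxA mulmxV // mul1mx mul_diag_mx.
    by apply/rowP => j; rewrite !mxE Dx.
  apply/eqP => r0; have : row 0 P *m invmx P = 0 by rewrite r0 mul0mx.
  rewrite -row_mul mulmxV // => /rowP/(_ 0); rewrite !mxE eqxx => /eqP.
  by rewrite oner_eq0.
have {}ev : eigenvalue H x.
  move: ev; rewrite !eigenvalue_root_char /H' -map_char_poly.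
  by rewrite (fmorph_root (real_complex R)).
have [v vH v0] := eigenvalueP ev.
pose c := (v *m v^T) 0 0.
have cE : c = \sum_j v 0 j ^+ 2 by rewrite /c mxE; apply: eq_bigr => j _; rewrite mxE expr2.
have c0 : 0 < c.
  rewrite lt_def cE sumr_ge0 ?andbT => [|j _]; last exact: sqr_ge0.
  apply: contra v0; rewrite psumr_eq0 => [/allP z|j _]; last exact: sqr_ge0.
  apply/eqP/rowP => j; have := z j (mem_index_enum j).
  by rewrite /= sqrf_eq0 mxE => /eqP.
exists ((Num.sqrt c)^-1 *: v), x; split.
  by rewrite -scalemxAl vH !scalerA mulrC.
rewrite -scalemxAl linearZ /= -scalemxAr scalerA -invfM -expr2 sqr_sqrtr ?ltW //.
rewrite [v *m v^T]mx11_scalar -/c scale_scalar_mx mulVf //; exact: lt0r_neq0.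
Qed.

(** If v is not e, the reflection in the hyperplane orthogonal to v - e exchanges v and the first
    basis vector e. *)
Lemma householder m (v : 'rV[R]_m.+1) : v *m v^T = 1%:M ->
  exists Q : 'M[R]_m.+1, [/\ Q^T = Q, Q *m Q = 1%:M & row 0 Q = v].
Proof.
move=> v1; pose e : 'rV[R]_m.+1 := delta_mx 0 0.
have [ve|ne] := eqVneq v e.
  exists 1%:M; split; rewrite ?trmx1 ?mul1mx // ve.
  by apply/rowP => j; rewrite !mxE eq_sym.
pose u := v - e; pose c := (u *m u^T) 0 0.
have cE : c = \sum_j u 0 j ^+ 2.
  by rewrite /c mxE; apply: eq_bigr => j _; rewrite [u^T _ _]mxE expr2.
have c0 : c != 0.
  rewrite cE psumr_eq0 => [|j _]; last exact: sqr_ge0.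
  apply: contra ne => /allP z; rewrite -subr_eq0; apply/eqP/rowP => j.
  have := z j (mem_index_enum j); rewrite /= sqrf_eq0 => /eqP ->.
  by rewrite !mxE.
have uu : u *m u^T = c%:M by rewrite [LHS]mx11_scalar.
have eu (w : 'rV[R]_m.+1) : e *m w^T = (w 0 0)%:M.
  by rewrite [LHS]mx11_scalar -rowE !mxE.
have cE2 : c = 2 - 2 * v 0 0.
  have : u *m u^T = (2 - 2 * v 0 0)%:M.
    rewrite /u linearB /= mulmxBl !mulmxBr v1 !eu.
    have -> : v *m e^T = (v 0 0)%:M.
      by rewrite -[LHS]trmxK trmx_mul trmxK eu tr_scalar_mx.
    rewrite -!raddfB /=; congr (_%:M); rewrite !mxE !eqxx /=; ring.
  by rewrite uu => /matrixP/(_ 0 0); rewrite !mxE eqxx !mulr1n.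
exists (1%:M - (2 / c) *: (u^T *m u)); split.
- by rewrite linearB /= trmx1 linearZ /= trmx_mul trmxK.
- have XX : u^T *m u *m (u^T *m u) = c *: (u^T *m u).
    by rewrite mulmxA -(mulmxA u^T) uu mul_mx_scalar -scalemxAl.
  set X := u^T *m u in XX *.
  rewrite mulmxBl !mulmxBr !mul1mx !mulmx1 -!scalemxAl -!scalemxAr XX !scalerA.
  have -> : 2 / c * (2 / c) * c = 2 / c + 2 / c by field.
  by rewrite scalerDl opprB addrK subrK.
- rewrite rowE -/e mulmxBr mulmx1 -scalemxAr mulmxA eu mul_scalar_mx scalerA.
  have -> : 2 / c * u 0 0 = -1.
    have u00 : u 0 0 = v 0 0 - 1 by rewrite /u !mxE !eqxx.
    rewrite u00; have -> : v 0 0 - 1 = - (c / 2) by rewrite cE2; field.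
    by field.
  by rewrite scaleN1r opprK /u addrC subrK.
Qed.

(** Deflation: conjugating by a reflection whose first row is an eigenvector makes H block
    diagonal. *)
Lemma real_sym_spectral m (H : 'M[R]_m) : H^T = H ->
  exists (U : 'M[R]_m) (d : 'rV[R]_m), U *m U^T = 1%:M /\ U *m H *m U^T = diag_mx d.
Proof.
elim: m H => [|m IH] H Hs.
  by exists 1%:M, 0; split; apply/matrixP => -[].
have [v [x [vH v1]]] := real_sym_eigenvector Hs.
have [Q [Qs QQ Qv]] := householder v1.
have [G GDef] : exists G : 'M[R]_(1 + m), G = Q *m H *m Q by eexists.
have Gs : G^T = G by rewrite GDef !trmx_mul Qs Hs mulmxA.
have G0 : row 0 G = x *: delta_mx 0 0.
  rewrite GDef -mulmxA row_mul Qv mulmxA vH -scalemxAl -Qv -row_mul QQ.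
  by rewrite rowE mulmx1.
have G0j j : G 0 j = x * (0 == j)%:R.
  by have /rowP/(_ j) := G0; rewrite !mxE eqxx eq_sym /= => ->.
pose H' := drsubmx G.
have GE : G = block_mx x%:M 0 0 H'.
  rewrite -[LHS]submxK; congr block_mx.
  - apply/matrixP => i j; rewrite !mxE !ord1 (_ : lshift m 0 = 0); last exact/val_inj.
    by rewrite G0j eqxx mulr1 mulr1n.
  - apply/matrixP => i j; rewrite !mxE ord1 (_ : lshift m 0 = 0); last exact/val_inj.
    by rewrite G0j mulr0.
  - apply/matrixP => i j; rewrite !mxE ord1 (_ : lshift m 0 = 0); last exact/val_inj.
    by rewrite -Gs mxE G0j mulr0.
have Hs' : H'^T = H' by rewrite /H' trmx_drsub Gs.
have [U [d [UU UH]]] := IH H' Hs'.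
pose V : 'M[R]_(1 + m) := block_mx 1%:M 0 0 U.
have VV : V *m V^T = 1%:M.
  rewrite /V tr_block_mx !trmx0 trmx1 mulmx_block !mul0mx !mulmx0 mulmx1 UU.
  by rewrite !addr0 !add0r -scalar_mx_block.
exists (V *m Q), (row_mx x%:M d); split.
  by rewrite trmx_mul Qs mulmxA -(mulmxA V) QQ mulmx1.
rewrite trmx_mul Qs.
have -> : V *m Q *m H *m (Q *m V^T) = V *m G *m V^T by rewrite GDef !mulmxA.
rewrite GE /V tr_block_mx !trmx0 trmx1 !mulmx_block !mul0mx !mulmx0 !mul1mx !mulmx1.
rewrite !addr0 !add0r mul0mx UH; apply: etrans _ (esym (diag_mx_row (x%:M : 'rV_1) d)).
congr block_mx.
by apply/matrixP => i j; rewrite !mxE !ord1 eqxx.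
Qed.

End RealSpectral.

Section BaseField.
Variables (R : realType) (b : base_field).
Local Notation K := (field_of R b).
Local Notation C := R[i].

Lemma toC_is_zmod_morphism : zmod_morphism (@toC R b).
Proof. by case: b => x y //=; rewrite rmorphB. Qed.
Lemma toC_is_monoid_morphism : monoid_morphism (@toC R b).
Proof. by case: b; split => [//|x y] //=; rewrite rmorphM. Qed.
HB.instance Definition _ := GRing.isZmodMorphism.Build K C (@toC R b) toC_is_zmod_morphism.
HB.instance Definition _ := GRing.isMonoidMorphism.Build K C (@toC R b) toC_is_monoid_morphism.

Definition ofR : R -> K :=
  match b with RealNumbers => fun x => x | ComplexNumbers => fun x => x%:C%C end.

Lemma toC_ofR x : toC (ofR x) = x%:C%C.
Proof. by rewrite /ofR; case: b. Qed.

Definition cm m p (A : 'M[K]_(m, p)) : 'M[C]_(m, p) := map_mx (@toC R b) A.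

Lemma cmM m p q (A : 'M[K]_(m, p)) (B : 'M[K]_(p, q)) : cm (A *m B) = cm A *m cm B.
Proof. exact: map_mxM. Qed.

Lemma cm_unit m (A : 'M[K]_m) : (cm A \in unitmx) = (A \in unitmx).
Proof. exact: map_unitmx. Qed.

Lemma adjoint_exists m p (A : 'M[K]_(m, p)) : exists B : 'M[K]_(p, m), cm B = (cm A)^t*.
Proof.
rewrite /cm; case: b A => A; last first.
  by exists ((A : 'M[R[i]]_(m, p))^t*); apply/matrixP => i j; rewrite !mxE.
exists A^T; apply/matrixP => i j; rewrite !mxE /=.
by apply/esym/CrealP; rewrite complex_real.
Qed.

Definition dgK m (a : 'rV[R]_m) : 'M[K]_m := diag_mx (\row_j ofR (a 0 j)).

Lemma cm_dgK m (a : 'rV[R]_m) : cm (dgK a) = dg a.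
Proof.
rewrite /cm map_diag_mx; congr diag_mx.
by apply/rowP => j; rewrite !mxE; apply: toC_ofR.
Qed.

Lemma hermitian_spectral m (H : 'M[K]_m) : (cm H)^t* = cm H ->
  exists (U : 'M[K]_m) (d : 'rV[R]_m),
    cm U \is unitarymx /\ cm U *m cm H *m (cm U)^t* = dg d.
Proof.
rewrite /cm; case: b H => H Hh.
  have Hs : H^T = H.
    apply/matrixP => i j; have /matrixP/(_ i j) := Hh; rewrite !mxE /= => /esym.
    have /CrealP -> : (H j i)%:C%C \is Num.real by rewrite complex_real.
    by move/(@complexI R) => ->.
  have [U [d [UU UH]]] := real_sym_spectral Hs.
  have E : (map_mx (@toC R RealNumbers) U)^t* = map_mx (real_complex R) U^T.
    apply/matrixP => i j; rewrite !mxE /=.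
    by apply/CrealP; rewrite complex_real.
  exists U, d; split.
    by apply/unitarymxP; rewrite E -map_mxM UU map_mx1.
  rewrite E -!map_mxM UH map_diag_mx; congr diag_mx.
  by apply/rowP => j; rewrite !mxE.
have E (A : 'M[R[i]]_m) : map_mx (@toC R ComplexNumbers) A = A.
  by apply/matrixP => i j; rewrite mxE.
have {}Hh : (H : 'M[R[i]]_m)^t* = H by move: Hh; rewrite !E.
have Hh' : (H : 'M[R[i]]_m) \is hermsymmx by apply/is_hermitianmxP; rewrite expr0 scale1r Hh.
have /orthomx_spectralP HE := hermitian_normalmx Hh'.
have Pu := spectral_unitarymx (H : 'M[R[i]]_m).
set P := spectralmx _ in HE Pu *; set D := spectral_diag _ in HE *.
exists P, (\row_j complex.Re (D 0 j)); rewrite !E; split => //.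
rewrite HE !mulmxA mulmxV ?unitarymx_unit // mul1mx -mulmxA (unitarymxP Pu) mulmx1.
congr diag_mx; apply/rowP => j; rewrite !mxE RRe_real //.
by have /mxOverP/(_ 0 j) := hermitian_spectral_diag_real Hh'.
Qed.

(** Since U diagonalizes the Gram matrix of A with eigenvalues s_j^2, the columns of A U^* are
    orthogonal of norms s_j; scaling them by 1 / s_j gives the unitary factor k. *)
Lemma unitary_scaled_adj m (A : 'M[C]_m) (U : 'M[C]_m) (s : 'rV[R]_m) :
  U \is unitarymx -> (forall j, 0 < s 0 j) ->
  U *m (A^t* *m A) *m U^t* = dg (\row_j (s 0 j) ^+ 2) ->
  exists2 k, k \is unitarymx & k = A *m U^t* *m dg (\row_j (s 0 j)^-1) /\ A = k *m dg s *m U.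
Proof.
move=> uU s0 H; set S := dg (\row_j (s 0 j)^-1).
have SS : S *m dg s = 1%:M.
  apply/matrixP => i j; rewrite mul_diag_mx !mxE.
  case: (i == j); rewrite ?mulr0n ?mulr0 // ?mulr1n -rmorphM /= mulVf //; exact: lt0r_neq0.
have St : S^t* = S.
  rewrite /S /dg tr_diag_mx map_diag_mx; congr diag_mx; apply/rowP => j; rewrite !mxE.
  by apply/CrealP; rewrite complex_real.
exists (A *m U^t* *m S); last first.
  split => //; rewrite -!mulmxA (mulmxA S) SS mul1mx -invmx_unitary // mulVmx ?mulmx1 //.
  exact: unitarymx_unit.
rewrite -trmxC_unitary; apply/unitarymxP; rewrite trmxCK.
rewrite !trmx_mul !map_mxM St trmxCK.
have -> : S *m (U *m A^t*) *m (A *m U^t* *m S) = S *m (U *m (A^t* *m A) *m U^t*) *m S.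
  by rewrite !mulmxA.
rewrite H; have -> : dg (\row_j s 0 j ^+ 2) = dg s *m dg s.
  apply/matrixP => i j; rewrite mul_diag_mx !mxE.
  by case: (i == j); rewrite ?mulr0n ?mulr0 // ?mulr1n -rmorphM /= expr2.
rewrite mulmxA SS mul1mx.
apply/matrixP => i j; rewrite mul_diag_mx !mxE.
case: (i == j); rewrite ?mulr0n ?mulr0 // ?mulr1n -rmorphM /= mulfV //; exact: lt0r_neq0.
Qed.

End BaseField.

Section Spectrum.
Variable R : realType.
Local Notation C := R[i].

Lemma char_poly_similar m (P D : 'M[C]_m) : P \in unitmx ->
  char_poly (invmx P *m D *m P) = char_poly D.
Proof.
move=> Pu; rewrite /char_poly /char_poly_mx.
have Pu' : map_mx polyC P \in unitmx.
  by rewrite unitmxE det_map_mx rmorph_unit // -unitmxE.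
have -> : 'X%:M - map_mx polyC (invmx P *m D *m P) =
   invmx (map_mx polyC P) *m ('X%:M - map_mx polyC D) *m map_mx polyC P.
  rewrite mulmxBr mulmxBl.
  have -> : invmx (map_mx polyC P) *m 'X%:M *m map_mx polyC P = 'X%:M.
    by rewrite -mulmxA -scalar_mxC mulmxA mulVmx // mul1mx.
  congr (_ - _).
  rewrite !map_mxM; congr (_ *m _ *m _).
  apply: (can_inj (mulKmx Pu')).
  by rewrite mulmxV // -map_mxM mulmxV // map_mx1.
rewrite !det_mulmx mulrC mulrA -det_mulmx mulmxV // det1 mul1r //.
Qed.

Lemma char_poly_diag m (d : 'rV[C]_m) : char_poly (diag_mx d) = \prod_(i < m) ('X - (d 0 i)%:P).
Proof.
rewrite char_poly_trig; last by apply/is_trig_mxP => i j ij; rewrite mxE; case: eqP ij => // ->; rewrite ltnn.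
by apply: eq_bigr => i _; rewrite mxE eqxx mulr1n.
Qed.

(** Both lists are the roots of the characteristic polynomial of H. This relates [sing_vals],
    defined by [spectral_diag], to a diagonalization obtained over K. *)
Lemma spectral_diag_perm m (H : 'M[C]_m) (U : 'M[C]_m) (d : 'rV[R]_m) :
  U \is unitarymx -> U *m H *m U^t* = dg d ->
  perm_eq [seq spectral_diag H 0 i | i <- enum 'I_m] [seq (d 0 i)%:C%C | i <- enum 'I_m].
Proof.
move=> uU E.
have Uu := unitarymx_unit uU.
have HE : H = invmx U *m dg d *m U.
  by rewrite -E -invmx_unitary // !mulmxA mulVmx // mul1mx mulmxKV.
have nH : H \is normalmx.
  apply/orthomx_spectral_subproof; exists (U, \row_j (d 0 j)%:C%C) => //=.
have [P Pu [D DE HS]] : exists2 P, P \in unitmx & exists2 D, D = spectral_diag H &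
    H = invmx P *m diag_mx D *m P.
  exists (spectralmx H); first exact: spectral_unit.
  by exists (spectral_diag H) => //; exact/orthomx_spectralP.
have e1 : char_poly H = char_poly (dg d) by rewrite {1}HE char_poly_similar.
have := char_poly_similar (diag_mx D) Pu; rewrite -HS e1 /dg !char_poly_diag -DE => e.
have E' (f : 'I_m -> C) : \prod_(x <- [seq f i | i <- enum 'I_m]) ('X - x%:P) =
    \prod_(i < m) ('X - (f i)%:P) by rewrite big_map big_enum.
apply: prod_XsubC_eq; rewrite !E' -e.
by apply: eq_bigr => i _; rewrite mxE.
Qed.

End Spectrum.

Section SingularValues.
Variables (R : realType) (b : base_field) (n : nat).
Local Notation K := (field_of R b).
Local Notation C := R[i].

Lemma perm_dg m (d : 'rV[R]_m) (p : 'S_m) :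
  perm_mx p *m dg d *m perm_mx p^-1 = dg (\row_j d 0 (p j)).
Proof.
rewrite -col_permE -row_permE; apply/matrixP => i j; rewrite 2!mxE.
by rewrite [LHS]mxE [RHS]mxE !mxE (inj_eq perm_inj).
Qed.

(** The Gram matrix is diagonalized over K, then the rows of U are permuted so that the eigenvalues
    follow the order of the sorted list [sing_vals], which is the one in [cartan]. *)
Theorem svd (g : PSL K n) : exists k l : 'M[K]_n.+1,
  [/\ cm k \is unitarymx, cm l \is unitarymx,
    cm (val (repr g)) = cm k *m dg (\row_i expR (cartan g 0 i)) *m cm l
   & forall j j' : 'I_n.+1, (j <= j')%N -> cartan g 0 j' <= cartan g 0 j].
Proof.
set A := val (repr g).
have Au : cm A \in unitmx by rewrite cm_unit; exact: SL_unit.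
have [B BA] := adjoint_exists A.
have [U [d [uU UH]]] := @hermitian_spectral R b _ (B *m A)
  ltac:(rewrite cmM BA trmx_mul map_mxM trmxCK; done).
rewrite cmM BA in UH.
set H := (cm A)^t* *m cm A in UH.
have [Y YE] : exists Y, Y = cm A *m (cm U)^t* by eexists.
have YY : Y^t* *m Y = dg d by rewrite -UH YE trmx_mul map_mxM trmxCK /H !mulmxA.
have dE j : d 0 j = \sum_i (normc (Y i j)) ^+ 2.
  have /matrixP/(_ j j) := YY; rewrite !mxE eqxx mulr1n => /(congr1 (@complex.Re R)) /= <-.
  rewrite raddf_sum; apply: eq_bigr => i _.
  by rewrite !mxE mulrC -[X in _ * X]/((Y i j)^*) mulJc.
have d0 j : 0 < d 0 j.
  rewrite lt_def dE sumr_ge0 ?andbT => [|i _]; last exact: sqr_ge0.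
  rewrite -dE; apply/eqP => dj.
  have Yu : Y \in unitmx.
    by rewrite YE unitmx_mul Au -invmx_unitary // unitmx_inv unitarymx_unit.
  have : dg d \in unitmx.
    by rewrite -YY unitmx_mul map_unitmx unitmx_tr Yu.
  by rewrite unitmxE det_diag (bigD1 j) //= mxE dj mul0r unitr0.
pose s0 : seq R := [seq Num.sqrt (d 0 i) | i <- enum 'I_n.+1].
have svE : sing_vals A = sort >=%R s0.
  rewrite /sing_vals; apply/perm_sortP.
  - by move=> x y; exact: le_total.
  - by move=> x y z /= yx zy; apply: le_trans zy yx.
  - by move=> x y /= /andP[yx xy]; apply/le_anti; rewrite xy yx.
  have := spectral_diag_perm uU UH.
  move=> /(perm_map (fun z : C => Num.sqrt (complex.Re z))).
  by rewrite -[X in perm_eq X _]map_comp -[X in perm_eq _ X]map_comp.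
have ss0 : size s0 = n.+1 by rewrite size_map size_enum_ord.
pose t0 : n.+1.-tuple R := [tuple Num.sqrt (d 0 i) | i < n.+1].
have t0E : s0 = t0 by rewrite /t0 /= /s0 enumT.
have pe : perm_eq (sing_vals A) t0 by rewrite svE -t0E perm_sort.
have [p pE] := tuple_permP pe.
have nthE (i : 'I_n.+1) : nth 0 (sing_vals A) i = Num.sqrt (d 0 (p i)) :> R.
  rewrite pE -tnth_nth tnth_mktuple.
  by rewrite /t0 tnth_mktuple.
have cE i : cartan g 0 i = ln (Num.sqrt (d 0 (p i))) by rewrite mxE nthE.
have eE i : expR (cartan g 0 i) = Num.sqrt (d 0 (p i)).
  by rewrite cE lnK // posrE sqrtr_gt0.
pose l := row_perm p U.
have lE : cm l = perm_mx p *m cm U by rewrite /cm /l map_row_perm row_permE.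
have up : (perm_mx p : 'M[C]_n.+1)^t* = perm_mx p^-1.
  by rewrite tr_perm_mx map_perm_mx.
have ul : cm l \is unitarymx.
  apply/unitarymxP; rewrite lE trmx_mul map_mxM up -mulmxA (mulmxA (cm U)).
  by rewrite (unitarymxP uU) mul1mx -perm_mxM mulgV perm_mx1.
have lH : cm l *m H *m (cm l)^t* = dg (\row_j (expR (cartan g 0 j)) ^+ 2).
  rewrite lE trmx_mul map_mxM up.
  have -> : perm_mx p *m cm U *m H *m ((cm U)^t* *m perm_mx p^-1) =
     perm_mx p *m (cm U *m H *m (cm U)^t*) *m perm_mx p^-1 by rewrite !mulmxA.
  have -> : dg (\row_j (expR (cartan g 0 j)) ^+ 2) = dg (\row_j d 0 (p j)).
    by congr dg; apply/rowP => j; rewrite [LHS]mxE [RHS]mxE eE sqr_sqrtr // ltW.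
  exact: etrans (congr1 (fun X => perm_mx p *m X *m perm_mx p^-1) UH) (perm_dg d p).
have s_gt0 j : 0 < (\row_i expR (cartan g 0 i)) 0 j by rewrite mxE expR_gt0.
have lH' : cm l *m ((cm A)^t* *m cm A) *m (cm l)^t* =
    dg (\row_j ((\row_i expR (cartan g 0 i)) 0 j) ^+ 2).
  by rewrite lH; congr dg; apply/rowP => j; rewrite [LHS]mxE [RHS]mxE [X in _ = X ^+ 2]mxE.
have [k' uk [k'E AE]] := unitary_scaled_adj ul s_gt0 lH'.
have [L LE] := adjoint_exists l.
pose k := A *m L *m dgK b (\row_j ((\row_i expR (cartan g 0 i)) 0 j)^-1).
have kE : cm k = k' by rewrite k'E /k !cmM cm_dgK LE.
exists k, l; split; rewrite ?kE // => j j' jj'.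
rewrite !cE ler_ln ?posrE ?sqrtr_gt0 // -!nthE.
have : sorted >=%R (sing_vals A) by rewrite svE; apply: sort_sorted => x y; exact: le_total.
have sz : size (sing_vals A) = n.+1 by rewrite svE size_sort.
move=> /(sorted_leq_nth (rev_trans le_trans) (fun x => lexx x) 0) /(_ j j').
by rewrite !inE sz !ltn_ord => /(_ isT isT jj').
Qed.

End SingularValues.

(** * Subsequences and convergence of complex matrices *)

Section Subsequences.
Local Open Scope classical_set_scope.

Lemma increasing_seq_ge (f : nat -> nat) : increasing_seq f -> forall m, (m <= f m)%N.
Proof.
move=> fi; elim=> // m IH; apply: leq_ltn_trans IH _.
by rewrite ltnNge -leEnat fi ltnn.
Qed.

Lemma increasing_seq_comp (f g : nat -> nat) :
  increasing_seq f -> increasing_seq g -> increasing_seq (f \o g).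
Proof. by move=> fi gi i j; rewrite /= fi -leEnat gi. Qed.

Lemma near_subseq (f : nat -> nat) (P : nat -> Prop) : increasing_seq f ->
  (\forall m \near \oo, P m) -> \forall m \near \oo, P (f m).
Proof.
move=> fi [N _ NP]; exists N => // m /= Nm; apply: NP => /=.
exact: leq_trans Nm (increasing_seq_ge fi m).
Qed.

Lemma cvg_subseq (T : topologicalType) (x : nat -> T) (l : T) f : increasing_seq f ->
  x @ \oo --> l -> (x \o f) @ \oo --> l.
Proof. by move=> fi xl U /xl; apply: (near_subseq (P := fun m => U (x m))). Qed.

Lemma bolzano_weierstrass_family (R : realType) (J : finType) (x : J -> nat -> R) B :
  (forall j m, `|x j m| <= B) ->
  exists2 f, increasing_seq f & exists l : J -> R, forall j, (x j \o f) @ \oo --> l j.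
Proof.
move=> bx.
suff [f fi fl] : exists2 f, increasing_seq f & forall j, j \in enum J ->
    exists l : R, (x j \o f) @ \oo --> l.
  exists f => //; have : forall j, exists l : R, (x j \o f) @ \oo --> l.
    by move=> j; apply: fl; rewrite mem_enum.
  by move=> /choice[l lP]; exists l.
elim: (enum J) => [|j s [f fi fl]]; first by exists id.
have [g gi gl] : exists2 g, increasing_seq g & cvgn ((x j \o f) \o g).
  apply: bolzano_weierstrass; exists B; split; first exact: num_real.
  by move=> M BM m _; apply: le_trans (bx j (f m)) (ltW BM).
exists (f \o g); first exact: increasing_seq_comp.
move=> i; rewrite inE => /predU1P[->|/fl[l il]].
  by exists (limn ((x j \o f) \o g)).
by exists l; apply: (cvg_subseq gi il).
Qed.

(** Each new term is chosen to differ from all the terms of u up to the previously chosen index. *)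
Lemma injective_subseq (T : eqType) (u : nat -> T) :
  (forall x, \forall m \near \oo, u m <> x) ->
  exists2 f, increasing_seq f & injective (u \o f).
Proof.
move=> uP.
pose P a c := (a < c)%N /\ forall m, (m <= a)%N -> u c <> u m.
have next a : exists c, P a c.
  have : \forall c \near \oo, forall m, (m <= a)%N -> u c <> u m.
    elim: a => [|a IH].
      by apply: filterS (uP (u 0%N)) => c uc m; rewrite leqn0 => /eqP ->.
    apply: filterS2 IH (uP (u a.+1)) => c H1 H2 m.
    by rewrite leq_eqVlt => /predU1P[->//|]; rewrite ltnS; apply: H1.
  move=> [N _ NP]; exists (maxn N a.+1); split; first by rewrite leq_maxr.
  by apply: NP; rewrite /= leq_maxl.
have [f fP] := choice next.
pose e := fix e k := if k is k'.+1 then f (e k') else 0%N.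
have eS k : P (e k) (e k.+1) by exact: fP.
have el : {homo e : i j / (i < j)%N}.
  by apply: homo_ltn => [|k]; [exact: ltn_trans|case: (eS k)].
exists e; first by apply/increasing_seqP => k; case: (eS k).
have key i j : (i < j)%N -> u (e j) <> u (e i).
  case: j => // j; rewrite ltnS => ij; case: (eS j) => _; apply.
  by move: ij; rewrite leq_eqVlt => /predU1P[->//|/el/ltnW].
move=> i j /= uij; case: (ltngtP i j) => // /key; first by rewrite uij.
by rewrite -uij.
Qed.

End Subsequences.

Section ComplexLimits.
Local Open Scope classical_set_scope.
Variable R : realType.
Local Notation C := R[i].
Implicit Types (z w : nat -> C).

(** Stated on real and imaginary parts, which reduces every limit to real ones for both base
    fields. *)
Definition ccvg z (l : C) : Prop :=
  (fun m => complex.Re (z m)) @ \oo --> complex.Re l /\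
  (fun m => complex.Im (z m)) @ \oo --> complex.Im l.

Lemma ccvg_cst l : ccvg (fun=> l) l.
Proof. by split; apply: cvg_cst. Qed.

Lemma Re_cmul (x y : C) : complex.Re (x * y) =
  complex.Re x * complex.Re y - complex.Im x * complex.Im y.
Proof. by case: x y => [? ?] [? ?]. Qed.
Lemma Im_cmul (x y : C) : complex.Im (x * y) =
  complex.Re x * complex.Im y + complex.Im x * complex.Re y.
Proof. by case: x y => [? ?] [? ?]. Qed.

Lemma ccvgD z w l l' : ccvg z l -> ccvg w l' -> ccvg (fun m => z m + w m) (l + l').
Proof.
move=> [zr zi] [wr wi]; split.
  rewrite raddfD; apply: cvg_trans (cvgD zr wr).
  by apply: near_eq_cvg; near=> m; rewrite raddfD.
rewrite raddfD; apply: cvg_trans (cvgD zi wi).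
by apply: near_eq_cvg; near=> m; rewrite raddfD.
Unshelve. all: by end_near. Qed.

Lemma ccvgM z w l l' : ccvg z l -> ccvg w l' -> ccvg (fun m => z m * w m) (l * l').
Proof.
move=> [zr zi] [wr wi]; split.
  rewrite Re_cmul; apply: cvg_trans (cvgB (cvgM zr wr) (cvgM zi wi)).
  by apply: near_eq_cvg; near=> m; rewrite Re_cmul.
rewrite Im_cmul; apply: cvg_trans (cvgD (cvgM zr wi) (cvgM zi wr)).
by apply: near_eq_cvg; near=> m; rewrite Im_cmul.
Unshelve. all: by end_near. Qed.

Lemma ccvg_sum (I : Type) (r : seq I) (P : pred I) (F : I -> nat -> C) (L : I -> C) :
  (forall i, ccvg (F i) (L i)) ->
  ccvg (fun m => \sum_(i <- r | P i) F i m) (\sum_(i <- r | P i) L i).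
Proof.
move=> H; elim: r => [|i r IH].
  by rewrite big_nil; under eq_fun do rewrite big_nil; exact: ccvg_cst.
rewrite big_cons; under eq_fun do rewrite big_cons.
by case: ifP => // _; apply: ccvgD.
Qed.

Lemma ccvg_prod (I : Type) (r : seq I) (P : pred I) (F : I -> nat -> C) (L : I -> C) :
  (forall i, ccvg (F i) (L i)) ->
  ccvg (fun m => \prod_(i <- r | P i) F i m) (\prod_(i <- r | P i) L i).
Proof.
move=> H; elim: r => [|i r IH].
  by rewrite big_nil; under eq_fun do rewrite big_nil; exact: ccvg_cst.
rewrite big_cons; under eq_fun do rewrite big_cons.
by case: ifP => // _; apply: ccvgM.
Qed.

Lemma ccvg_conj z l : ccvg z l -> ccvg (fun m => (z m)^*) (l^*).
Proof.
have cE (x : C) : x^* = Complex (complex.Re x) (- complex.Im x) by case: x.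
move=> [zr zi]; split; rewrite cE /=.
  by apply: cvg_trans zr; apply: near_eq_cvg; near=> m; rewrite cE.
apply: cvg_trans (cvgN zi); apply: near_eq_cvg; near=> m; by rewrite cE.
Unshelve. all: by end_near. Qed.

Lemma normcE (x : C) : normc x = Num.sqrt (complex.Re x ^+ 2 + complex.Im x ^+ 2).
Proof. by case: x. Qed.

Lemma ccvg_normc z l : ccvg z l -> (fun m => normc (z m)) @ \oo --> normc l.
Proof.
move=> [zr zi]; rewrite normcE.
apply: cvg_trans (continuous_cvg _ (@sqrt_continuous R _) (cvgD (cvgM zr zr) (cvgM zi zi))).
by apply: near_eq_cvg; near=> m; rewrite normcE !expr2.
Unshelve. all: by end_near. Qed.

Lemma ccvg_unique z l l' : ccvg z l -> ccvg z l' -> l = l'.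
Proof.
move=> [a b] [a' b']; apply/eqP; rewrite eq_complex.
by rewrite (cvg_unique _ a a') // (cvg_unique _ b b') // !eqxx.
Qed.

Lemma ccvg_subseq z l f : increasing_seq f -> ccvg z l -> ccvg (z \o f) l.
Proof. by move=> fi [a b]; split; [exact: (cvg_subseq fi a)|exact: (cvg_subseq fi b)]. Qed.

Definition mcvg d d' (A : nat -> 'M[C]_(d, d')) (L : 'M[C]_(d, d')) : Prop :=
  forall i j, ccvg (fun m => A m i j) (L i j).

Lemma mcvg_cst d d' (L : 'M[C]_(d, d')) : mcvg (fun=> L) L.
Proof. by move=> i j; apply: ccvg_cst. Qed.

Lemma mcvgM d d' d'' (A : nat -> 'M[C]_(d, d')) (B : nat -> 'M[C]_(d', d'')) L L' :
  mcvg A L -> mcvg B L' -> mcvg (fun m => A m *m B m) (L *m L').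
Proof.
move=> AL BL i j; rewrite mxE; under eq_fun do rewrite mxE.
by apply: ccvg_sum => l; apply: ccvgM.
Qed.

Lemma mcvg_adj d d' (A : nat -> 'M[C]_(d, d')) L :
  mcvg A L -> mcvg (fun m => (A m)^t*) (L^t*).
Proof.
by move=> AL i j; rewrite !mxE; under eq_fun do rewrite !mxE; apply: ccvg_conj.
Qed.

Lemma ccvg_det d (A : nat -> 'M[C]_d) L : mcvg A L -> ccvg (fun m => \det (A m)) (\det L).
Proof.
move=> AL; apply: ccvg_sum => s; apply: ccvgM; first exact: ccvg_cst.
by apply: ccvg_prod => i; apply: AL.
Qed.

Lemma ccvg_minor d k (A : nat -> 'M[C]_d) L (f g : {ffun 'I_k -> 'I_d}) : mcvg A L ->
  ccvg (fun m => minor (A m) f g) (minor L f g).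
Proof.
by move=> AL; apply: ccvg_det => i j; rewrite mxE; under eq_fun do rewrite mxE; apply: AL.
Qed.

Lemma mcvg_unique d d' (A : nat -> 'M[C]_(d, d')) L L' : mcvg A L -> mcvg A L' -> L = L'.
Proof. by move=> H H'; apply/matrixP => i j; apply: ccvg_unique (H i j) (H' i j). Qed.

Lemma mcvg_subseq d d' (A : nat -> 'M[C]_(d, d')) L f : increasing_seq f ->
  mcvg A L -> mcvg (A \o f) L.
Proof. by move=> fi AL i j; apply: (ccvg_subseq fi (AL i j)). Qed.

Lemma mcvg_unitary d (A : nat -> 'M[C]_d) L : mcvg A L ->
  (forall m, A m \is unitarymx) -> L \is unitarymx.
Proof.
move=> AL uA; apply/unitarymxP.
apply: mcvg_unique (mcvgM AL (mcvg_adj AL)) _.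
have -> : (fun m => A m *m (A m)^t*) = (fun=> 1%:M).
  by apply: funext => m; rewrite (unitarymxP (uA m)).
exact: mcvg_cst.
Qed.

End ComplexLimits.

(** * Norms of products in terms of singular value decompositions *)

Section Decomposition.
Variables (R : realType) (d k : nat).
Local Notation C := R[i].
Local Notation T := {ffun 'I_k -> 'I_d}.

(** The unimodular c absorbs the choice of a lift from PSL, to which [cnorm] is blind. *)
Definition decomp (X U : 'M[C]_d) (a : 'rV[R]_d) (V : 'M[C]_d) (p : T) (e : R) : Prop :=
  [/\ U \is unitarymx, V \is unitarymx, dominant a p e, e <= 1
    & exists2 c, normc c = 1 & X = c *: (U *m dg a *m V)].

(** One constant for all the estimates below: nT^4 pays for two unitary factors, nT^2 for the sum
    over pairs of maps, k! for the normalization of [cnorm]. *)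
Definition Kd : R := 3 * (k`!)%:R * nT R d k ^+ 6.

Lemma nT_ge1 (p : T) : 1 <= nT R d k.
Proof. by rewrite /nT ler1n; apply/card_gt0P; exists p. Qed.

Lemma Kd_ge (p : T) m : (m <= 6)%N -> (k`!)%:R * nT R d k ^+ m <= Kd.
Proof.
move=> m6; have n1 := nT_ge1 p.
rewrite /Kd -mulrA; set x := _ * _ ^+ 6; set y := _ * _.
have xy : y <= x by rewrite /x /y ler_wpM2l // ler_weXn2l.
have x0 : 0 <= x by rewrite mulr_ge0 // exprn_ge0 // (le_trans ler01).
by move: (x) (y) xy x0 => u v; lra.
Qed.

Lemma Kd_ge' (p : T) m : (m <= 6)%N -> nT R d k ^+ m <= Kd.
Proof.
move=> m6; apply: le_trans (Kd_ge p m6); rewrite ler_peMl ?ler1n ?fact_gt0 //.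
by rewrite exprn_ge0 // (le_trans ler01) // nT_ge1.
Qed.

Lemma Kd_ge1 (p : T) : 1 <= Kd.
Proof. exact: (@Kd_ge' p 0). Qed.

Lemma dg_const1 : dg (const_mx 1 : 'rV[R]_d) = 1%:M.
Proof. by apply/matrixP => i j; rewrite !mxE. Qed.

Lemma dominant_const1 (p : T) : injective p -> dominant (const_mx 1) p (1 : R).
Proof.
move=> pi; split => // [j|f fi]; first by rewrite mxE.
have E (g : T) : pr (const_mx 1 : 'rV[R]_d) g = 1.
  by rewrite /pr big1 // => i _; rewrite mxE.
by rewrite !E mulr1.
Qed.

Lemma unitary1 : (1%:M : 'M[C]_d) \is unitarymx.
Proof. by apply/unitarymxP; rewrite trmx1 map_mx1 mulmx1. Qed.

Lemma decomp_mul X Y U a V U' a' V' p q e e' :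
  decomp X U a V p e -> decomp Y U' a' V' q e' ->
  forall F, cnorm k (X *m F *m Y) = cnorm k (U *m (dg a *m (V *m F *m U') *m dg a') *m V').
Proof.
move=> [_ _ _ _ [c c1 ->]] [_ _ _ _ [c' c'1 ->]] F.
rewrite -!scalemxAl -scalemxAr scalerA cnormZ; last by rewrite normcM c1 c'1 mulr1.
by rewrite !mulmxA.
Qed.

Lemma decomp_mul_ge X Y U a V U' a' V' p q e e' :
  decomp X U a V p e -> decomp Y U' a' V' q e' ->
  forall F, pr a p * pr a' q * normc (minor (V *m F *m U') p q) <= Kd * cnorm k (X *m F *m Y).
Proof.
move=> dX dY F; rewrite (decomp_mul dX dY).
case: dX dY => [uU uV dp e1 _] [uU' uV' dq e'1 _].
have := cnorm_dg_ge (V *m F *m U') dp dq.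
have := cnorm_unitary_ge k (dg a *m (V *m F *m U') *m dg a') uU uV'.
set N0 := cnorm k (dg a *m _ *m _); set N := cnorm k _.
move=> le2 le1.
have N1 : 0 <= N by exact: cnorm_ge0.
have k0 := fact_gt0R R k; rewrite ler_pdivrMl in le1; last exact: k0.
apply: le_trans le1 _.
apply: le_trans (ler_wpM2l (ltW k0) le2) _.
by rewrite mulrA; apply: ler_wpM2r => //; exact: Kd_ge.
Qed.

Lemma decomp_mul_le X Y U a V U' a' V' p q e e' :
  decomp X U a V p e -> decomp Y U' a' V' q e' ->
  forall F M, 0 <= M -> (forall f g : T, normc (minor (V *m F *m U') f g) <= (k`!)%:R * M) ->
  cnorm k (X *m F *m Y) <=
    Kd * (pr a p * pr a' q * (normc (minor (V *m F *m U') p q) + M * e + M * e')).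
Proof.
move=> dX dY F M M0 FM; have := decomp_mul dX dY F => ->.
case: dX dY => [uU uV dp e1 _] [uU' uV' dq e'1 _].
have := cnorm_unitary_le k (dg a *m (V *m F *m U') *m dg a') uU uV'.
have := cnorm_dg_le dp dq M0 FM.
set N0 := cnorm k (dg a *m _ *m _); set N := cnorm k _.
set x := pr a p * _ * _ => le1 le2.
have x0 : 0 <= x.
  case: dp dq => [a0 _ e0 _] [a'0 _ e'0 _].
  apply: mulr_ge0; first by apply: mulr_ge0; apply: ltW; apply: pr_gt0.
  by rewrite !addr_ge0 ?mulr_ge0 // normc_ge0.
apply: le_trans le2 _; apply: (@le_trans _ _ (nT R d k ^+ 4 * (nT R d k ^+ 2 * x))).
  by apply: ler_wpM2l => //; apply: exprn_ge0; rewrite /nT.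
by rewrite mulrA -exprD; apply: ler_wpM2r => //; exact: Kd_ge'.
Qed.

Lemma decomp_mul1_le X Y U a V U' a' V' p q e e' :
  decomp X U a V p e -> decomp Y U' a' V' q e' ->
  cnorm k (X *m Y) <= Kd * (pr a p * pr a' q * (normc (minor (V *m U') p q) + e + e')).
Proof.
move=> dX dY; have [_ uV _ _ _] := dX; have [uU' _ _ _ _] := dY.
have := decomp_mul_le dX dY (F := 1%:M) ler01; rewrite !mulmx1 !mul1r; apply => f g.
by rewrite mulr1; exact: normc_minor_unitary (mul_unitarymx uV uU').
Qed.

Lemma decomp1 (p : T) : injective p -> decomp 1%:M 1%:M (const_mx 1) 1%:M p 1.
Proof.
move=> pi; split; rewrite ?unitary1 //; first exact: dominant_const1.
by exists 1; rewrite ?normc1 // scale1r dg_const1 !mulmx1.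
Qed.

(** Multiplying by V^* on the right makes the middle minor that of the identity. *)
Lemma decomp_ge X U a V p e : decomp X U a V p e -> pr a p <= Kd ^+ 2 * cnorm k X.
Proof.
move=> dX; have [uU uV [a0 pi e0 aP] e1 [c c1 XE]] := dX.
have K1 := Kd_ge1 p.
have dU : decomp (U *m dg a *m V) U a V p e by split => //; exists 1; rewrite ?scale1r ?normc1.
have dY : decomp (V^t*) (V^t*) (const_mx 1) 1%:M p 1.
  split; rewrite ?unitary1 ?trmxC_unitary //; first exact: dominant_const1.
  by exists 1; rewrite ?normc1 // scale1r dg_const1 !mulmx1.
have := decomp_mul_ge dX dY 1%:M; rewrite !mulmx1 (unitarymxP uV) (minor1 _ pi) normc1 mulr1.
have -> : pr (const_mx 1 : 'rV[R]_d) p = 1 by rewrite /pr big1 // => i _; rewrite mxE.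
rewrite mulr1 => le; apply: le_trans le _; rewrite expr2 -mulrA ler_wpM2l //; first lra.
apply: le_trans (cnormM _ _ _) _; rewrite mulrC ler_wpM2r ?cnorm_ge0 //.
apply: le_trans (cnorm_unitary _ _) _; first by rewrite trmxC_unitary.
exact: Kd_ge'.
Qed.

Lemma decomp_le X U a V p e : decomp X U a V p e -> cnorm k X <= 3 * Kd ^+ 2 * pr a p.
Proof.
move=> dX; have [uU uV [a0 pi e0 aP] e1 [c c1 XE]] := dX.
have K1 := Kd_ge1 p.
have := decomp_mul1_le dX (decomp1 pi); rewrite mulmx1.
have -> : pr (const_mx 1 : 'rV[R]_d) p = 1 by rewrite /pr big1 // => i _; rewrite mxE.
rewrite mulr1 => le; apply: le_trans le _.
have -> : 3 * Kd ^+ 2 * pr a p = Kd * (pr a p * (3 * Kd)) by ring.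
rewrite ler_wpM2l ?(le_trans ler01 K1) // ler_wpM2l ?(ltW (pr_gt0 p a0)) // mulmx1.
have : normc (minor V p p) <= (k`!)%:R by exact: normc_minor_unitary.
have : (k`!)%:R <= Kd by have := @Kd_ge p 0 isT; rewrite expr0 mulr1.
by move: (normc _) (k`!%:R : R) (Kd) K1 e1 => x y z; lra.
Qed.

End Decomposition.

Lemma ln_submul (R : realType) (x y z : R) : 0 < x -> 0 < y -> 0 < z ->
  z <= x * y -> ln z <= ln x + ln y.
Proof. by move=> x0 y0 z0 le; rewrite -lnM ?posrE // ler_ln ?posrE ?mulr_gt0. Qed.

Section LogNorm.
Variables (R : realType) (b : base_field) (n : nat).
Local Notation K := (field_of R b).
Local Notation C := R[i].
Local Notation G := (PSL K n).
Implicit Types (g h : G) (i : 'I_n).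

Definition liftC g : 'M[C]_n.+1 := cm (val (repr g)).

Lemma lift_unit g : liftC g \in unitmx.
Proof. by rewrite cm_unit; exact: SL_unit. Qed.

Lemma cm_center (A B : 'M[K]_n.+1) (c : K) : c ^+ n.+1 = 1 -> B = c *: A ->
  exists2 c' : C, normc c' = 1 & cm B = c' *: cm A.
Proof.
move=> c1 ->; exists (toC c); last by rewrite /cm map_mxZ.
apply: (@normc_root1 R _ n).
by have := congr1 (@toC R b) c1; rewrite rmorphXn rmorph1.
Qed.

Lemma liftM g h : exists2 c, normc c = 1 & liftC (g * h)%g = c *: (liftC g *m liftC h).
Proof.
have : \pi_(PSL K n) (SL_mul (repr g) (repr h)) = \pi_(PSL K n) (repr (g * h)%g).
  by rewrite reprK.
move/PSL_piP => [c c1 e]; have [c' c'1 e'] := cm_center c1 e.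
by exists c'; rewrite // /liftC e' /= cmM.
Qed.

Lemma liftV g : exists2 c, normc c = 1 & liftC (g^-1)%g = c *: invmx (liftC g).
Proof.
have : \pi_(PSL K n) (SL_inv (repr g)) = \pi_(PSL K n) (repr (g^-1)%g).
  by rewrite reprK.
move/PSL_piP => [c c1 e]; have [c' c'1 e'] := cm_center c1 e.
exists c' => //; rewrite /liftC e'; congr (_ *: _); exact: map_invmx.
Qed.

Definition logN i g : R := ln (cnorm i.+1 (liftC g)).

Lemma cnorm_lift_gt0 i g : 0 < cnorm i.+1 (liftC g).
Proof. by apply: cnorm_gt0; rewrite ?lift_unit // ltnS ltnW. Qed.

Lemma expR_logN i g : expR (logN i g) = cnorm i.+1 (liftC g).
Proof. by rewrite lnK // posrE cnorm_lift_gt0. Qed.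

Lemma cnorm_liftM i g h : cnorm i.+1 (liftC (g * h)%g) = cnorm i.+1 (liftC g *m liftC h).
Proof. by have [c c1 ->] := liftM g h; rewrite cnormZ. Qed.

Lemma logN_sub i g h : logN i (g * h)%g <= logN i g + logN i h.
Proof.
have le : cnorm i.+1 (liftC (g * h)%g) <= cnorm i.+1 (liftC g) * cnorm i.+1 (liftC h).
  by rewrite cnorm_liftM; exact: cnormM.
exact: (ln_submul (cnorm_lift_gt0 i g) (cnorm_lift_gt0 i h) (cnorm_lift_gt0 i (g * h)%g) le).
Qed.

Definition svdk g := sval (cid (svd g)).
Definition svdl g := sval (cid (svalP (cid (svd g)))).
Definition ecartan g : 'rV[R]_n.+1 := \row_j expR (cartan g 0 j).

Lemma svdP g : [/\ cm (svdk g) \is unitarymx, cm (svdl g) \is unitarymx,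
    liftC g = cm (svdk g) *m dg (ecartan g) *m cm (svdl g)
   & forall j j' : 'I_n.+1, (j <= j')%N -> cartan g 0 j' <= cartan g 0 j].
Proof. exact: (svalP (cid (svalP (cid (svd g))))). Qed.

Lemma ecartanE g j : ecartan g 0 j = expR (cartan g 0 j).
Proof. by rewrite mxE. Qed.

Lemma ecartan_gt0 g j : 0 < ecartan g 0 j.
Proof. by rewrite ecartanE expR_gt0. Qed.

Lemma ecartan_sorted g (j j' : 'I_n.+1) : (j <= j')%N -> ecartan g 0 j' <= ecartan g 0 j.
Proof. by move=> jj'; rewrite !ecartanE ler_expR; case: (svdP g) => _ _ _; apply. Qed.

Lemma ecartan_ratio g i : ecartan g 0 (lift ord0 i) / ecartan g 0 (widen_ord (leqnSn n) i) =
  expR (- simple_root i (cartan g)).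
Proof. by rewrite !ecartanE -expRN -expRD; congr expR; rewrite /simple_root; ring. Qed.

End LogNorm.

Lemma dgV (R : realType) m (a : 'rV[R]_m) : (forall j, 0 < a 0 j) ->
  dg a *m dg (\row_j (a 0 j)^-1) = 1%:M.
Proof.
move=> a0; apply/matrixP => x y; rewrite mul_diag_mx !mxE.
case: (x == y); rewrite ?mulr0n ?mulr0 // ?mulr1n -rmorphM /= mulfV //.
exact: lt0r_neq0.
Qed.

Lemma decomp_inv (R : realType) d k (X U V : 'M[R[i]]_d) (a : 'rV[R]_d)
    (p : {ffun 'I_k -> 'I_d}) e c :
  U \is unitarymx -> V \is unitarymx -> X = U *m dg a *m V -> (forall j, 0 < a 0 j) ->
  dominant (\row_j (a 0 j)^-1) p e -> e <= 1 -> normc c = 1 ->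
  decomp (c *: invmx X) (V^t*) (\row_j (a 0 j)^-1) (U^t*) p e.
Proof.
move=> uU uV XE a0 dp e1 c1; split; [| |exact: dp|exact: e1|].
- by rewrite trmxC_unitary.
- by rewrite trmxC_unitary.
exists c => //; congr (_ *: _).
have Uu := unitarymx_unit uU; have Vu := unitarymx_unit uV.
set Y := _ *m _; have XY : X *m Y = 1%:M.
  rewrite /Y XE -(invmx_unitary uU) -(invmx_unitary uV) !mulmxA mulmxK //.
  by rewrite -(mulmxA _ (dg a)) dgV // mulmx1 mulmxV.
have [Xu _] := mulmx1_unit XY.
by apply: (can_inj (mulKmx Xu)); rewrite mulmxV // XY.
Qed.

Lemma cnorm_scale2 (R : realType) d k (A B D : 'M[R[i]]_d) c c' :
  normc c = 1 -> normc c' = 1 ->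
  cnorm k (c *: (A *m (c' *: (B *m D)))) = cnorm k (A *m B *m D).
Proof. by move=> c1 c'1; rewrite (cnormZ _ _ c1) -scalemxAr (cnormZ _ _ c'1) mulmxA. Qed.

(** * Gromov products and limit flags *)

Section GromovProduct.
Variables (R : realType) (b : base_field) (n : nat).
Local Notation K := (field_of R b).
Local Notation C := R[i].
Local Notation G := (PSL K n).
Implicit Types (g h : G) (i : 'I_n).
Opaque PSL_mul PSL_inv.

Lemma simple_root_ge0 i g : 0 <= simple_root i (cartan g).
Proof.
rewrite /simple_root subr_ge0; case: (svdP g) => _ _ _; apply.
by rewrite /= /bump /= add1n.
Qed.

Lemma decomp_svd i g : decomp (liftC g) (cm (svdk g)) (ecartan g) (cm (svdl g))
  (iota_ n i.+1) (expR (- simple_root i (cartan g))).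
Proof.
case: (svdP g) => uk ul gE _; split => //.
- rewrite -ecartan_ratio; apply: dominant_sorted; [exact: ecartan_gt0|exact: ecartan_sorted].
- by rewrite -expR0 ler_expR oppr_le0 simple_root_ge0.
- by exists 1; rewrite ?normc1 // scale1r.
Qed.

(** Inverting keeps the order of the frames but not that of the singular values: the dominant map
    selects the last i + 1 indices, and the gap is the one at [rev_ord i]. *)
Lemma decomp_svdV i g : decomp (liftC (g^-1)%g) ((cm (svdl g))^t*)
  (\row_j (ecartan g 0 j)^-1) ((cm (svdk g))^t*)
  (rev_ (iota_ n i.+1)) (expR (- simple_root (rev_ord i) (cartan g))).
Proof.
case: (svdP g) => uk ul gE _; have [c c1 ->] := liftV g.
apply: (decomp_inv uk ul gE (ecartan_gt0 g)) => //.
- rewrite -ecartan_ratio; apply: dominant_inv_sorted; [exact: ecartan_gt0|exact: ecartan_sorted].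
- by rewrite -expR0 ler_expR oppr_le0 simple_root_ge0.
Qed.

Lemma pr_ecartan i g : pr (ecartan g) (iota_ n i.+1) = expR (fund_weight i (cartan g)).
Proof.
have ii : (i.+1 <= n.+1)%N by rewrite ltnS ltnW.
pose F (x : nat) := cartan g 0 (inord x).
have -> : fund_weight i (cartan g) = \sum_(j < n.+1 | (j < i.+1)%N) F j.
  by apply: eq_bigr => j _; rewrite /F inord_val.
rewrite -(big_ord_widen n.+1 F ii) expR_sum; apply: eq_bigr => x _.
by rewrite ecartanE /iota_ ffunE.
Qed.

Local Notation T i := {ffun 'I_(nat_of_ord i).+1 -> 'I_n.+1}.
Local Notation KD i := (Kd R n.+1 (nat_of_ord i).+1).

Lemma KD_ge1 i : 1 <= KD i.
Proof. exact: Kd_ge1 (iota_ n i.+1). Qed.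

Lemma KD_gt0 i : 0 < KD i.
Proof. exact: lt_le_trans ltr01 (KD_ge1 i). Qed.

Lemma KD3_gt0 i : 0 < 3 * KD i ^+ 2.
Proof. by rewrite mulr_gt0 ?exprn_gt0 ?KD_gt0. Qed.

Lemma KD3_ge i : KD i ^+ 2 <= 3 * KD i ^+ 2.
Proof. by have : 0 < KD i ^+ 2 by [rewrite exprn_gt0 ?KD_gt0]; move: (_ ^+ 2) => x; lra. Qed.

Lemma logN_cartan i g : `|logN i g - fund_weight i (cartan g)| <= ln (3 * KD i ^+ 2).
Proof.
have K1 := KD_ge1 i; have K0 := KD_gt0 i.
have ge := decomp_ge (decomp_svd i g); have le := decomp_le (decomp_svd i g).
rewrite pr_ecartan in ge le.
have N0 := cnorm_lift_gt0 i g.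
move: ge le; rewrite /logN; move: (cnorm _ _) N0 (fund_weight _ _) => N N0 w ge le.
have K20 : 0 < KD i ^+ 2 by rewrite exprn_gt0.
have K31 := KD3_ge i.
have K30 := KD3_gt0 i.
have h1 : ln N <= ln (3 * KD i ^+ 2) + w.
  by rewrite -[X in _ + X](expRK w); apply: ln_submul; rewrite ?expR_gt0.
have h2 : w <= ln (KD i ^+ 2) + ln N.
  by rewrite -[X in X <= _](expRK w); apply: ln_submul; rewrite ?expR_gt0.
have h3 : ln (KD i ^+ 2) <= ln (3 * KD i ^+ 2) by rewrite ler_ln ?posrE.
by rewrite ler_norml; apply/andP; split; lra.
Qed.

Lemma decomp_logN_le i g U a V (p : T i) e : decomp (liftC g) U a V p e ->
  logN i g <= ln (3 * KD i ^+ 2) + ln (pr a p).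
Proof.
move=> dg; have [_ _ [a0 _ _ _] _ _] := dg.
have le := decomp_le dg; have N0 := cnorm_lift_gt0 i g.
by apply: ln_submul => //; [exact: KD3_gt0|exact: pr_gt0].
Qed.

Lemma decomp_logN_ge i g U a V (p : T i) e : decomp (liftC g) U a V p e ->
  ln (pr a p) <= ln (3 * KD i ^+ 2) + logN i g.
Proof.
move=> dg; have [_ _ [a0 _ _ _] _ _] := dg.
have le := decomp_ge dg; have N0 := cnorm_lift_gt0 i g.
have K0 := KD_gt0 i.
have K30 := KD3_gt0 i.
apply: ln_submul; rewrite ?pr_gt0 //; apply: le_trans le _.
by rewrite ler_wpM2r ?KD3_ge // ltW.
Qed.

(** Two comparisons of W_i with a product of singular values, for g and for h, and one use of
    [decomp_mul_ge]. *)
Definition cgp i : R := 2 * ln (3 * KD i ^+ 2) + ln (KD i).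

(** The defect is controlled by one minor, which measures how far F moves the attracting flag of h
    away from the repelling flag of g. Only the norm of the lift of x matters, so x may be gh or
    gfh. *)
Lemma gromov_le_through i g h (x : G) F U a V (p : T i) e U' a' V' (q : T i) e' :
  decomp (liftC g) U a V p e -> decomp (liftC h) U' a' V' q e' ->
  cnorm i.+1 (liftC g *m F *m liftC h) = cnorm i.+1 (liftC x) ->
  0 < normc (minor (V *m F *m U') p q) ->
  logN i g + logN i h - logN i x <= cgp i - ln (normc (minor (V *m F *m U') p q)).
Proof.
move=> dg dh xE; have := decomp_mul_ge dg dh F; rewrite xE.
have [_ _ [a0 _ _ _] _ _] := dg; have [_ _ [a'0 _ _ _] _ _] := dh.
have lg := decomp_logN_le dg; have lh := decomp_logN_le dh.
have N0 := cnorm_lift_gt0 i x.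
move: (normc _) => m le m0.
have pa := pr_gt0 p a0; have qa := pr_gt0 q a'0; have K0 := KD_gt0 i.
have q0 : 0 < pr a p * pr a' q * m by apply: mulr_gt0 => //; apply: mulr_gt0.
have : ln (pr a p * pr a' q * m) <= ln (KD i) + ln (cnorm i.+1 (liftC x)).
  exact: (ln_submul K0 N0 q0 le).
rewrite (lnM (mulr_gt0 pa qa) m0) (lnM pa qa) -/(logN i x) /cgp.
move: lg lh; move: (logN i x) (logN i g) (logN i h) => z u v lg lh; lra.
Qed.

Lemma gromov_le3 i g f h U a V (p : T i) e U' a' V' (q : T i) e' :
  decomp (liftC g) U a V p e -> decomp (liftC h) U' a' V' q e' ->
  0 < normc (minor (V *m liftC f *m U') p q) ->
  logN i g + logN i h - logN i (g * (f * h))%g <=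
    cgp i - ln (normc (minor (V *m liftC f *m U') p q)).
Proof.
move=> dg dh; apply: (gromov_le_through dg dh).
have [c c1 ->] := liftM g (f * h)%g; have [c' c'1 ->] := liftM f h.
exact/esym/cnorm_scale2.
Qed.

Lemma gromov_le i g h U a V (p : T i) e U' a' V' (q : T i) e' :
  decomp (liftC g) U a V p e -> decomp (liftC h) U' a' V' q e' ->
  0 < normc (minor (V *m U') p q) ->
  logN i g + logN i h - logN i (g * h)%g <= cgp i - ln (normc (minor (V *m U') p q)).
Proof.
move=> dg dh; have := gromov_le_through dg dh (F := 1%:M) (x := (g * h)%g).
by rewrite !mulmx1; apply; rewrite cnorm_liftM.
Qed.

(** Converse of [gromov_le]: a small defect forces a large minor, up to the gaps e and e', which
    vanish along escaping sequences. *)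
Lemma gromov_ge i g h U a V (p : T i) e U' a' V' (q : T i) e' :
  decomp (liftC g) U a V p e -> decomp (liftC h) U' a' V' q e' ->
  expR (- (logN i g + logN i h - logN i (g * h)%g)) <=
    expR (cgp i) * (normc (minor (V *m U') p q) + e + e').
Proof.
move=> dg dh; have := decomp_mul1_le dg dh.
have [_ _ [a0 _ e0 _] _ _] := dg; have [_ _ [a'0 _ e'0 _] _ _] := dh.
have lg := decomp_logN_ge dg; have lh := decomp_logN_ge dh.
have N0 := cnorm_lift_gt0 i (g * h)%g.
rewrite -(cnorm_liftM i g h).
have m0 : 0 <= normc (minor (V *m U') p q) + e + e' by rewrite !addr_ge0 ?normc_ge0.
move: (_ + e') m0 => m m0 le.
have pa := pr_gt0 p a0; have qa := pr_gt0 q a'0; have K0 := KD_gt0 i.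
have K30 := KD3_gt0 i.
have {}le : expR (logN i (g * h)%g) <= KD i * (pr a p * pr a' q * m).
  by rewrite expR_logN.
move: lg lh le; move: (logN i (g * h)%g) (logN i g) (logN i h) => z x y lg lh le.
have {}lg : pr a p <= 3 * KD i ^+ 2 * expR x.
  by rewrite -[leLHS](lnK pa) -[X in _ <= X * _](lnK K30) -expRD ler_expR.
have {}lh : pr a' q <= 3 * KD i ^+ 2 * expR y.
  by rewrite -[leLHS](lnK qa) -[X in _ <= X * _](lnK K30) -expRD ler_expR.
have -> : expR (cgp i) = KD i * (3 * KD i ^+ 2) ^+ 2.
  rewrite /cgp expRD mulrC (lnK K0); congr (_ * _).
  by rewrite mulr2n mulrDl !mul1r expRD (lnK K30) expr2.
rewrite opprB opprD expRD expRD mulrA ?expRN.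
have x0 := expR_gt0 x; have y0 := expR_gt0 y.
rewrite ler_pdivrMr // ler_pdivrMr //; apply: le_trans le _.
have -> : KD i * (3 * KD i ^+ 2) ^+ 2 * m * expR y * expR x =
   KD i * ((3 * KD i ^+ 2 * expR x) * (3 * KD i ^+ 2 * expR y) * m) by ring.
rewrite ler_wpM2l ?(ltW K0) // ler_wpM2r // ler_pM // ltW //.
Qed.

End GromovProduct.

(** * Polynomial functions and Zariski density *)

Section Polynomials.
Variables (R : realType) (b : base_field) (n : nat).
Local Notation K := (field_of R b).
Local Notation C := R[i].

Definition polyfun (f : 'M[K]_n.+1 -> R) : Prop :=
  exists p : @real_poly R n, forall A, real_poly_eval p A = f A.

Lemma polyfun_cst (c : R) : polyfun (fun=> c).
Proof. by exists (mpoly.mpolyC _ c) => A; rewrite /real_poly_eval mpoly.mevalC. Qed.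

Lemma polyfun_coord x : polyfun (fun A => real_coord A x).
Proof.
exists (mpoly.mpolyX R (mpoly.mnm1 (enum_rank x))) => A.
by rewrite /real_poly_eval mpoly.mevalXU enum_rankK.
Qed.

Lemma polyfunD f g : polyfun f -> polyfun g -> polyfun (fun A => f A + g A).
Proof.
by move=> [p pf] [q qg]; exists (p + q) => A; rewrite /real_poly_eval mpoly.mevalD -pf -qg.
Qed.

Lemma polyfunM f g : polyfun f -> polyfun g -> polyfun (fun A => f A * g A).
Proof.
by move=> [p pf] [q qg]; exists (p * q) => A; rewrite /real_poly_eval mpoly.mevalM -pf -qg.
Qed.

Lemma polyfun_sum (I : Type) (r : seq I) (P : pred I) (F : I -> 'M[K]_n.+1 -> R) :
  (forall i, polyfun (F i)) -> polyfun (fun A => \sum_(i <- r | P i) F i A).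
Proof.
move=> H; elim: r => [|i r IH].
  by under eq_fun do rewrite big_nil; exact: polyfun_cst.
by under eq_fun do rewrite big_cons; case: (P i) => //; apply: polyfunD.
Qed.

Lemma polyfun_prod (I : Type) (r : seq I) (P : pred I) (F : I -> 'M[K]_n.+1 -> R) :
  (forall i, polyfun (F i)) -> polyfun (fun A => \prod_(i <- r | P i) F i A).
Proof.
move=> H; elim: r => [|i r IH].
  by under eq_fun do rewrite big_nil; exact: polyfun_cst.
by under eq_fun do rewrite big_cons; case: (P i) => //; apply: polyfunM.
Qed.

Definition cpolyfun (F : 'M[K]_n.+1 -> C) : Prop :=
  polyfun (fun A => complex.Re (F A)) /\ polyfun (fun A => complex.Im (F A)).

Lemma cpolyfun_cst (c : C) : cpolyfun (fun=> c).
Proof. by split; exact: polyfun_cst. Qed.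

Lemma cpolyfun_entry i j : cpolyfun (fun A => toC (A i j)).
Proof. by split; [exact: (polyfun_coord (false, i, j))|exact: (polyfun_coord (true, i, j))]. Qed.

Lemma cpolyfunD F H : cpolyfun F -> cpolyfun H -> cpolyfun (fun A => F A + H A).
Proof.
move=> [Fr Fi] [Hr Hi]; split.
  by under eq_fun do rewrite raddfD; exact: polyfunD.
by under eq_fun do rewrite raddfD; exact: polyfunD.
Qed.

Lemma polyfunN f : polyfun f -> polyfun (fun A => - f A).
Proof.
move=> pf; under eq_fun do rewrite -mulN1r.
by apply: polyfunM => //; exact: polyfun_cst.
Qed.

Lemma cpolyfunM F H : cpolyfun F -> cpolyfun H -> cpolyfun (fun A => F A * H A).
Proof.
move=> [Fr Fi] [Hr Hi]; split.
  under eq_fun do rewrite Re_cmul.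
  by apply: polyfunD; [|apply: polyfunN]; exact: polyfunM.
by under eq_fun do rewrite Im_cmul; apply: polyfunD; exact: polyfunM.
Qed.

Lemma cpolyfun_conj F : cpolyfun F -> cpolyfun (fun A => (F A)^*).
Proof.
have cE (x : C) : x^* = Complex (complex.Re x) (- complex.Im x) by case: x.
move=> [Fr Fi]; split; first by under eq_fun do rewrite cE.
by under eq_fun do rewrite cE; exact: polyfunN.
Qed.

Lemma cpolyfun_sum (I : Type) (r : seq I) (P : pred I) (F : I -> 'M[K]_n.+1 -> C) :
  (forall i, cpolyfun (F i)) -> cpolyfun (fun A => \sum_(i <- r | P i) F i A).
Proof.
move=> H; elim: r => [|i r IH].
  by under eq_fun do rewrite big_nil; exact: cpolyfun_cst.
by under eq_fun do rewrite big_cons; case: (P i) => //; apply: cpolyfunD.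
Qed.

Lemma cpolyfun_prod (I : Type) (r : seq I) (P : pred I) (F : I -> 'M[K]_n.+1 -> C) :
  (forall i, cpolyfun (F i)) -> cpolyfun (fun A => \prod_(i <- r | P i) F i A).
Proof.
move=> H; elim: r => [|i r IH].
  by under eq_fun do rewrite big_nil; exact: cpolyfun_cst.
by under eq_fun do rewrite big_cons; case: (P i) => //; apply: cpolyfunM.
Qed.

Lemma cpolyfun_minor k (l r : 'M[C]_n.+1) (f g : {ffun 'I_k -> 'I_n.+1}) :
  cpolyfun (fun A => minor (l *m cm A *m r) f g).
Proof.
apply: cpolyfun_sum => s; apply: cpolyfunM; first exact: cpolyfun_cst.
apply: cpolyfun_prod => i; under eq_fun do rewrite !mxE.
apply: cpolyfun_sum => x; apply: cpolyfunM; last exact: cpolyfun_cst.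
under eq_fun do rewrite mxE.
apply: cpolyfun_sum => y; apply: cpolyfunM; first exact: cpolyfun_cst.
by under eq_fun do rewrite mxE; exact: cpolyfun_entry.
Qed.

Lemma polyfun_normc2 F : cpolyfun F -> polyfun (fun A => normc (F A) ^+ 2).
Proof.
move=> [Fr Fi].
under eq_fun do rewrite normcE sqr_sqrtr ?addr_ge0 ?sqr_ge0 // !expr2.
by apply: polyfunD; apply: polyfunM.
Qed.

(** Invariance under the centre makes the zeros of f a well-defined closed subset of PSL. *)
Lemma zariski_vanish (Gamma : set (PSL K n)) (f : 'M[K]_n.+1 -> R) :
  zariski_dense Gamma -> polyfun f ->
  (forall (c : K) A, c ^+ n.+1 = 1 -> f (c *: A) = f A) ->
  (forall g, Gamma g -> f (val (repr g)) = 0) ->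
  forall A : SL K n, f (val A) = 0.
Proof.
move=> dense [p pf] fc fG A.
pose Z : set (PSL K n) := [set x | f (val (repr x)) = 0]%classic.
have ZE : Z = [set: PSL K n]%classic.
  apply: dense => //; exists [set p]%classic => B; rewrite /Z /=.
  have /PSL_piP[c c1 eB] := reprK (\pi_(PSL K n) B).
  have e : f (val (repr (\pi_(PSL K n) B))) = f (val B) by rewrite eB fc.
  split=> [fB q -> | H]; first by rewrite pf -e.
  by rewrite e -pf; apply: H.
have : Z (\pi_(PSL K n) A) by rewrite ZE.
have /PSL_piP[c c1 eB] := reprK (\pi_(PSL K n) A).
by rewrite /Z /= eB => H; rewrite fc.
Qed.

(** Used to evaluate identities that hold on SL: any X of the right determinant can be prescribed as
    l A r. *)
Lemma SL_through (l r X : 'M[K]_n.+1) : l \in unitmx -> r \in unitmx ->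
  \det X = \det l * \det r -> exists A : SL K n, l *m val A *m r = X.
Proof.
move=> lu ru dX.
have dA : \det (invmx l *m X *m invmx r) == 1.
  have l0 : \det l != 0 by rewrite -unitfE -unitmxE.
  have r0 : \det r != 0 by rewrite -unitfE -unitmxE.
  by rewrite !det_mulmx dX !det_inv mulrA mulVf // mul1r mulfV.
exists (Sub (invmx l *m X *m invmx r) dA) => /=.
by rewrite !mulmxA mulmxV // mul1mx mulmxKV.
Qed.

(** Corrects the determinant without changing the minors on the first i + 1 <= n rows or columns,
    which avoid [ord_max]. *)
Definition last_diag (x : K) : 'M[K]_n.+1 :=
  diag_mx (\row_j (if j == ord_max then x else 1)).

Lemma det_last_diag x : \det (last_diag x) = x.
Proof.
rewrite /last_diag det_diag (bigD1 ord_max) //= mxE eqxx big1 ?mulr1 // => j jm.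
by rewrite mxE (negbTE jm).
Qed.

Lemma minor_last_diagl x (X : 'M[C]_n.+1) (i : 'I_n) g :
  minor (cm (last_diag x) *m X) (iota_ n i.+1) g = minor X (iota_ n i.+1) g.
Proof.
rewrite /cm map_diag_mx minor_diagl big1 ?mul1r // => j _.
rewrite !mxE; case: eqP => [e|_]; last by rewrite rmorph1.
have : (iota_ n i.+1 j < n)%N by rewrite iota_val (leq_ltn_trans _ (ltn_ord i)) // -ltnS.
by rewrite e ltnn.
Qed.

Lemma minor_last_diagr x (X : 'M[C]_n.+1) (i : 'I_n) f :
  minor (X *m cm (last_diag x)) f (iota_ n i.+1) = minor X f (iota_ n i.+1).
Proof.
have E : (cm (last_diag x))^T = cm (last_diag x) by rewrite /cm map_trmx tr_diag_mx.
by rewrite -minor_tr trmx_mul E minor_last_diagl minor_tr.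
Qed.

(** The product over theta of the squared moduli of these minors is a polynomial, and it equals 1 at
    the A for which l A r is [last_diag]. *)
Lemma zariski_generic (Gamma : set (PSL K n)) (theta : {set 'I_n}) (l r : 'M[K]_n.+1) :
  zariski_dense Gamma -> l \in unitmx -> r \in unitmx ->
  exists2 g, Gamma g & forall i, i \in theta ->
    minor (cm l *m liftC g *m cm r) (iota_ n i.+1) (iota_ n i.+1) != 0.
Proof.
move=> dense lu ru; apply: contrapT => H.
pose m (i : 'I_n) (A : 'M[K]_n.+1) := minor (cm l *m cm A *m cm r) (iota_ n i.+1) (iota_ n i.+1).
pose f (A : 'M[K]_n.+1) := \prod_(i in theta) normc (m i A) ^+ 2.
have f0 : forall A : SL K n, f (val A) = 0.
  apply: (zariski_vanish dense).
  - by apply: polyfun_prod => i; apply: polyfun_normc2; exact: cpolyfun_minor.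
  - move=> c A c1; rewrite /f; apply: eq_bigr => i _.
    have [c' c'1 E] := cm_center c1 (erefl (c *: A)).
    suff -> : normc (m i (c *: A)) = normc (m i A) by [].
    by rewrite /m E -scalemxAr -scalemxAl minor_scale normcM normcX c'1 expr1n mul1r.
  - move=> g Gg; apply/eqP; rewrite /f prodf_seq_eq0; apply/negPn/negP => /hasPn nz.
    apply: H; exists g => // i it; have := nz i (mem_index_enum i).
    by rewrite it /= expf_eq0 /= normc_eq0.
have [A AE] := SL_through lu ru (det_last_diag (\det l * \det r)).
have := f0 A; rewrite /f => /eqP; rewrite prodf_seq_eq0 => /hasP[i _ /andP[it]].
rewrite expf_eq0 /= normc_eq0 /m -!cmM AE -[cm _]mulmx1 minor_last_diagl.
by rewrite minor1 ?oner_eq0 //; exact: iota_inj.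
Qed.

End Polynomials.

(** * Compactness of the unitary group and finite sets of transversals *)

Section Compactness.
Variables (R : realType) (b : base_field) (n : nat).
Local Notation K := (field_of R b).
Local Notation C := R[i].
Local Notation G := (PSL K n).
Local Open Scope classical_set_scope.

Definition ofC : C -> K :=
  match b with RealNumbers => fun z => complex.Re z | ComplexNumbers => id end.

Lemma ofCK (z : C) : (b = RealNumbers -> complex.Im z = 0) -> toC (ofC z) = z.
Proof. by rewrite /ofC; case: b => //=; case: z => x y /= ->. Qed.

Lemma Im_toC_real (x : K) : b = RealNumbers -> complex.Im (toC x) = 0.
Proof. by case: b x. Qed.

(** One subsequence serves all j. For K = R the limits of the imaginary parts are 0, so the limit
    matrix has entries in K. *)
Lemma unitary_compact (J : finType) (u : J -> nat -> 'M[K]_n.+1) :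
  (forall j m, cm (u j m) \is unitarymx) ->
  exists2 f, increasing_seq f & exists l : J -> 'M[K]_n.+1, forall j,
    mcvg (fun m => cm (u j (f m))) (cm (l j)) /\ cm (l j) \is unitarymx.
Proof.
move=> uu.
pose x (j : J * (bool * 'I_n.+1 * 'I_n.+1)) m : R := real_coord (u j.1 m) j.2.
have bx j m : `|x j m| <= 1.
  have h := unitary_entry j.2.1.2 j.2.2 (uu j.1 m).
  rewrite mxE in h; rewrite /x /real_coord; case: (j.2.1.1).
    by apply: le_trans (Im_le_normc _) h.
  by apply: le_trans (Re_le_normc _) h.
have [f fi [L LP]] := bolzano_weierstrass_family bx.
exists f => //.
pose z j i k : C := Complex (L (j, (false, i, k))) (L (j, (true, i, k))).
have zP j i k : ccvg (fun m => cm (u j (f m)) i k) (z j i k).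
  split; first by under eq_fun do rewrite mxE; exact: (LP (j, (false, i, k))).
  by under eq_fun do rewrite mxE; exact: (LP (j, (true, i, k))).
exists (fun j => \matrix_(i, k) ofC (z j i k)) => j.
have cv : mcvg (fun m => cm (u j (f m))) (cm (\matrix_(i, k) ofC (z j i k))).
  move=> i k; rewrite !mxE ofCK; first exact: zP.
  move=> br; have [_ H] := zP j i k.
  apply: (cvg_unique _ H) => //.
  have -> : (fun m => complex.Im (cm (u j (f m)) i k)) = fun=> 0.
    by apply: funext => m; rewrite mxE Im_toC_real.
  exact: cvg_cst.
by split => //; apply: mcvg_unitary cv _.
Qed.

(** Otherwise there are frames l_m, r_m for which each f in X m has a minor below 1 / (m + 1). At a
    limit of these frames [zariski_generic] gives one g in Gamma whose minors are nonzero, and g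
    belongs to X m for large m. *)
Lemma finite_transversals (Gamma : set G) (theta : {set 'I_n}) (X : nat -> seq G) :
  zariski_dense Gamma -> (forall f, Gamma f -> exists N, forall m, (N <= m)%N -> f \in X m) ->
  exists m delta, 0 < delta /\ forall l r : 'M[K]_n.+1,
    cm l \is unitarymx -> cm r \is unitarymx ->
    exists2 f, f \in X m & forall i, i \in theta ->
      delta <= normc (minor (cm l *m liftC f *m cm r) (iota_ n i.+1) (iota_ n i.+1)).
Proof.
move=> dense XP; apply: contrapT => H.
have bad m : exists lr : 'M[K]_n.+1 * 'M[K]_n.+1,
   [/\ cm lr.1 \is unitarymx, cm lr.2 \is unitarymx & forall f, f \in X m ->
     exists2 i, i \in theta &
       normc (minor (cm lr.1 *m liftC f *m cm lr.2) (iota_ n i.+1) (iota_ n i.+1)) < m.+1%:R^-1].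
  apply: contrapT => nb; apply: H; exists m, m.+1%:R^-1; split; first by rewrite invr_gt0.
  move=> l r ul ur; apply: contrapT => nf; apply: nb; exists (l, r); split; [exact: ul|exact: ur|move=> f fX].
  apply: contrapT => ni; apply: nf; exists f => // i it.
  by rewrite leNgt; apply/negP => lt; apply: ni; exists i.
have [lr lrP] := choice bad.
pose u (j : bool) m := if j then (lr m).1 else (lr m).2.
have uu j m : cm (u j m) \is unitarymx by rewrite /u; case: j; case: (lrP m).
have [f fi [L LP]] := unitary_compact uu.
have [cl ul] := LP true; have [cr ur] := LP false.
have lu : L true \in unitmx by rewrite -cm_unit; exact: unitarymx_unit ul.
have ru : L false \in unitmx by rewrite -cm_unit; exact: unitarymx_unit ur.
have [g Gg gP] := zariski_generic theta dense lu ru.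
have [N NP] := XP g Gg.
have cv i : (fun m => normc (minor (cm (lr (f m)).1 *m liftC g *m cm (lr (f m)).2)
    (iota_ n i.+1) (iota_ n i.+1))) @ \oo -->
    normc (minor (cm (L true) *m liftC g *m cm (L false)) (iota_ n i.+1) (iota_ n i.+1)).
  apply: ccvg_normc; apply: ccvg_minor; apply: mcvgM => //; apply: mcvgM => //.
  exact: mcvg_cst.
have ev : \forall m \near \oo, forall i : 'I_n, i \in theta ->
   (f m).+1%:R^-1 <= normc (minor (cm (lr (f m)).1 *m liftC g *m cm (lr (f m)).2)
     (iota_ n i.+1) (iota_ n i.+1)).
  apply: filter_forall => i; have [it|nit] := boolP (i \in theta); last exact: nearW.
  have a0 : 0 < normc (minor (cm (L true) *m liftC g *m cm (L false)) (iota_ n i.+1) (iota_ n i.+1)).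
    by rewrite normc_gt0 gP.
  set a := normc _ in a0 cv; have a20 : 0 < a / 2 by rewrite divr_gt0.
  have a2a : a / 2 < a by rewrite ltr_pdivrMr // ltr_pMr // ltr1n.
  have h1 := cvgr_gt a (cv i) (a / 2) a2a.
  have h2 := near_subseq fi (cvgr_lt 0 (@cvg_harmonic R) (a / 2) a20).
  near=> m; move=> _; apply: ltW; apply: (@lt_trans _ _ (a / 2)).
    by near: m; exact: h2.
  by near: m; exact: h1.
have [M _ MP] := ev; pose m := maxn M N.
have [_ _ badm] := lrP (f m).
have [|i it] := badm g.
  by apply: NP; apply: leq_trans (increasing_seq_ge fi m); rewrite leq_maxr.
by rewrite ltNge MP //= leq_maxl.
Unshelve. all: by end_near. Qed.

End Compactness.

Lemma ler_sum_norm2 (R : realType) (I : finType) (T : eqType) (F : I -> T -> R)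
    (s : seq T) i f : f \in s -> F i f <= \sum_(x <- s) \sum_j `|F j x|.
Proof.
move=> fs; apply: le_trans (ler_norm _) _.
rewrite (big_rem f) //= (bigD1 i) //= -addrA lerDl.
by rewrite addr_ge0 ?sumr_ge0 // => y _; apply: sumr_ge0.
Qed.

Section FiniteSet.
Variables (R : realType) (b : base_field) (n : nat) (theta : {set 'I_n}).
Local Notation K := (field_of R b).
Local Notation G := (PSL K n).

Definition omega (i : theta_root theta) (g : G) : R := logN (val i) g.

(** The minor estimate bounds W_i(g) + W_i(h) - W_i(gfh); replacing W_i(h) by W_i(fh) costs at most
    W_i(f), bounded over the finite set. *)
Lemma good_finite_set (Gamma : set G) (X : nat -> seq G) :
  zariski_dense Gamma -> (forall m f, f \in X m -> Gamma f) ->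
  (forall f, Gamma f -> exists N, forall m, (N <= m)%N -> f \in X m) ->
  exists (F : seq G) (Cf : R), [/\ forall f, f \in F -> Gamma f, 0 <= Cf &
    forall g h, exists2 f, f \in F & good omega Cf g (f * h)%g].
Proof.
move=> dense XG XP.
have [m [delta [d0 H]]] := finite_transversals theta dense XP.
pose Cf : R := \sum_(f <- X m) \sum_(i : theta_root theta) `|omega i f|
   + \sum_(i : theta_root theta) `|@cgp R n (val i)| + `|ln delta|.
exists (X m), Cf; split; first exact: XG.
  rewrite /Cf !addr_ge0 //; first by apply: sumr_ge0 => f _; apply: sumr_ge0.
  exact: sumr_ge0.
move=> g h; have [_ ul _ _] := svdP g; have [uk _ _ _] := svdP h.
have [f fX fP] := H _ _ ul uk; exists f => // i.
have := fP (val i) (valP i); set mm := normc _ => dm.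
have mm0 : 0 < mm by apply: lt_le_trans d0 dm.
have := gromov_le3 (decomp_svd (val i) g) (decomp_svd (val i) h) mm0.
have := logN_sub (val i) f h.
have l1 : ln delta <= ln mm by rewrite ler_ln ?posrE.
have l2 : omega i f <= \sum_(f <- X m) \sum_(i : theta_root theta) `|omega i f|.
  exact: (ler_sum_norm2 omega i fX).
have l3 : @cgp R n (val i) <= \sum_(i : theta_root theta) `|@cgp R n (val i)|.
  by apply: le_trans (ler_norm _) _; rewrite (bigD1 i) //= lerDl sumr_ge0.
have l4 : - ln delta <= `|ln delta| by rewrite -normrN ler_norm.
move: l1 l2 l3 l4; rewrite /Cf /omega -/mm.
set s1 := \sum_(f <- X m) _; set s2 := \sum_(i : theta_root theta) _.
move: (ln mm) (ln delta) (`|_|) (cgp _ _).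
move: (logN _ (f * h)%g) (logN _ (g * (f * h))%g) (logN _ f) (logN _ g) (logN _ h).
by move: s1 s2 => s1 s2 *; lra.
Qed.

End FiniteSet.

(** * Frames, flags and the limit set *)

Section FlagFrames.
Variables (K : fieldType) (n : nat) (theta : {set 'I_n}).
Implicit Types (k : 'M[K]_n.+1) (F : flag K theta).

Definition cols k m : seq 'cV[K]_n.+1 :=
  [seq col j k | j : 'I_n.+1 <- enum 'I_n.+1 & (j <= m)%N].

Lemma invmx_col k j : k \in unitmx -> invmx k *m col j k = col j 1%:M.
Proof. by move=> ku; rewrite !colE mulmxA mulVmx. Qed.

Lemma mem_span_cols k m (v : 'cV[K]_n.+1) : k \in unitmx ->
  (v \in <<cols k m>>%VS) <-> (forall j : 'I_n.+1, (m < j)%N -> (invmx k *m v) j 0 = 0).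
Proof.
move=> ku; split=> [vs j mj|H].
  have vs' : v \in <<in_tuple (cols k m)>>%VS by [].
  rewrite (coord_span vs') mulmx_sumr summxE big1 // => x _.
  rewrite -scalemxAr mxE.
  have : (in_tuple (cols k m))`_x \in cols k m by rewrite mem_nth.
  move=> /mapP[y]; rewrite mem_filter => /andP[ym _] ->.
  rewrite invmx_col // !mxE; case: eqP => [e|_]; rewrite ?mulr0 //.
  by move: mj; rewrite e ltnNge ym.
have -> : v = \sum_j (invmx k *m v) j 0 *: col j k.
  rewrite -{1}(mulKVmx ku v); apply/matrixP => i x; rewrite ord1 mxE summxE.
  by apply: eq_bigr => j _; rewrite !mxE mulrC.
apply: memv_suml => j _; have [jm|mj] := leqP j m; last by rewrite H // scale0r mem0v.
by apply/memvZ/memv_span/map_f; rewrite mem_filter jm mem_enum.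
Qed.

Lemma dim_span_cols k m : k \in unitmx -> (m < n.+1)%N -> \dim <<cols k m>> = m.+1.
Proof.
move=> ku mn.
have full : <<[seq col j k | j : 'I_n.+1 <- enum 'I_n.+1]>>%VS = fullv.
  apply/vspaceP => v; rewrite memvf; have := mem_span_cols n v ku.
  rewrite /cols (@all_filterP _ _ _ _); last by apply/allP => j _; rewrite -ltnS.
  by case=> _; apply=> j; rewrite ltnNge -ltnS ltn_ord.
have fr : free [seq col j k | j : 'I_n.+1 <- enum 'I_n.+1].
  by rewrite /free full dimvf size_map size_enum_ord /dim /= muln1.
have /eqP -> : free (cols k m).
  pose P := fun j : 'I_n.+1 => (j <= m)%N.
  apply: (@catl_free _ _ [seq col j k | j <- enum 'I_n.+1 & predC P j]).
  by rewrite -map_cat (perm_free (perm_map _ (permEl (perm_filterC P _)))).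
rewrite size_map size_filter -sum1_count big_enum_cond /=.
rewrite (eq_bigl (fun j : 'I_n.+1 => (j < m.+1)%N)) //.
by rewrite -(big_ord_widen n.+1 (fun=> 1%N) mn) sum1_card card_ord.
Qed.

Lemma flag_exists k : k \in unitmx -> exists F, flag_of_frame k F.
Proof.
move=> ku.
pose part (i : theta_root theta) : {vspace 'cV[K]_n.+1} := <<cols k (val i)>>%VS.
have dimp (i : theta_root theta) : \dim (part i) = (val i).+1.
  by apply: dim_span_cols => //; rewrite ltnW // ltnS.
have nest (i j : theta_root theta) : (val i <= val j)%N -> (part i <= part j)%VS.
  move=> ij; apply: sub_span => v /mapP[x]; rewrite mem_filter => /andP[xi _] ->.
  by apply: map_f; rewrite mem_filter mem_enum (leq_trans xi ij).
by exists (Flag dimp nest).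
Qed.

Lemma flag_of_frame_inj k F F' : flag_of_frame k F -> flag_of_frame k F' -> F = F'.
Proof.
move=> kF kF'; have e : flag_part F = flag_part F'.
  by apply: funext => i; rewrite kF kF'.
move: kF kF' e; case: F F' => [p d m] [p' d' m'] _ _ /= e.
move: d m d' m'; rewrite e => d m d' m'.
by congr Flag; exact: Prop_irrelevance.
Qed.

Hypothesis theta_sym : symmetric_roots theta.

(** A zero minor yields a nonzero combination w of the first i + 1 columns of k' whose last i + 1
    coordinates in the frame k vanish; then w lies in the parts of F and F' of complementary
    dimensions d - i - 1 and i + 1. *)
Lemma transverse_minor k k' F F' i : k \in unitmx -> k' \in unitmx ->
  flag_of_frame k F -> flag_of_frame k' F' -> transverse F F' -> i \in theta ->
  minor (invmx k *m k') (rev_ (iota_ n i.+1)) (iota_ n i.+1) != 0.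
Proof.
move=> ku ku' kF kF' tr it; apply/negP; rewrite /minor -det_tr => /det0P[v v0 vM].
pose ir : theta_root theta := exist _ (rev_ord i) (etrans (theta_sym i) it).
pose ii : theta_root theta := exist _ i it.
have /tr[/directv_addP dir _] : val ii = rev_ord (val ir) by rewrite /= rev_ordK.
pose w := \sum_y v 0 y *: col (iota_ n i.+1 y) k'.
have wF' : w \in F' ii.
  rewrite kF'; apply: memv_suml => y _; apply/memvZ/memv_span/map_f.
  by rewrite mem_filter mem_enum andbT iota_val -ltnS.
have wE : invmx k *m w = \sum_y v 0 y *: col (iota_ n i.+1 y) (invmx k *m k').
  by rewrite /w mulmx_sumr; apply: eq_bigr => y _; rewrite -scalemxAr !colE mulmxA.
have wF : w \in F ir.
  rewrite kF; apply/(mem_span_cols _ _ ku) => j /= nj.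
  rewrite wE summxE.
  have nji : (n - j < i.+1)%N by have := ltn_ord i; have := ltn_ord j; lia.
  have := congr1 (fun r : 'rV[K]_i.+1 => r 0 (Ordinal nji)) vM => e.
  rewrite [LHS]mxE [RHS]mxE in e; apply: etrans e.
  have jE : rev_ (iota_ n i.+1) (Ordinal nji) = j.
    by apply/val_inj; rewrite ffunE /= iota_val /=; have := ltn_ord j; lia.
  by apply: eq_bigr => y _; rewrite [LHS]mxE [col _ _ _ _]mxE; congr (_ * _); rewrite [RHS]mxE [RHS]mxE jE.
have : w \in (F ir :&: F' ii)%VS by rewrite memv_cap wF wF'.
rewrite dir memv0 => /eqP w0.
have : invmx k' *m w = 0 by rewrite w0 mulmx0.
move=> /matrixP e; case/negP: v0; apply/eqP/rowP => y; rewrite mxE.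
have := e (iota_ n i.+1 y) 0; rewrite /w mulmx_sumr summxE !mxE => <-.
rewrite (bigD1 y) //= big1 ?addr0.
  by rewrite -scalemxAr invmx_col // !mxE eqxx mulr1.
move=> x xy; rewrite -scalemxAr invmx_col // !mxE; case: eqP => [/(@iota_inj n i)e'|_].
  by move: xy; rewrite e' eqxx.
by rewrite mulr0.
Qed.

(** The first column of k' lies in the part of F of index [rev_ord i], so the first column of the
    submatrix is zero. *)
Lemma self_minor k k' F i : k \in unitmx -> k' \in unitmx ->
  flag_of_frame k F -> flag_of_frame k' F -> i \in theta ->
  minor (invmx k *m k') (rev_ (iota_ n i.+1)) (iota_ n i.+1) = 0.
Proof.
move=> ku ku' kF kF' it.
pose ir : theta_root theta := exist _ (rev_ord i) (etrans (theta_sym i) it).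
have : col 0 k' \in F ir.
  by rewrite kF'; apply/memv_span/map_f; rewrite mem_filter mem_enum.
rewrite kF => /(mem_span_cols _ _ ku) H.
rewrite /minor (expand_det_col _ 0) big1 // => x _; rewrite mxE.
have -> : iota_ n i.+1 0 = 0 by apply/val_inj; rewrite [LHS]iota_val.
have := H (rev_ (iota_ n i.+1) x); rewrite !colE mulmxA -colE [col _ _ _ _]mxE => ->.
  by rewrite mul0r.
rewrite ffunE /= iota_val; have := ltn_ord i; have := ltn_ord x; lia.
Qed.

End FlagFrames.

Section LimitSet.
Variables (R : realType) (b : base_field) (n : nat) (theta : {set 'I_n}).
Local Notation K := (field_of R b).
Local Notation C := R[i].
Local Notation G := (PSL K n).
Local Open Scope classical_set_scope.

Lemma ccvg_base_field (z : nat -> K) (l : K) :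
  ccvg (fun m => toC (z m)) (toC l) -> z @ \oo --> l.
Proof.
case: b z l => z l [zr zi]; first exact: zr.
apply/cvgrPdist_lt => e e0.
have [er ei] : 0 < complex.Re e /\ e = (complex.Re e)%:C%C.
  by move: e0; rewrite ltcE /= => /andP[/eqP ie re]; split => //; case: e ie re => x y /= ->.
have H : (fun m => normc (l - z m)) @ \oo --> (0 : R).
  have -> : (0 : R) = normc (l - l : C) by rewrite subrr ComplexField.Normc.normc0.
  apply: ccvg_normc; apply: ccvgD; first exact: ccvg_cst.
  have zl : ccvg z l by split.
  have := ccvgM (ccvg_cst (-1)) zl; rewrite mulN1r.
  by under eq_fun do rewrite mulN1r.
have h := cvgr_lt 0 H _ er.
near=> m; rewrite ei normc_def -normcE ltcR; near: m; exact: h.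
Unshelve. all: by end_near. Qed.

(** A flag-open set pulls back to an open set of frames, so convergence of frames suffices. *)
Lemma flag_cvg_frame (u : nat -> 'M[K]_n.+1) k (v : nat -> flag K theta) F :
  mcvg (fun m => cm (u m)) (cm k) -> k \in unitmx -> (forall m, u m \in unitmx) ->
  (forall m, flag_of_frame (u m) (v m)) -> flag_of_frame k F -> flag_cvg v F.
Proof.
move=> uk ku uu uv kF U oU UF.
pose S := [set g : 'M[K]_n.+1 | g \in unitmx /\ exists2 F, U F & flag_of_frame g F].
have Sk : nbhs k S by apply: open_nbhs_nbhs; split => //; split => //; exists F.
have [P Pk PS] := Sk.
have ev : \forall m \near \oo, forall i j, P i j (u m i j).
  apply: filter_forall => i; apply: filter_forall => j.
  have cv : (fun m => u m i j) @ \oo --> k i j.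
    by apply: ccvg_base_field; have := uk i j; rewrite mxE; under eq_fun do rewrite mxE.
  exact: cv (P i j) (Pk i j).
apply: filterS ev => m Pm; have [_ [F' UF' mF']] := PS (u m) Pm.
by rewrite (flag_of_frame_inj (uv m) mF').
Qed.

Variable Gamma : set G.
Hypothesis Gdiv : divergent theta Gamma.

Definition escaping (u : nat -> G) := forall x, \forall m \near \oo, u m <> x.

(** Divergence is stated for injective sequences; if the root stayed below M infinitely often, an
    injective subsequence of these terms would contradict it. *)
Lemma simple_root_escaping (u : nat -> G) i : i \in theta -> (forall m, Gamma (u m)) ->
  escaping u -> forall M, \forall m \near \oo, M <= simple_root i (cartan (u m)).
Proof.
move=> it Gu ue M; apply: contrapT => H.
have next N : exists m, (N <= m)%N /\ simple_root i (cartan (u m)) < M.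
  apply: contrapT => nx; apply: H; exists N => // m /= Nm.
  by rewrite leNgt; apply/negP => lt; apply: nx; exists m.
have [f fP] := choice next.
pose e := fix e k := if k is k'.+1 then f (e k').+1 else f 0%N.
have ei : increasing_seq e.
  by apply/increasing_seqP => k; case: (fP (e k).+1).
have eM k : simple_root i (cartan (u (e k))) < M by case: k => [|k]; [case: (fP 0%N)|case: (fP (e k).+1)].
have ue' : escaping (u \o e) by move=> x; exact: (near_subseq (P := fun m => u m <> x) ei (ue x)).
have [g gi uinj] := injective_subseq ue'.
have := Gdiv uinj (fun m => Gu _) => /cvgeyPge /(_ M)[N _ NP].
have := NP N (leqnn N); rewrite leNgt => /negP; apply.
apply: le_lt_trans (_ : ((simple_root i (cartan (u (e (g N)))))%:E < M%:E)%E); last by rewrite lte_fin.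
by rewrite (bigD1 i) //= ge_min lexx.
Qed.

Lemma limit_set_frame (u : nat -> G) k (F : flag K theta) : (forall m, Gamma (u m)) -> escaping u ->
  mcvg (fun m => cm (svdk (u m))) (cm k) -> k \in unitmx -> flag_of_frame k F ->
  limit_set Gamma F.
Proof.
move=> Gu ue uk ku kF.
have [f fi finj] := injective_subseq ue.
have pos : \forall m \near \oo, forall i, i \in theta -> 0 < simple_root i (cartan (u (f m))).
  apply: filter_forall => i; have [it|nit] := boolP (i \in theta); last exact: nearW.
  have := near_subseq fi (simple_root_escaping it Gu ue 1).
  by apply: filterS => m h _; apply: lt_le_trans ltr01 h.
have [N _ NP] := pos.
(* [is_Utheta] requires positive roots at every term, hence the shift by N. *)
pose g m := f (m + N)%N.
have gi : increasing_seq g by move=> i j; rewrite /g fi leq_add2r.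
have ginj : injective (u \o g) by move=> i j /finj; apply: addIn.
have su m : svdk (u (g m)) \in unitmx.
  by rewrite -cm_unit; have [uk' _ _ _] := svdP (u (g m)); exact: unitarymx_unit uk'.
have [v vP] := choice (fun m => flag_exists theta (su m)).
exists (u \o g), v; split => //.
- by move=> m; apply: Gu.
- move=> m; split; first by move=> i it; apply: NP => //; rewrite /= leq_addl.
  exists (svdk (u (g m))), (svdl (u (g m))).
  have [uk' ul' E _] := svdP (u (g m)); split; [exact: uk'|exact: ul'| |exact: vP].
  rewrite -/(cm _) -/(liftC _) E; congr (_ *m diag_mx _ *m _).
  by apply/rowP => j; rewrite mxE ecartanE [RHS]mxE.
- apply: (flag_cvg_frame (u := fun m => svdk (u (g m)))) ku _ vP kF; last exact: su.
  exact: (mcvg_subseq gi uk).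
Qed.

End LimitSet.

(** * Hyperbolicity from the transversality of limit flags *)

Section Hyperbolicity.
Variables (R : realType) (b : base_field) (n : nat) (theta : {set 'I_n}).
Local Notation K := (field_of R b).
Local Notation C := R[i].
Local Notation G := (PSL K n).
Local Notation omega := (@omega R b n theta).
Local Open Scope classical_set_scope.
Variable Gamma : set G.
Hypothesis Gdiv : divergent theta Gamma.
Hypothesis theta_sym : symmetric_roots theta.
Hypothesis Gtrans : forall F F' : flag K theta,
  limit_set Gamma F -> limit_set Gamma F' -> F <> F' -> transverse F F'.

(** As k is unitary in the applications, this is a minor of k^-1 k'; it measures the transversality
    at the root i of the flags spanned by k and k'. *)
Definition iminor (k k' : 'M[C]_n.+1) (i : 'I_n) : C :=
  minor (k^t* *m k') (rev_ (iota_ n i.+1)) (iota_ n i.+1).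

Lemma iminor_cvg (k k' : nat -> 'M[C]_n.+1) l l' i : mcvg k l -> mcvg k' l' ->
  (fun m => normc (iminor (k m) (k' m) i)) @ \oo --> normc (iminor l l' i).
Proof.
by move=> kl kl'; apply/ccvg_normc/ccvg_minor/mcvgM => //; exact: mcvg_adj.
Qed.

Lemma iminor_cm (k k' : 'M[K]_n.+1) i : cm k \is unitarymx ->
  iminor (cm k) (cm k') i = toC (minor (invmx k *m k') (rev_ (iota_ n i.+1)) (iota_ n i.+1)).
Proof.
move=> uk; rewrite /iminor -(invmx_unitary uk) -map_minor; congr minor.
by rewrite map_mxM /cm map_invmx.
Qed.

Lemma gromov_iminor_le i (g h : G) : 0 < normc (iminor (cm (svdk g)) (cm (svdk h)) i) ->
  logN i (g^-1)%g + logN i h - logN i (g^-1 * h)%g <=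
    @cgp R n i - ln (normc (iminor (cm (svdk g)) (cm (svdk h)) i)).
Proof. exact: (gromov_le (decomp_svdV i g) (decomp_svd i h)). Qed.

Lemma gromov_iminor_ge i (g h : G) :
  expR (- (logN i (g^-1)%g + logN i h - logN i (g^-1 * h)%g)) <=
    expR (@cgp R n i) * (normc (iminor (cm (svdk g)) (cm (svdk h)) i)
      + expR (- simple_root (rev_ord i) (cartan g)) + expR (- simple_root i (cartan h))).
Proof. exact: (gromov_ge (decomp_svdV i g) (decomp_svd i h)). Qed.

Variables (u u' : nat -> G) (k k' : 'M[K]_n.+1).
Hypothesis Gu : forall m, Gamma (u m).
Hypothesis Gu' : forall m, Gamma (u' m).
Hypothesis ue : escaping u.
Hypothesis ue' : escaping u'.
Hypothesis uk : mcvg (fun m => cm (svdk (u m))) (cm k).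
Hypothesis uk' : mcvg (fun m => cm (svdk (u' m))) (cm k').
Hypothesis unik : cm k \is unitarymx.
Hypothesis unik' : cm k' \is unitarymx.

(** The two gaps in [gromov_iminor_ge] tend to 0, so a bounded defect keeps the minor away from
    0. *)
Lemma bounded_iminor Cc i : i \in theta ->
  (forall m, logN i (u m)^-1%g + logN i (u' m) - logN i ((u m)^-1 * u' m)%g <= Cc) ->
  iminor (cm k) (cm k') i != 0.
Proof.
move=> it bd; apply/negP => /eqP i0.
have it' : rev_ord i \in theta by rewrite theta_sym.
(* Small enough that the minor and both gaps, once at most d, add up to less than the lower bound 4
   d given by [gromov_iminor_ge]. *)
pose d := expR (- Cc - @cgp R n i) / 4.
have d0 : 0 < d by rewrite divr_gt0 ?expR_gt0.
have cv := iminor_cvg (i := i) uk uk'; rewrite i0 ComplexField.Normc.normc0 in cv.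
have h1 := cvgr_lt 0 cv d d0.
have h2 := simple_root_escaping Gdiv it' Gu ue (- ln d).
have h3 := simple_root_escaping Gdiv it Gu' ue' (- ln d).
have [N1 _ P1] := h1; have [N2 _ P2] := h2; have [N3 _ P3] := h3.
pose m := (N1 + N2 + N3)%N.
have l1 := P1 m (leq_trans (leq_addr N2 N1) (leq_addr N3 (N1 + N2))).
have l2 := P2 m (leq_trans (leq_addl N1 N2) (leq_addr N3 (N1 + N2))).
have l3 := P3 m (leq_addl (N1 + N2) N3).
have := gromov_iminor_ge i (u m) (u' m); have := bd m.
rewrite /= in l1 l2 l3.
move: l1 l2 l3; move: (logN i ((u m)^-1 * u' m)%g) (logN i (u m)^-1%g) (logN i (u' m)) => w3 w1 w2.
move: (simple_root (rev_ord i) (cartan (u m))) (simple_root i (cartan (u' m))) => y z.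
move: (normc _) => x l1 l2 l3 bdm.
have e2 : expR (- y) <= d by rewrite -(lnK d0) ler_expR lerNl.
have e3 : expR (- z) <= d by rewrite -(lnK d0) ler_expR lerNl.
have {}bdm : expR (- Cc) <= expR (- (w1 + w2 - w3)) by rewrite ler_expR lerN2.
move/(le_trans bdm); apply/negP; rewrite -ltNge.
apply: (@lt_le_trans _ _ (expR (@cgp R n i) * (4 * d))).
  have aux (x1 x2 x3 e : R) : x1 < e -> x2 <= e -> x3 <= e -> 0 < e -> x1 + x2 + x3 < 4 * e.
    by move=> *; lra.
  by rewrite ltr_pM2l ?expR_gt0 //; exact: aux.
have -> : 4 * d = expR (- Cc - @cgp R n i) by rewrite /d; field.
by rewrite -expRD ler_expR addrCA subrr addr0.
Qed.

(** If all the limit minors were nonzero, [gromov_iminor_le] would bound every defect by a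
    constant. *)
Lemma unbounded_iminor : (forall m, exists2 i, i \in theta &
     m%:R < logN i (u m)^-1%g + logN i (u' m) - logN i ((u m)^-1 * u' m)%g) ->
  exists2 i, i \in theta & iminor (cm k) (cm k') i = 0.
Proof.
move=> unb; apply: contrapT => H.
have ev : \forall m \near \oo, forall i : 'I_n, i \in theta ->
   logN i (u m)^-1%g + logN i (u' m) - logN i ((u m)^-1 * u' m)%g < m%:R.
  apply: filter_forall => i; have [it|nit] := boolP (i \in theta); last exact: nearW.
  pose a := normc (iminor (cm k) (cm k') i).
  have a0 : 0 < a by rewrite normc_gt0; apply/eqP => e; apply: H; exists i.
  have cv : (fun m => normc (iminor (cm (svdk (u m))) (cm (svdk (u' m))) i)) @ \oo --> a.
    exact: iminor_cvg uk uk'.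
  have a20 : 0 < a / 2 by rewrite divr_gt0.
  have a2a : a / 2 < a by rewrite ltr_pdivrMr // ltr_pMr // ltr1n.
  have h1 := cvgr_gt a cv (a / 2) a2a.
  have h2 : \forall m \near \oo, @cgp R n i - ln (a / 2) < m%:R.
    exists (Num.bound `|@cgp R n i - ln (a / 2)|) => // m /= bm.
    apply: le_lt_trans (ler_norm _) _; apply: lt_le_trans (archi_boundP _) _ => //.
    by rewrite ler_nat.
  have aux (x y : R) : 0 < y -> y < x -> @cgp R n i - ln x <= @cgp R n i - ln y.
    move=> y0 yx; have x0 := lt_trans y0 yx.
    by rewrite lerD2l lerN2 ler_ln ?posrE // ltW.
  near=> m; move=> _.
  have l1 : a / 2 < normc (iminor (cm (svdk (u m))) (cm (svdk (u' m))) i) by near: m; exact: h1.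
  have l2 : @cgp R n i - ln (a / 2) < m%:R by near: m; exact: h2.
  apply: le_lt_trans l2; apply: le_trans (gromov_iminor_le (lt_trans a20 l1)) _.
  exact: aux.
have [N _ NP] := ev; have [i it] := unb N.
by rewrite ltNge ltW // NP /=.
Unshelve. all: by end_near. Qed.

(** Both flags are in the limit set, and a zero minor contradicts transversality; distinct limit
    flags are transverse. *)
Lemma limit_flag_eq (F F' : flag K theta) : flag_of_frame k F -> flag_of_frame k' F' ->
  (exists2 i, i \in theta & iminor (cm k) (cm k') i = 0) -> F = F'.
Proof.
move=> kF kF' [i it i0]; apply: contrapT => FF'.
have ku : k \in unitmx by rewrite -cm_unit; exact: unitarymx_unit unik.
have ku' : k' \in unitmx by rewrite -cm_unit; exact: unitarymx_unit unik'.
have lF := limit_set_frame Gdiv Gu ue uk ku kF.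
have lF' := limit_set_frame Gdiv Gu' ue' uk' ku' kF'.
have := transverse_minor theta_sym ku ku' kF kF' (Gtrans lF lF' FF') it.
have := i0; rewrite (iminor_cm k' i unik) -(rmorph0 (@toC R b)) => /(fmorph_inj _) ->.
by rewrite eqxx.
Qed.

End Hyperbolicity.

Section HyperbolicTriples.
Variables (R : realType) (b : base_field) (n : nat) (theta : {set 'I_n}).
Local Notation K := (field_of R b).
Local Notation C := R[i].
Local Notation G := (PSL K n).
Local Notation omega := (@omega R b n theta).
Local Open Scope classical_set_scope.

Lemma omega_sub (i : theta_root theta) (g h : G) : omega i (g * h)%g <= omega i g + omega i h.
Proof. exact: logN_sub. Qed.

(** Along a sequence of counterexamples the frames of a, c and d converge. The two unbounded defects
    identify the limit flag of c with those of a and of d, whereas the bounded defect at (a^-1, d)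
    gives a nonzero minor between the latter two, against [self_minor]. *)
Lemma hyperbolic_triples (Gamma : set G) : symmetric_roots theta -> is_subgroup Gamma ->
  divergent theta Gamma ->
  (forall F F' : flag K theta,
    limit_set Gamma F -> limit_set Gamma F' -> F <> F' -> transverse F F') ->
  forall Cc, exists C', forall a c d, Gamma a -> Gamma c -> Gamma d ->
    good omega Cc a^-1%g d -> good omega C' a^-1%g c \/ good omega C' c^-1%g d.
Proof.
move=> tsym Gsub Gdiv Gtrans Cc; apply: contrapT => H.
have bad (m : nat) : exists t : G * G * G, [/\ [/\ Gamma t.1.1, Gamma t.1.2 & Gamma t.2],
   good omega Cc (t.1.1)^-1%g t.2, ~ good omega m%:R (t.1.1)^-1%g t.1.2
   & ~ good omega m%:R (t.1.2)^-1%g t.2].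
  apply: contrapT => nb; apply: H; exists m%:R => a c d Ga Gc Gd gad.
  apply: contrapT => no; apply: nb; exists (a, c, d); split => //.
    by move=> g1; apply: no; left.
  by move=> g1; apply: no; right.
have [t tP] := choice bad.
have archi (x : R) : \forall m \near \oo, x <= m%:R.
  exists (Num.bound `|x|) => // m /= bm; apply: le_trans (ler_norm _) _.
  by apply: ltW; apply: lt_le_trans (archi_boundP _) _; rewrite ?ler_nat.
(* A pair that contains u m has defect at most [gcst] of u m, so defects above m prevent u from
   returning to a given element. *)
have esc (u : nat -> G) : (forall m, m%:R < gcst omega (u m)) -> escaping u.
  move=> uP x; have := archi (gcst omega x); apply: filterS => m xm ux.
  by have := uP m; rewrite ux ltNge xm.
have ea : escaping (fun m => (t m).1.1).
  apply: esc => m; have [_ _ ng _] := tP m; rewrite ltNge; apply/negP => le.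
  apply: ng; apply: goodW (le) _; rewrite -(gcstV omega (t m).1.1).
  exact: (good_finl omega_sub).
have ec : escaping (fun m => (t m).1.2).
  apply: esc => m; have [_ _ ng _] := tP m; rewrite ltNge; apply/negP => le.
  by apply: ng; apply: goodW (le) _; exact: (good_finr omega_sub).
have ed : escaping (fun m => (t m).2).
  apply: esc => m; have [_ _ _ ng] := tP m; rewrite ltNge; apply/negP => le.
  by apply: ng; apply: goodW (le) _; exact: (good_finr omega_sub).
pose s (j : option bool) m : G :=
  match j with None => (t m).1.1 | Some true => (t m).1.2 | Some false => (t m).2 end.
have us j m : cm (svdk (s j m)) \is unitarymx by case: (svdP (s j m)).
have [f fi [L LP]] := unitary_compact us.
have [La uLa] := LP None; have [Lc uLc] := LP (Some true); have [Ld uLd] := LP (Some false).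
have Ga m : Gamma (t (f m)).1.1 by case: (tP (f m)) => -[].
have Gc m : Gamma (t (f m)).1.2 by case: (tP (f m)) => -[].
have Gd m : Gamma (t (f m)).2 by case: (tP (f m)) => -[].
have ea' : escaping (fun m => (t (f m)).1.1).
  by move=> x; exact: (near_subseq (P := fun m => (t m).1.1 <> x) fi (ea x)).
have ec' : escaping (fun m => (t (f m)).1.2).
  by move=> x; exact: (near_subseq (P := fun m => (t m).1.2 <> x) fi (ec x)).
have ed' : escaping (fun m => (t (f m)).2).
  by move=> x; exact: (near_subseq (P := fun m => (t m).2 <> x) fi (ed x)).
have unb (g h : G) m : ~ good omega (f m)%:R g h -> exists2 i, i \in theta &
   m%:R < logN i g + logN i h - logN i (g * h)%g.
  move=> ng; apply: contrapT => no; apply: ng => i.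
  rewrite leNgt; apply/negP => lt; apply: no; exists (val i); first exact: (valP i).
  by apply: le_lt_trans lt; rewrite ler_nat; exact: increasing_seq_ge.
have nac m := let: And4 _ _ x _ := tP (f m) in unb _ _ m x.
have ncd m := let: And4 _ _ _ x := tP (f m) in unb _ _ m x.
have [i it iac] := unbounded_iminor La Lc nac.
have icd := unbounded_iminor Lc Ld ncd.
have ku j : L j \in unitmx.
  by rewrite -cm_unit; have [_ uL] := LP j; exact: unitarymx_unit uL.
have [Fa kFa] := flag_exists theta (ku None).
have [Fc kFc] := flag_exists theta (ku (Some true)).
have [Fd kFd] := flag_exists theta (ku (Some false)).
have eac := limit_flag_eq Gdiv tsym Gtrans Ga Gc ea' ec' La Lc uLa uLc kFa kFc (ex_intro2 _ _ i it iac).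
have ecd := limit_flag_eq Gdiv tsym Gtrans Gc Gd ec' ed' Lc Ld uLc uLd kFc kFd icd.
have bnd : iminor (cm (L None)) (cm (L (Some false))) i != 0.
  apply: (bounded_iminor Gdiv tsym Ga Gd ea' ed' La Ld it (Cc := Cc)) => m.
  by have [_ gm _ _] := tP (f m); exact: (gm (exist _ i it)).
move: bnd; rewrite (iminor_cm _ _ uLa) (self_minor tsym (ku None) (ku (Some false)) kFa _ it).
  by rewrite rmorph0 eqxx.
by rewrite eac ecd.
Qed.

End HyperbolicTriples.

(** * Bounded combinations of the weights *)

Section LogarithmicAsymptotics.
Local Open Scope classical_set_scope.
Variable R : realType.
Local Notation C := R[i].

Lemma ccvg_real (x : nat -> R) (a : R) : x @ \oo --> a -> ccvg (fun m => (x m)%:C%C) a%:C%C.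
Proof. by move=> xa; split => //=; exact: cvg_cst. Qed.

Lemma Re_sum (I : Type) (r : seq I) (P : pred I) (F : I -> C) :
  complex.Re (\sum_(i <- r | P i) F i) = \sum_(i <- r | P i) complex.Re (F i).
Proof. exact: (raddf_sum (@complex.Re R)). Qed.

Lemma Re_realM (x : R) (z : C) : complex.Re (x%:C%C * z) = x * complex.Re z.
Proof. by rewrite Re_cmul /= mul0r subr0. Qed.

Lemma cvg_sum_cond (I : Type) (r : seq I) (P : pred I) (F : I -> nat -> R) (L : I -> R) :
  (forall i, P i -> F i @ \oo --> L i) ->
  (fun m => \sum_(i <- r | P i) F i m) @ \oo --> \sum_(i <- r | P i) L i.
Proof.
move=> H; elim: r => [|i r IH].
  by rewrite big_nil; under eq_fun do rewrite big_nil; exact: cvg_cst.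
rewrite big_cons; under eq_fun do rewrite big_cons.
by case: ifP => // Pi; apply: cvgD => //; exact: H.
Qed.

Lemma cvg_norm_le (u : nat -> R) (a B : R) : u @ \oo --> a ->
  (\forall m \near \oo, `|u m| <= B) -> `|a| <= B.
Proof.
move=> ua [N _ NP]; rewrite leNgt; apply/negP => lt.
have [N' _ N'P] := cvgr_gt _ (cvg_norm ua) _ lt.
by have := N'P (N + N')%N (leq_addl N N'); rewrite /= ltNge NP //= leq_addr.
Qed.

Lemma halving_eq0 (x B : R) : (forall p, `|x| <= B / 2 ^+ p) -> x = 0.
Proof.
move=> H; apply/eqP; rewrite -normr_eq0 eq_le normr_ge0 andbT leNgt; apply/negP => x0.
have B0 : 0 <= B by have := H 0%N; rewrite expr0 divr1; exact: le_trans.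
have := H (Num.bound (B / `|x|)); apply/negP; rewrite -ltNge.
rewrite ltr_pdivrMr ?exprn_gt0 // mulrC -ltr_pdivrMr //.
apply: lt_trans (archi_boundP _) _; first by rewrite divr_ge0.
by rewrite -natrX ltr_nat ltn_expl.
Qed.

Lemma ccvg_sum_cond (I : Type) (r : seq I) (P : pred I) (F : I -> nat -> C) (L : I -> C) :
  (forall i, P i -> ccvg (F i) (L i)) ->
  ccvg (fun m => \sum_(i <- r | P i) F i m) (\sum_(i <- r | P i) L i).
Proof.
move=> H; under eq_fun do rewrite big_mkcond; rewrite [X in ccvg _ X]big_mkcond.
by apply: ccvg_sum => i; case: ifP => Pi; [exact: H|exact: ccvg_cst].
Qed.

Lemma ccvgV (z : nat -> C) l : l != 0 -> ccvg z l -> ccvg (fun m => (z m)^-1) l^-1.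
Proof.
move=> l0 zl.
have VE (w : C) : w != 0 -> w^-1 = w^* * ((normc w)^-1 ^+ 2)%:C%C.
  move=> w0; apply: (mulfI w0); rewrite mulfV // mulrA mulJc -rmorphM -exprMn mulfV.
    by rewrite expr1n.
  by rewrite normc_eq0.
have nl0 : normc l != 0 by rewrite normc_eq0.
have nz := ccvg_normc zl.
have H : ccvg (fun m => (z m)^* * ((normc (z m))^-1 ^+ 2)%:C%C) l^-1.
  rewrite (VE l l0); apply: ccvgM; first exact: ccvg_conj.
  apply: ccvg_real; rewrite expr2; under eq_fun do rewrite expr2.
  exact: (cvgM (cvgV nl0 nz) (cvgV nl0 nz)).
have ez : \forall m \near \oo, (z m)^* * ((normc (z m))^-1 ^+ 2)%:C%C = (z m)^-1.
  have nl : 0 < normc l by rewrite normc_gt0.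
  have g0 := cvgr_gt _ nz 0 nl.
  have [N _ NP] := g0; exists N => // m /NP /=; rewrite normc_gt0 => zm.
  by rewrite [RHS]VE.
case: H => Hr Hi; split.
  by apply: cvg_trans Hr; apply: near_eq_cvg; have [N _ NP] := ez; exists N => // m /NP ->.
by apply: cvg_trans Hi; apply: near_eq_cvg; have [N _ NP] := ez; exists N => // m /NP ->.
Qed.

Lemma ccvg0_quotient (z : nat -> C) (e : nat -> R) xi : (forall m, 0 < e m) ->
  e @ \oo --> (0 : R) -> ccvg (fun m => z m * (e m)^-1%:C%C) xi -> ccvg z 0.
Proof.
move=> e0 ec /ccvgM/(_ (ccvg_real ec)); rewrite mulr0; congr ccvg; apply/funext => m.
by rewrite -mulrA -rmorphM mulVf ?mulr1 // lt0r_neq0.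
Qed.

(** Squeeze by y / (1 + y) <= ln (1 + y) <= y. *)
Lemma ln1p_quotient (y e : nat -> R) (L : R) : (forall m, 0 < e m) -> y @ \oo --> (0 : R) ->
  (fun m => y m / e m) @ \oo --> L -> (fun m => ln (1 + y m) / e m) @ \oo --> L.
Proof.
move=> e0 y0 ye.
have lo : (fun m => y m / e m * (1 + y m)^-1) @ \oo --> L.
  have := cvgM ye (cvgV (oner_neq0 _) (_ : (fun m => 1 + y m) @ \oo --> (1 : R))).
  rewrite invr1 mulr1; apply; rewrite -[X in _ --> X]addr0.
  by apply: cvgD => //; exact: cvg_cst.
apply: (squeeze_cvgr _ lo ye).
have g0 := cvgr_gt _ y0 (-1) (ltrN10 _); have [N _ NP] := g0; exists N => // m /NP /= ym.
have p : 0 < 1 + y m by rewrite -ltrBlDl sub0r.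
rewrite mulrAC !ler_pM2r ?invr_gt0 //; apply/andP; split; last exact: le_ln1Dx.
have -> : y m / (1 + y m) = - (- (y m / (1 + y m))) by rewrite opprK.
rewrite lerNl -lnV //.
have -> : ln (1 + y m)^-1 = ln (1 + - (y m / (1 + y m))).
  by congr ln; field; rewrite lt0r_neq0.
apply: le_ln1Dx; rewrite ltrN2 ltr_pdivrMr // mul1r ltrDr; exact: ltr01.
Qed.

(** |1 + x|^2 = 1 + 2 Re x + |x|^2, and the last term is negligible at the scale e. *)
Lemma ln_normc1p_quotient (x : nat -> C) (e : nat -> R) xi :
  (forall m, 0 < e m) -> e @ \oo --> (0 : R) ->
  ccvg (fun m => x m * (e m)^-1%:C%C) xi ->
  (fun m => ln (normc (1 + x m)) / e m) @ \oo --> complex.Re xi.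
Proof.
move=> e0 ec xe.
pose y m := 2 * complex.Re (x m) + normc (x m) ^+ 2.
have yE m : normc (1 + x m) ^+ 2 = 1 + y m.
  rewrite /y !normcE !sqr_sqrtr ?addr_ge0 ?sqr_ge0 //.
  by case: (x m) => a c /=; ring.
have nE m : normc (x m) / e m = normc (x m * (e m)^-1%:C%C).
  by rewrite normcM normcR ger0_norm // invr_ge0 ltW.
have yq : (fun m => y m / e m) @ \oo --> 2 * complex.Re xi.
  have h1 := xe.1; have h2 := ccvg_normc xe.
  have h4 : (fun m => 2 * complex.Re (x m * (e m)^-1%:C%C) +
      e m * (normc (x m * (e m)^-1%:C%C) * normc (x m * (e m)^-1%:C%C))) @ \oo -->
      2 * complex.Re xi + 0 * (normc xi * normc xi).
    by apply: cvgD; apply: cvgM => //; [exact: cvg_cst|apply: cvgM].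
  rewrite mul0r addr0 in h4; apply: cvg_trans h4; apply: near_eq_cvg; apply: nearW => m /=.
  rewrite -nE Re_cmul /= mulr0 subr0 /y.
  have := e0 m; move: (complex.Re _) (normc _) (e m) => u v w w0.
  by field; rewrite lt0r_neq0.
have y0 : y @ \oo --> (0 : R).
  have h : (fun m => y m / e m * e m) @ \oo --> 2 * complex.Re xi * 0 by exact: cvgM.
  rewrite mulr0 in h; apply: cvg_trans h.
  by apply: near_eq_cvg; apply: nearW => m /=; rewrite divfK // lt0r_neq0.
have h : (fun m => 2^-1 * (ln (1 + y m) / e m)) @ \oo --> 2^-1 * (2 * complex.Re xi).
  by apply: cvgM; [exact: cvg_cst|exact: ln1p_quotient].
rewrite mulKf // in h; apply: cvg_trans h; apply: near_eq_cvg.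
have g0 := cvgr_gt _ y0 (-1) (ltrN10 _); have [N _ NP] := g0; exists N => // m /NP /= ym.
have p : 0 < 1 + y m by rewrite -ltrBlDl sub0r.
have n0 : 0 < normc (1 + x m).
  rewrite lt_def normc_ge0 andbT; apply/eqP => z; move: p.
  by rewrite -yE z expr0n ltxx.
by rewrite -yE lnXn // mulr2n mulrDl; have := e0 m; move: (ln _) (e m) => u w w0; field; rewrite lt0r_neq0.
Qed.

End LogarithmicAsymptotics.

(** * Leading minors of products and test matrices *)

Section LeadingMinor.
Variables (R : realType) (d k : nat).
Local Notation C := R[i].
Local Notation T := {ffun 'I_k -> 'I_d}.
Implicit Types (X Y : 'M[C]_d) (a : 'rV[R]_d) (p f : T).

Definition off_image p f := injectiveb f && ~~ onto_image p f.
(** For injective p this is k!, the number of maps that give the leading term in Cauchy-Binet. *)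
Definition rearrangements p := #|[set f : T | injectiveb f && onto_image p f]|.

Lemma rearrangements_gt0 p : injective p -> (0 < rearrangements p)%N.
Proof.
move=> pi; apply/card_gt0P; exists p; rewrite inE; apply/andP; split; first exact/injectiveP.
by apply/forallP => i; exact: codom_f.
Qed.

(** Cauchy-Binet split by the image of f: all rearrangements of p contribute the same term, because
    their signs in X and in Y cancel. The other injective maps form the correction. *)
Lemma minor_mul_dg X a Y p : injective p -> (forall j, 0 < a 0 j) ->
  (k`!)%:R * minor (X *m dg a *m Y) p p = (pr a p)%:C%C *
    ((rearrangements p)%:R * (minor X p p * minor Y p p) +
     \sum_(f | off_image p f) (pr a f / pr a p)%:C%C * (minor X p f * minor Y f p)).
Proof.
have aux (e x y z : C) : e * e = 1 -> e * x * (z * (e * y)) = z * (x * y).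
  move=> ee; have -> : e * x * (z * (e * y)) = e * e * (z * (x * y)) by ring.
  by rewrite ee mul1r.
move=> pi a0; have pa : pr a p != 0 by rewrite lt0r_neq0 ?pr_gt0.
rewrite -mulmxA minorM (bigID (fun f : T => injectiveb f)) /=.
rewrite [X in _ + X]big1 ?addr0; last by move=> f nf; rewrite (minor_ninjr _ _ nf) mul0r.
have dE f : minor (dg a *m Y) f p = (pr a f)%:C%C * minor Y f p.
  rewrite minor_diagl /pr rmorph_prod; congr (_ * _).
  by apply: eq_bigr => i _; rewrite mxE.
rewrite (bigID (onto_image p)) /= mulrDr; congr (_ + _); last first.
  rewrite mulr_sumr; apply: eq_bigr => f _; rewrite dE [RHS]mulrA -rmorphM /=.
  have -> : pr a p * (pr a f / pr a p) = pr a f by rewrite mulrC divfK.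
  by rewrite mulrCA.
have -> : (pr a p)%:C%C * ((rearrangements p)%:R * (minor X p p * minor Y p p)) =
    \sum_(f in [set f : T | injectiveb f && onto_image p f])
      (pr a p)%:C%C * (minor X p p * minor Y p p).
  by rewrite sumr_const -[RHS]mulr_natl [LHS]mulrCA.
rewrite [RHS]big_mkcond [LHS]big_mkcond; apply: eq_bigr => f _.
rewrite inE; case: ifP => // /andP[/injectiveP fi fp]; rewrite dE.
have [s fE] := same_image fi pi fp.
have -> : pr a f = pr a p.
  rewrite /pr [RHS](reindex_inj (@perm_inj _ s)); apply: eq_bigr => i _.
  by rewrite fE ffunE.
rewrite {}fE minor_perml minor_permr.
have ss : (-1) ^+ s * (-1) ^+ s = 1 :> C by rewrite -signr_addb addbb.
exact: aux ss.
Qed.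

Lemma minor_mul_dg_ratio X a Y p : injective p -> (forall j, 0 < a 0 j) ->
  minor X p p != 0 -> minor Y p p != 0 ->
  minor (X *m dg a *m Y) p p =
    (pr a p * ((rearrangements p)%:R / (k`!)%:R))%:C%C * (minor X p p * minor Y p p) *
    (1 + ((rearrangements p)%:R^-1 : R)%:C%C * \sum_(f | off_image p f) (pr a f / pr a p)%:C%C *
      (minor X p f / minor X p p * (minor Y f p / minor Y p p))).
Proof.
move=> pi a0 x0 y0; have := minor_mul_dg X Y pi a0.
have k0 : ((k`!)%:R : C) != 0 by rewrite pnatr_eq0 -lt0n fact_gt0.
have N0 : ((rearrangements p)%:R : C) != 0 by rewrite pnatr_eq0 -lt0n rearrangements_gt0.
move=> E; apply: (mulfI k0); rewrite {}E.
rewrite !rmorphM /= !fmorphV /= !rmorph_nat.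
set S1 := \sum_(f | _) _; set S2 := \sum_(f | _) _.
have -> : S1 = minor X p p * minor Y p p * S2.
  rewrite mulr_sumr; apply: eq_bigr => f _.
  move: (minor X p p) (minor Y p p) x0 y0 (minor X p f) (minor Y f p) (_%:C%C).
  by move=> u v u0 v0 w z t; field; rewrite u0 v0.
move: (minor X p p) (minor Y p p) (_%:C%C) S2 ((rearrangements p)%:R : C) ((k`!)%:R : C) N0 k0.
by move=> u v t S N q N0 q0; field; rewrite N0 q0.
Qed.

End LeadingMinor.

Section ZariskiRatios.
Variables (R : realType) (b : base_field) (n : nat).
Local Notation K := (field_of R b).
Local Notation C := R[i].

(* Multiplying by the squared moduli of the denominators yields a polynomial. *)
Lemma zariski_ratio (Gamma : set (PSL K n)) (J : finType) (nu de : J -> 'M[K]_n.+1 -> C)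
    (w : J -> C) (kappa : R) :
  zariski_dense Gamma -> (forall j, cpolyfun (nu j)) -> (forall j, cpolyfun (de j)) ->
  (forall j A c, c ^+ n.+1 = 1 -> nu j (c *: A) / de j (c *: A) = nu j A / de j A) ->
  (forall j A c, c ^+ n.+1 = 1 -> normc (de j (c *: A)) = normc (de j A)) ->
  (forall g, Gamma g -> (forall j, de j (val (repr g)) != 0) ->
     \sum_j complex.Re (nu j (val (repr g)) / de j (val (repr g)) * w j) = kappa) ->
  forall A : SL K n, (forall j, de j (val A) != 0) ->
    \sum_j complex.Re (nu j (val A) / de j (val A) * w j) = kappa.
Proof.
move=> dense nuP deP quoZ deZ H A A0.
pose f B := \prod_j normc (de j B) ^+ 2 * (\sum_j complex.Re (nu j B / de j B * w j) - kappa).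
have f0 : f (val A) = 0.
  apply: (zariski_vanish dense).
  - rewrite /f; under eq_fun do rewrite mulrBr mulr_sumr.
    have h1 : polyfun (fun B => \sum_i \prod_j normc (de j B) ^+ 2 * complex.Re (nu i B / de i B * w i)).
      apply: polyfun_sum => i.
      have E B : \prod_j normc (de j B) ^+ 2 * complex.Re (nu i B / de i B * w i) =
         \prod_(j | j != i) normc (de j B) ^+ 2 * complex.Re (nu i B * (de i B)^* * w i).
        rewrite (bigD1 i) //= mulrAC mulrC; congr (_ * _).
        have [->|d0] := eqVneq (de i B) 0.
          by rewrite ComplexField.Normc.normc0 expr0n mul0r conjC0 mulr0 mul0r.
        have -> : nu i B * (de i B)^* * w i = ((normc (de i B)) ^+ 2)%:C%C * (nu i B / de i B * w i).
          by rewrite -mulJc; field.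
        by rewrite [RHS]Re_cmul /= mul0r subr0.
      under eq_fun do rewrite E.
      apply: polyfunM; first by apply: polyfun_prod => j; exact: polyfun_normc2.
      have [] // : cpolyfun (fun B => nu i B * (de i B)^* * w i).
      by apply: cpolyfunM; [apply: cpolyfunM => //; exact: cpolyfun_conj|exact: cpolyfun_cst].
    have h2 : polyfun (fun B => \prod_j normc (de j B) ^+ 2 * kappa * (-1)).
      by do 2 (apply: polyfunM; last exact: polyfun_cst); apply: polyfun_prod => j; exact: polyfun_normc2.
    have := polyfunD h1 h2; congr polyfun; apply/funext => B.
    by rewrite mulrN1.
  - move=> c B c1; rewrite /f; congr (_ * (_ - _)).
      by apply: eq_bigr => j _; rewrite deZ.
    by apply: eq_bigr => j _; rewrite quoZ.
  - move=> g Gg; rewrite /f.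
    have [/forallP ne|/forallPn[j]] := boolP [forall j, de j (val (repr g)) != 0].
      by rewrite H // subrr mulr0.
    by rewrite negbK => /eqP z; rewrite (bigD1 j) //= z ComplexField.Normc.normc0 expr0n !mul0r.
move/eqP: f0; rewrite mulf_eq0 => /orP[|]; last by rewrite subr_eq0 => /eqP.
rewrite prodf_seq_eq0 => /hasP[j _ /=]; rewrite expf_eq0 /= normc_eq0.
by rewrite (negbTE (A0 j)).
Qed.

End ZariskiRatios.

Section Transvections.
Variables (F : fieldType) (n : nat).
Local Notation iota_ i := (@iota_ n i).
Implicit Types i j : 'I_n.

Definition transv j : 'M[F]_n.+1 :=
  1%:M + delta_mx (widen_ord (leqnSn n) j) (lift ord0 j).

Lemma transvE j x y : transv j x y = (x == y)%:R + ((x == j :> nat) && (y == j.+1 :> nat))%:R.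
Proof. by rewrite !mxE -!val_eqE /= /bump /= add1n. Qed.

Lemma det_transv j : \det (transv j) = 1.
Proof.
rewrite -det_tr det_trig.
  rewrite big1 // => x _; rewrite mxE transvE eqxx.
  by case: (altP (val x =P val j)) => [->|]; rewrite ?andbF ?addr0 //= ltn_eqF ?addr0.
apply/is_trig_mxP => x y xy; rewrite mxE transvE -val_eqE /= gtn_eqF // add0r.
case: andP => // -[/eqP yj /eqP xj]; move: xy; rewrite yj xj; lia.
Qed.

Lemma minor_transv_iota i j : minor (transv j) (iota_ i.+1) (iota_ i.+1) = 1.
Proof.
rewrite /minor -det_tr det_trig.
  rewrite big1 // => x _; rewrite 2!mxE transvE eqxx iota_val.
  by case: eqP => [->|]; rewrite ?addr0 //= ltn_eqF ?addr0.
apply/is_trig_mxP => x y xy; rewrite 2!mxE transvE -val_eqE /= !iota_val gtn_eqF // add0r.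
case: andP => // -[/eqP yj /eqP xj]; move: xy; rewrite yj xj; lia.
Qed.

Lemma minor1_off_image i f : off_image (iota_ i.+1) f -> minor (1%:M : 'M[F]_n.+1) (iota_ i.+1) f = 0.
Proof.
move=> /andP[_ /forallPn[x]]; rewrite codom_iota -ltnNge => fx.
rewrite /minor (expand_det_col _ x) big1 // => y _; rewrite !mxE -val_eqE /= iota_val.
by rewrite ltn_eqF ?mul0r // (leq_trans _ fx).
Qed.

(** f selects some column beyond i. In the first i + 1 rows of [transv j], such a column is zero
    unless it meets the entry (j, j + 1) with j = i. *)
Lemma minor_transv_off_image i j f : off_image (iota_ i.+1) f -> i != j ->
  minor (transv j) (iota_ i.+1) f = 0.
Proof.
move=> /andP[_ /forallPn[x]]; rewrite codom_iota -ltnNge => fx ij.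
rewrite /minor (expand_det_col _ x) big1 // => y _; rewrite mxE transvE -val_eqE /= iota_val.
have yi := ltn_ord y; rewrite ltn_eqF ?add0r; last by rewrite (leq_trans _ fx).
case: andP => [[/eqP yj /eqP xj]|]; last by rewrite mul0r.
by move: ij; rewrite -val_eqE /=; move: yi fx; rewrite yj xj; lia.
Qed.

(** The off-image map of largest weight for a sorted spectrum: relative to the leading one its
    weight is exactly one singular value gap, by [pr_shift_last]. *)
Definition shift_last i : {ffun 'I_i.+1 -> 'I_n.+1} :=
  [ffun x => if x == ord_max then lift ord0 i else iota_ i.+1 x].

Lemma shift_last_val i x : shift_last i x = (if x == ord_max then i.+1 else x) :> nat.
Proof. by rewrite ffunE; case: eqP => _; rewrite ?iota_val //= /bump add1n. Qed.

Lemma shift_last_off i : off_image (iota_ i.+1) (shift_last i).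
Proof.
apply/andP; split; last first.
  apply/forallPn; exists ord_max; rewrite codom_iota shift_last_val eqxx; lia.
apply/injectiveP => x y /(congr1 val) /=; rewrite !shift_last_val => e; apply/val_inj.
move: e (ltn_ord x) (ltn_ord y); rewrite -!val_eqE /=.
case: eqP => [->|_]; case: eqP => [->|_]; lia.
Qed.

Lemma minor_transv_shift i : minor (transv i) (iota_ i.+1) (shift_last i) = 1.
Proof.
rewrite /minor -[RHS](det1 F i.+1); congr (\det _); apply/matrixP => x y.
rewrite mxE transvE [RHS]mxE -!val_eqE /= iota_val shift_last_val -!val_eqE /=.
have := ltn_ord x; have := ltn_ord y; case: (altP (val y =P i)) => [->|yi] ylt xlt.
  by rewrite eqxx andbT ltn_eqF ?add0r.
by rewrite (_ : (nat_of_ord y == i.+1) = false) ?andbF ?addr0 //; lia.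
Qed.

End Transvections.

Lemma map_transv (F F' : fieldType) (u : {rmorphism F -> F'}) n (j : 'I_n) :
  map_mx u (transv F j) = transv F' j.
Proof. by rewrite /transv map_mxD map_mx1 map_delta_mx. Qed.

Lemma pr_shift_last (R : realType) n (a : 'rV[R]_n.+1) (i : 'I_n) : (forall j, 0 < a 0 j) ->
  pr a (shift_last i) / pr a (iota_ n i.+1) = a 0 (lift ord0 i) / a 0 (widen_ord (leqnSn n) i).
Proof.
move=> a0; rewrite /pr (bigD1 (ord_max : 'I_i.+1)) //=
  [X in _ / X](bigD1 (ord_max : 'I_i.+1)) //= !ffunE eqxx.
have -> : inord (ord_max : 'I_i.+1) = widen_ord (leqnSn n) i :> 'I_n.+1.
  by apply/val_inj; rewrite /= inordK // ltnS ltnW.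
set p := \prod_(j | _) _; set q := \prod_(j | _) _.
have -> : p = q by apply: eq_bigr => x xm; rewrite !ffunE (negbTE xm).
have q0 : q != 0 by rewrite lt0r_neq0 // prodr_gt0.
by rewrite -mulf_div mulfV // mulr1.
Qed.

(** * First-order terms and the vanishing of a coefficient *)

Section CrossTerms.
Variables (R : realType) (b : base_field) (n : nat) (theta : {set 'I_n}).
Local Notation K := (field_of R b).
Local Notation C := R[i].
Local Notation G := (PSL K n).
Local Notation iota_ i := (@iota_ n i).
Local Open Scope classical_set_scope.
Opaque PSL_mul PSL_inv.

Variables (Gamma : set G) (h : nat -> G) (k l : 'M[K]_n.+1) (c : 'I_n -> R) (e : nat -> R) (kp : R).
Variable t : forall i : 'I_n, {ffun 'I_i.+1 -> 'I_n.+1} -> R.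
Hypothesis Gsub : is_subgroup Gamma.
Hypothesis Gh : forall m, Gamma (h m).
Hypothesis hk : mcvg (fun m => cm (svdk (h m))) (cm k).
Hypothesis hl : mcvg (fun m => cm (svdl (h m))) (cm l).
Hypothesis e_gt0 : forall m, 0 < e m.
Hypothesis e_cvg : e @ \oo --> (0 : R).
Hypothesis t_cvg : forall (i : 'I_n) (f : {ffun 'I_i.+1 -> 'I_n.+1}), i \in theta ->
  off_image (iota_ i.+1) f ->
  (fun m => pr (ecartan (h m)) f / pr (ecartan (h m)) (iota_ i.+1) / e m) @ \oo --> t f.

Local Notation rearr i := (rearrangements (iota_ (nat_of_ord i).+1)).

(** The share of h m alone in the combination of the log |Delta_i(l g1 h_m g2 k)|. *)
Definition kap m := \sum_(i in theta)
  c i * (fund_weight i (cartan (h m)) + ln ((rearr i)%:R / (i.+1`!)%:R)).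
Hypothesis kap_cvg : kap @ \oo --> kp.

Section Minors.
Variable i : 'I_n.
Implicit Types A : 'M[C]_n.+1.

Definition qlim A := minor (cm l *m A *m cm k) (iota_ i.+1) (iota_ i.+1).
Definition rowq f A := minor (cm l *m A *m cm k) (iota_ i.+1) f / qlim A.
Definition colq f A := minor (cm l *m A *m cm k) f (iota_ i.+1) / qlim A.

Definition lq m A := minor (cm l *m A *m cm (svdk (h m))) (iota_ i.+1) (iota_ i.+1).
Definition rq m A := minor (cm (svdl (h m)) *m A *m cm k) (iota_ i.+1) (iota_ i.+1).
(** The correction in [minor_mul_dg_ratio] for the product l A1 h_m A2 k; it is exact, and only its
    limit at the scale e, [corr_lim], separates into row and column quotients at l A k. *)
Definition corr m A1 A2 := ((rearr i)%:R^-1 : R)%:C%C * \sum_(f | off_image (iota_ i.+1) f)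
  (pr (ecartan (h m)) f / pr (ecartan (h m)) (iota_ i.+1))%:C%C *
   (minor (cm l *m A1 *m cm (svdk (h m))) (iota_ i.+1) f / lq m A1 *
    (minor (cm (svdl (h m)) *m A2 *m cm k) f (iota_ i.+1) / rq m A2)).
Definition corr_lim A1 A2 := ((rearr i)%:R^-1 : R)%:C%C * \sum_(f | off_image (iota_ i.+1) f)
  (t f)%:C%C * (rowq f A1 * colq f A2).

Lemma normc_qlimZ z A : normc z = 1 -> normc (qlim (z *: A)) = normc (qlim A).
Proof.
by move=> z1; rewrite /qlim -scalemxAr -scalemxAl minor_scale normcM normcX z1 expr1n mul1r.
Qed.

Lemma minor_lcvg (f g : {ffun 'I_i.+1 -> 'I_n.+1}) A :
  ccvg (fun m => minor (cm l *m A *m cm (svdk (h m))) f g)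
  (minor (cm l *m A *m cm k) f g : C).
Proof. by apply/ccvg_minor/mcvgM => //; exact: mcvg_cst. Qed.

Lemma minor_rcvg (f g : {ffun 'I_i.+1 -> 'I_n.+1}) A :
  ccvg (fun m => minor (cm (svdl (h m)) *m A *m cm k) f g)
  (minor (cm l *m A *m cm k) f g : C).
Proof. by apply/ccvg_minor/mcvgM; [apply: mcvgM => //|]; exact: mcvg_cst. Qed.

Lemma rowq_cvg f A : qlim A != 0 -> ccvg (fun m =>
  minor (cm l *m A *m cm (svdk (h m))) (iota_ i.+1) f / lq m A) (rowq f A).
Proof.
move=> q0; have q1 := ccvgV q0 (minor_lcvg (iota_ i.+1) (iota_ i.+1) A).
exact: (ccvgM (minor_lcvg (iota_ i.+1) f A) q1).
Qed.

Lemma colq_cvg f A : qlim A != 0 -> ccvg (fun m =>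
  minor (cm (svdl (h m)) *m A *m cm k) f (iota_ i.+1) / rq m A) (colq f A).
Proof.
move=> q0; have q1 := ccvgV q0 (minor_rcvg (iota_ i.+1) (iota_ i.+1) A).
exact: (ccvgM (minor_rcvg f (iota_ i.+1) A) q1).
Qed.

Lemma corr_cvg A1 A2 : i \in theta -> qlim A1 != 0 -> qlim A2 != 0 ->
  ccvg (fun m => corr m A1 A2 * (e m)^-1%:C%C) (corr_lim A1 A2).
Proof.
move=> it q1 q2.
have E m : corr m A1 A2 * (e m)^-1%:C%C =
  ((rearr i)%:R^-1 : R)%:C%C * \sum_(f | off_image (iota_ i.+1) f)
  (pr (ecartan (h m)) f / pr (ecartan (h m)) (iota_ i.+1) / e m)%:C%C *
   (minor (cm l *m A1 *m cm (svdk (h m))) (iota_ i.+1) f / lq m A1 *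
    (minor (cm (svdl (h m)) *m A2 *m cm k) f (iota_ i.+1) / rq m A2)).
  rewrite -mulrA; congr (_ * _); rewrite mulr_suml; apply: eq_bigr => f _.
  by rewrite mulrAC [X in X * _ = _]mulrC -rmorphM /= [X in X%:C%C]mulrC.
under eq_fun do rewrite E.
apply: ccvgM; first exact: ccvg_cst.
apply: ccvg_sum_cond => f fo; apply: ccvgM; first exact: (ccvg_real (t_cvg it fo)).
exact: (ccvgM (rowq_cvg f q1) (colq_cvg f q2)).
Qed.

Lemma corr_cvg0 A1 A2 : i \in theta -> qlim A1 != 0 -> qlim A2 != 0 ->
  ccvg (fun m => corr m A1 A2) 0.
Proof.
move=> it q1 q2; exact: (ccvg0_quotient e_gt0 e_cvg (corr_cvg it q1 q2)).
Qed.

Lemma qlim_through m A1 A2 : lq m A1 != 0 -> rq m A2 != 0 -> 1 + corr m A1 A2 != 0 ->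
  qlim (A1 *m liftC (h m) *m A2) != 0 /\
  ln (normc (qlim (A1 *m liftC (h m) *m A2))) =
    fund_weight i (cartan (h m)) + ln ((rearr i)%:R / (i.+1`!)%:R)
    + ln (normc (lq m A1)) + ln (normc (rq m A2)) + ln (normc (1 + corr m A1 A2)).
Proof.
move=> l0 r0 c0; have [_ _ hE _] := svdP (h m).
have N0 : 0 < (rearr i)%:R / (i.+1`!)%:R :> R.
  by rewrite divr_gt0 ?ltr0n ?fact_gt0 // rearrangements_gt0 //; exact: iota_inj.
have -> : qlim (A1 *m liftC (h m) *m A2) =
   (expR (fund_weight i (cartan (h m))) * ((rearr i)%:R / (i.+1`!)%:R))%:C%C *
   (lq m A1 * rq m A2) * (1 + corr m A1 A2).
  rewrite -pr_ecartan; have E := minor_mul_dg_ratio (@iota_inj n i) (ecartan_gt0 (h m)) l0 r0.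
  by apply: etrans E; rewrite /qlim hE !mulmxA.
move: (corr m A1 A2) c0 (lq m A1) l0 (rq m A2) r0 (_ / _) N0 (fund_weight _ _).
move=> x x0 y y0 z z0 v v0 w.
have p0 : 0 < expR w * v by rewrite mulr_gt0 ?expR_gt0.
have pC : (expR w * v)%:C%C != 0 :> C by rewrite -normc_gt0 normcR normr_gt0 lt0r_neq0.
split; first by rewrite !mulf_neq0.
rewrite !normcM normcR (ger0_norm (ltW p0)).
have [xp yp zp] : [/\ 0 < normc (1 + x), 0 < normc y & 0 < normc z] by split; rewrite normc_gt0.
have yz := mulr_gt0 yp zp.
by rewrite (lnM (mulr_gt0 p0 yz) xp) (lnM p0 yz) (lnM yp zp) (lnM (expR_gt0 w) v0) expRK !addrA.
Qed.

End Minors.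
Implicit Types g : G.

Definition genericm A := forall i, i \in theta -> qlim i A != 0.
Definition generic g := genericm (liftC g).
Definition logq g := \sum_(i in theta) c i * ln (normc (qlim i (liftC g))).
Definition Psi g := kp + logq g.
Definition logl m g := \sum_(i in theta) c i * ln (normc (lq i m (liftC g))).
Definition logr m g := \sum_(i in theta) c i * ln (normc (rq i m (liftC g))).
Definition logc m g1 g2 :=
  \sum_(i in theta) c i * ln (normc (1 + corr i m (liftC g1) (liftC g2))).

Lemma liftC3 g1 g g2 : exists2 z, normc z = 1 &
  liftC (g1 * (g * g2))%g = z *: (liftC g1 *m liftC g *m liftC g2).
Proof.
have [z z1 ->] := liftM g1 (g * g2)%g; have [w w1 ->] := liftM g g2.
exists (z * w); first by rewrite normcM z1 w1 mulr1.
by rewrite -scalemxAr scalerA mulmxA.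
Qed.

Lemma near_theta (P : 'I_n -> nat -> Prop) :
  (forall i, i \in theta -> \forall m \near \oo, P i m) ->
  \forall m \near \oo, forall i, i \in theta -> P i m.
Proof.
move=> H; apply: filter_forall => i.
by have [it|nit] := boolP (i \in theta); [apply: filterS (H i it)|exact: nearW].
Qed.

Lemma ccvg_neq0 (z : nat -> C) a : ccvg z a -> a != 0 -> \forall m \near \oo, z m != 0.
Proof.
move=> za; rewrite -normc_gt0 => a0.
have [N _ NP] := cvgr_gt _ (ccvg_normc za) 0 a0.
by exists N => // m /NP /=; rewrite normc_gt0.
Qed.

(** The splitting is exact for large m; g1 and g2 interact only through [logc]. *)
Lemma Psi_product g1 g2 : generic g1 -> generic g2 -> \forall m \near \oo,
  generic (g1 * (h m * g2))%g /\
  Psi (g1 * (h m * g2))%g = kp + (kap m + logl m g1 + logr m g2 + logc m g1 g2).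
Proof.
move=> q1 q2.
have : \forall m \near \oo, forall i, i \in theta -> [/\ lq i m (liftC g1) != 0,
    rq i m (liftC g2) != 0 & 1 + corr i m (liftC g1) (liftC g2) != 0].
  apply: near_theta => i it.
  have [N1 _ P1] := ccvg_neq0 (minor_lcvg (iota_ i.+1) (iota_ i.+1) (liftC g1)) (q1 i it).
  have [N2 _ P2] := ccvg_neq0 (minor_rcvg (iota_ i.+1) (iota_ i.+1) (liftC g2)) (q2 i it).
  have c1 := ccvgD (ccvg_cst 1) (corr_cvg0 it (q1 i it) (q2 i it)).
  have [|N3 _ P3] := ccvg_neq0 c1; first by rewrite addr0 oner_neq0.
  exists (N1 + N2 + N3)%N => // m /= Nm.
  split; [exact: (P1 m (leq_trans (leq_trans (leq_addr N2 N1) (leq_addr N3 _)) Nm))|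
          exact: (P2 m (leq_trans (leq_trans (leq_addl N1 N2) (leq_addr N3 _)) Nm))|
          exact: (P3 m (leq_trans (leq_addl _ N3) Nm))].
move=> [N _ NP]; exists N; first by []. move=> m Nm; have {}NP := NP m Nm.
have [z z1 zE] := liftC3 g1 (h m) g2.
have T i : i \in theta -> qlim i (liftC (g1 * (h m * g2))%g) != 0 /\
   ln (normc (qlim i (liftC (g1 * (h m * g2))%g))) =
     fund_weight i (cartan (h m)) + ln ((rearr i)%:R / (i.+1`!)%:R)
     + ln (normc (lq i m (liftC g1))) + ln (normc (rq i m (liftC g2)))
     + ln (normc (1 + corr i m (liftC g1) (liftC g2))).
  move=> it; have [l0 r0 c0] := NP i it; have [T1 T2] := qlim_through l0 r0 c0.
  have := normc_qlimZ i (liftC g1 *m liftC (h m) *m liftC g2) z1; rewrite -zE => nE.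
  split; last exact: (etrans (congr1 (@ln R) nE) T2).
  by rewrite -normc_eq0 nE normc_eq0; exact: T1.
split=> [i it|]; first by have [] := T i it.
rewrite /Psi /logq /kap /logl /logr /logc -!big_split /=; congr (_ + _).
apply: eq_bigr => i it; apply: etrans (congr1 (fun x => c i * x) (T i it).2) _.
by rewrite !mulrDr.
Qed.

Lemma log_cvg (z : nat -> C) a : ccvg z a -> a != 0 ->
  (fun m => ln (normc (z m))) @ \oo --> ln (normc a).
Proof.
move=> za a0; apply: continuous_cvg; last exact: ccvg_normc.
by apply: continuous_ln; rewrite normc_gt0.
Qed.

Lemma logl_cvg g : generic g ->
  logl ^~ g @ \oo --> logq g.
Proof.
move=> q0; apply: cvg_sum_cond => i it; apply: cvgM; first exact: cvg_cst.
exact: (log_cvg (minor_lcvg (iota_ i.+1) (iota_ i.+1) (liftC g)) (q0 i it)).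
Qed.

Lemma logr_cvg g : generic g ->
  logr ^~ g @ \oo --> logq g.
Proof.
move=> q0; apply: cvg_sum_cond => i it; apply: cvgM; first exact: cvg_cst.
exact: (log_cvg (minor_rcvg (iota_ i.+1) (iota_ i.+1) (liftC g)) (q0 i it)).
Qed.

Lemma logc_cvg0 g1 g2 : generic g1 -> generic g2 -> (logc m g1 g2 @[m --> \oo]) --> (0 : R).
Proof.
move=> q1 q2; have -> : 0 = \sum_(i in theta) (0 : R) by rewrite big1.
apply: cvg_sum_cond => i it; rewrite -[X in _ --> X](mulr0 (c i)); apply: cvgM; first exact: cvg_cst.
have c1 := ccvgD (ccvg_cst 1) (corr_cvg0 it (q1 i it) (q2 i it)).
have := log_cvg c1; rewrite addr0 normc1 ln1; apply; exact: oner_neq0.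
Qed.

Lemma Psi_cvg g1 g2 : generic g1 -> generic g2 ->
  Psi (g1 * (h m * g2))%g @[m --> \oo] --> Psi g1 + Psi g2.
Proof.
move=> q1 q2.
have sumE (x u v : R) : x + u + (x + v) = x + (x + u + v + 0) by ring.
have H : (fun m => kp + (kap m + logl m g1 + logr m g2 + logc m g1 g2)) @ \oo -->
    kp + (kp + logq g1 + logq g2 + 0).
  apply: cvgD; first exact: cvg_cst.
  apply: cvgD; last exact: logc_cvg0.
  by apply: cvgD; [apply: cvgD; [exact: kap_cvg|exact: logl_cvg]|exact: logr_cvg].
have PE : Psi g1 + Psi g2 = kp + (kp + logq g1 + logq g2 + 0) := sumE kp (logq g1) (logq g2).
rewrite -PE in H.
apply: cvg_trans H; apply: near_eq_cvg.
have [N _ NP] := Psi_product q1 q2.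
by exists N => // m /NP[_ ->].
Qed.

(** Psi (g h_m g) tends to 2 Psi g with all terms in Gamma, so any bound on Psi can be halved. *)
Lemma Psi_eq0 B : (forall g, Gamma g -> generic g -> `|Psi g| <= B) ->
  forall g, Gamma g -> generic g -> Psi g = 0.
Proof.
move=> PB g Gg qg; have [_ GM _] := Gsub.
have half p : forall g, Gamma g -> generic g -> `|Psi g| <= B / 2 ^+ p.
  elim: p => [|p IH] {}g {}Gg {}qg; first by rewrite expr0 divr1 PB.
  have dbl (x y : R) : `|x + x| <= y -> `|x| <= y / 2.
    by rewrite -[x + x]mulr2n -[x *+ 2]mulr_natl normrM normr_nat ler_pdivlMr // mulrC.
  rewrite exprSr invfM mulrA; apply/dbl/(cvg_norm_le (Psi_cvg qg qg)).
  have [N _ NP] := Psi_product qg qg; exists N; first by [].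
  move=> m Nm; have [gen _] := NP m Nm.
  have Gg1 := GM (h m) g (Gh m) Gg.
  have Gg2 := GM g _ Gg Gg1.
  exact: (IH _ Gg2 gen).
by apply: (@halving_eq0 _ _ B) => p; exact: half.
Qed.

Local Notation J := {i : 'I_n & {ffun 'I_i.+1 -> 'I_n.+1}}.
Implicit Types j : J.

(** Set to 0 outside theta and for the maps that are not off-image, so that the double sums become
    sums over all of J. *)
Definition wt j : R := if (tag j \in theta) && off_image (iota_ (tag j).+1) (tagged j)
  then (rearr (tag j))%:R^-1 * t (tagged j) else 0.
(** The coefficient of first order of [logc] at the scale e. *)
Definition cross g1 g2 := \sum_(i in theta) c i * complex.Re (corr_lim i (liftC g1) (liftC g2)).

Lemma cross_cvg g1 g2 : generic g1 -> generic g2 ->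
  (fun m => logc m g1 g2 / e m) @ \oo --> cross g1 g2.
Proof.
move=> q1 q2; rewrite /logc; under eq_fun do rewrite mulr_suml.
apply: cvg_sum_cond => i it; under eq_fun do rewrite -mulrA.
apply: cvgM; first exact: cvg_cst.
exact: (ln_normc1p_quotient e_gt0 e_cvg (corr_cvg it (q1 i it) (q2 i it))).
Qed.

Lemma cross_sigma g1 g2 : cross g1 g2 = \sum_j c (tag j) * wt j *
  complex.Re (rowq (tagged j) (liftC g1) * colq (tagged j) (liftC g2)).
Proof.
pose X (i : 'I_n) (f : {ffun 'I_i.+1 -> 'I_n.+1}) := rowq f (liftC g1) * colq f (liftC g2).
have E i : c i * complex.Re (corr_lim i (liftC g1) (liftC g2)) =
   \sum_(f | off_image (iota_ i.+1) f) c i * ((rearr i)%:R^-1 * t f) * complex.Re (X i f).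
  rewrite /corr_lim Re_realM Re_sum mulrA mulr_sumr.
  by apply: eq_bigr => f _; rewrite Re_realM [LHS]mulrA -[c i / _ * _]mulrA.
rewrite /cross; under eq_bigr do rewrite E.
rewrite sig_big_dep /= big_mkcond; apply: eq_bigr => j _; rewrite /wt /X.
by case: ifP => // _; rewrite mulr0 mul0r.
Qed.

Hypothesis Psi0 : forall g, Gamma g -> generic g -> Psi g = 0.

(** Psi vanishes at g1 h_m g2, which writes [logc] as a function of g1 plus one of g2. Its mixed
    difference is thus 0 for large m, and stays so after division by e m. *)
Lemma cross_diff g1 g1' g2 g2' : Gamma g1 -> Gamma g1' -> Gamma g2 -> Gamma g2' ->
  generic g1 -> generic g1' -> generic g2 -> generic g2' ->
  cross g1 g2 - cross g1' g2 - (cross g1 g2' - cross g1' g2') = 0.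
Proof.
move=> G1 G1' G2 G2' q1 q1' q2 q2'; have [_ GM _] := Gsub.
have cv : (fun m => logc m g1 g2 / e m - logc m g1' g2 / e m -
    (logc m g1 g2' / e m - logc m g1' g2' / e m)) @ \oo -->
    cross g1 g2 - cross g1' g2 - (cross g1 g2' - cross g1' g2').
  by apply: cvgB; apply: cvgB; exact: cross_cvg.
have aux (x y : R) : kp + (x + y) = 0 -> y = - (kp + x) by move=> xy; lra.
have E g g' : Gamma g -> Gamma g' -> generic g -> generic g' ->
    \forall m \near \oo, logc m g g' = - (kp + (kap m + logl m g + logr m g')).
  move=> Gg Gg' qg qg'; have [N _ NP] := Psi_product qg qg'.
  exists N; first by []. move=> m Nm; have [gen] := NP m Nm.
  have Gp := GM g _ Gg (GM _ g' (Gh m) Gg').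
  by move=> PE; exact: (aux _ _ (etrans (esym PE) (Psi0 Gp gen))).
have [N1 _ P1] := E _ _ G1 G2 q1 q2; have [N2 _ P2] := E _ _ G1' G2 q1' q2.
have [N3 _ P3] := E _ _ G1 G2' q1 q2'; have [N4 _ P4] := E _ _ G1' G2' q1' q2'.
have : (fun=> 0 : R) @ \oo --> cross g1 g2 - cross g1' g2 - (cross g1 g2' - cross g1' g2').
  apply: cvg_trans cv; apply: near_eq_cvg; exists (N1 + N2 + (N3 + N4))%N; first by [].
  move=> m /= Nm.
  rewrite (P1 m _) /=; last by move: Nm; clear; lia.
  rewrite (P2 m _) /=; last by move: Nm; clear; lia.
  rewrite (P3 m _) /=; last by move: Nm; clear; lia.
  rewrite (P4 m _) /=; last by move: Nm; clear; lia.
  by move: (kap m) (logl m g1) (logl m g1') (logr m g2) (logr m g2') (e m)^-1 kp => *; ring.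
by move=> /(cvg_unique _ (cvg_cst _)) <-.
Qed.

Hypothesis dense : zariski_dense Gamma.
Hypothesis uk : cm k \is unitarymx.
Hypothesis ul : cm l \is unitarymx.

Lemma cpolyfun_if (d : bool) (P Q : 'M[K]_n.+1 -> C) : cpolyfun P -> cpolyfun Q ->
  cpolyfun (fun A => if d then P A else Q A).
Proof. by case: d. Qed.

Lemma zariski_rowcol (u v : forall j, {ffun 'I_(tag j).+1 -> 'I_n.+1}) (w : J -> C) kappa :
  (forall j, tag j \notin theta -> w j = 0) ->
  (forall g, Gamma g -> generic g -> \sum_(j : J) complex.Re
     (minor (cm l *m liftC g *m cm k) (u j) (v j) / qlim (tag j) (liftC g) * w j) = kappa) ->
  forall A : SL K n, genericm (cm (val A)) -> \sum_(j : J) complex.Re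
     (minor (cm l *m cm (val A) *m cm k) (u j) (v j) / qlim (tag j) (cm (val A)) * w j) = kappa.
Proof.
move=> w0 H.
(* Outside theta the minor [qlim] may vanish; the quotient is replaced there by 0 / 1, which is
   harmless because w j = 0. *)
pose nu j (A : 'M[K]_n.+1) := if tag j \in theta then minor (cm l *m cm A *m cm k) (u j) (v j) else 0.
pose de j (A : 'M[K]_n.+1) := if tag j \in theta then qlim (tag j) (cm A) else 1.
have E A : \sum_(j : J) complex.Re (minor (cm l *m cm A *m cm k) (u j) (v j) / qlim (tag j) (cm A) * w j)
   = \sum_(j : J) complex.Re (nu j A / de j A * w j).
  apply: eq_bigr => j _; congr (complex.Re _); rewrite /nu /de.
  by case: ifP => // /negbT /w0 ->; rewrite !mulr0.
have gE A : (forall j, de j A != 0) -> genericm (cm A).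
  move=> dA i it; have := dA (Tagged _ (iota_ i.+1)).
  by rewrite /de /= it.
have deE A : genericm (cm A) -> forall j, de j A != 0.
  by move=> gA j; rewrite /de; case: ifP => [/gA //|_]; exact: oner_neq0.
move=> A gA; rewrite E.
apply: (zariski_ratio (nu := nu) (de := de) (Gamma := Gamma)).
- exact: dense.
- by move=> j; apply: cpolyfun_if; [exact: cpolyfun_minor|exact: cpolyfun_cst].
- by move=> j; apply: cpolyfun_if; [exact: cpolyfun_minor|exact: cpolyfun_cst].
- move=> j B z z1; rewrite /nu /de; have [z' z'1 zE] := cm_center z1 (erefl (z *: B)).
  have mZ (f f' : {ffun 'I_(tag j).+1 -> 'I_n.+1}) : minor (cm l *m cm (z *: B) *m cm k) f f' =
      z' ^+ (tag j).+1 * minor (cm l *m cm B *m cm k) f f'.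
    by rewrite zE -scalemxAr -scalemxAl minor_scale.
  have z'0 : z' ^+ (tag j).+1 != 0 by rewrite expf_neq0 // -normc_eq0 z'1 oner_neq0.
  case: (_ \in _); last by [].
  have -> : qlim (tag j) (cm (z *: B)) = z' ^+ (tag j).+1 * qlim (tag j) (cm B) by exact: mZ.
  by rewrite (mZ (u j) (v j)) -mulf_div divff // mul1r.
- move=> j B z z1; rewrite /de; have [z' z'1 zE] := cm_center z1 (erefl (z *: B)).
  case: (_ \in _); last by [].
  exact: (etrans (congr1 (fun X => normc (qlim (tag j) X)) zE) (normc_qlimZ (tag j) (cm B) z'1)).
- by move=> g Gg gg; exact: (etrans (esym (E (val (repr g)))) (H g Gg (gE (val (repr g)) gg))).
- exact: deE.
Qed.

Lemma generic_exists : exists2 g, Gamma g & generic g.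
Proof.
have lu : l \in unitmx by rewrite -cm_unit; exact: (unitarymx_unit ul).
have ku : k \in unitmx by rewrite -cm_unit; exact: (unitarymx_unit uk).
by have [g Gg gg] := zariski_generic theta dense lu ku; exists g.
Qed.

Variable i0 : 'I_n.
Let D : 'M[K]_n.+1 := last_diag n (\det l * \det k).
Let rho j : R := minor (transv R i0) (iota_ (tag j).+1) (tagged j).

Lemma test_matrix (X : 'M[K]_n.+1) : \det X = \det l * \det k ->
  exists A : SL K n, cm l *m cm (val A) *m cm k = cm X.
Proof.
have lu : l \in unitmx by rewrite -cm_unit; exact: (unitarymx_unit ul).
have ku : k \in unitmx by rewrite -cm_unit; exact: (unitarymx_unit uk).
by move=> dX; have [A AE] := SL_through lu ku dX; exists A; rewrite -!cmM AE.
Qed.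

(** l A k is diagonal with leading minors 1, so all off-image quotients vanish: this reference point
    shows that the constants below are 0. *)
Lemma test_diag : exists2 A : SL K n, genericm (cm (val A)) &
  forall j, off_image (iota_ (tag j).+1) (tagged j) ->
    rowq (tagged j) (cm (val A)) = 0 /\ colq (tagged j) (cm (val A)) = 0.
Proof.
have [A AE] := test_matrix (det_last_diag n (\det l * \det k)).
have E1 (i : 'I_n) f : minor (cm l *m cm (val A) *m cm k) (iota_ i.+1) f = minor 1%:M (iota_ i.+1) f.
  by rewrite AE -[cm _]mulmx1 minor_last_diagl.
have E2 (i : 'I_n) f : minor (cm l *m cm (val A) *m cm k) f (iota_ i.+1) = minor 1%:M f (iota_ i.+1).
  by rewrite AE -[cm _]mul1mx minor_last_diagr.
have q1 i : qlim i (cm (val A)) = 1.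
  by apply: etrans (E1 i (iota_ i.+1)) _; rewrite minor1 //; exact: iota_inj.
exists A => [i _|j jo]; first by rewrite q1 oner_neq0.
split; first by rewrite /rowq E1 (minor1_off_image _ jo) mul0r.
by rewrite /colq E2 -minor_tr trmx1 (minor1_off_image _ jo) mul0r.
Qed.

(** l A k is a transvection up to the diagonal factor D, which leaves the leading rows unchanged. *)
Lemma test_row : exists2 A : SL K n, genericm (cm (val A)) &
  forall j, rowq (tagged j) (cm (val A)) = (rho j)%:C%C.
Proof.
have [|A AE] := test_matrix (X := D *m transv K i0).
  by rewrite det_mulmx det_transv mulr1 det_last_diag.
have E1 (i : 'I_n) f : minor (cm l *m cm (val A) *m cm k) (iota_ i.+1) f = minor (transv C i0) (iota_ i.+1) f.
  by rewrite AE cmM minor_last_diagl /cm map_transv.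
have q1 i : qlim i (cm (val A)) = 1.
  by apply: etrans (E1 i (iota_ i.+1)) _; rewrite minor_transv_iota.
exists A => [i _|j]; first by rewrite q1 oner_neq0.
by rewrite /rowq E1 q1 divr1 -(map_transv (@real_complex R)) map_minor.
Qed.

Lemma test_col : exists2 A : SL K n, genericm (cm (val A)) &
  forall j, colq (tagged j) (cm (val A)) = (rho j)%:C%C.
Proof.
have [|A AE] := test_matrix (X := (transv K i0)^T *m D).
  by rewrite det_mulmx det_tr det_transv mul1r det_last_diag.
have E2 (i : 'I_n) f : minor (cm l *m cm (val A) *m cm k) f (iota_ i.+1) = minor (transv C i0) (iota_ i.+1) f.
  by rewrite AE cmM minor_last_diagr /cm -map_trmx map_transv minor_tr.
have q1 i : qlim i (cm (val A)) = 1.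
  by apply: etrans (E2 i (iota_ i.+1)) _; rewrite minor_transv_iota.
exists A => [i _|j]; first by rewrite q1 oner_neq0.
by rewrite /colq E2 q1 divr1 -(map_transv (@real_complex R)) map_minor.
Qed.

Lemma wt_eq0 j : ~~ ((tag j \in theta) && off_image (iota_ (tag j).+1) (tagged j)) -> wt j = 0.
Proof. by rewrite /wt => /negbTE ->. Qed.

Lemma wt_off j : wt j = 0 \/ off_image (iota_ (tag j).+1) (tagged j).
Proof. by rewrite /wt; case: ifP => [/andP[_]|]; [right|left]. Qed.

(** For fixed g and g', the mixed difference makes a linear combination of row quotients constant on
    Gamma, hence on SL by density. The constant is 0 by [test_diag], and [test_row] gives the stated
    relation. *)
Lemma col_identity g g' : Gamma g -> Gamma g' -> generic g -> generic g' ->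
  \sum_(j : J) complex.Re (colq (tagged j) (liftC g) * (c (tag j) * wt j * rho j)%:C%C) =
  \sum_(j : J) complex.Re (colq (tagged j) (liftC g') * (c (tag j) * wt j * rho j)%:C%C).
Proof.
move=> Gg Gg' gg gg'.
pose w j := (c (tag j) * wt j)%:C%C * (colq (tagged j) (liftC g) - colq (tagged j) (liftC g')).
have [g0 Gg0 gg0] := generic_exists.
have w0 j : tag j \notin theta -> w j = 0.
  by move=> /negbTE jt; rewrite /w wt_eq0 ?jt // mulr0 mul0r.
have crossE x : cross x g - cross x g' = \sum_(j : J) complex.Re (rowq (tagged j) (liftC x) * w j).
  rewrite !cross_sigma -sumrB; apply: eq_bigr => j _.
  rewrite -mulrBr -raddfB -mulrBr /w; set y := _ - _ : C.
  by rewrite mulrCA Re_realM.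
have H x : Gamma x -> generic x ->
    \sum_(j : J) complex.Re (rowq (tagged j) (liftC x) * w j) = cross g0 g - cross g0 g'.
  move=> Gx gx; rewrite -crossE; have := cross_diff Gx Gg0 Gg Gg' gx gg0 gg gg'.
  by move: (cross x g) (cross x g') (cross g0 g) (cross g0 g') => *; lra.
have ext := zariski_rowcol (u := fun j => iota_ (tag j).+1) (v := fun j => tagged j) w0 H.
have [A gA AE] := test_diag; have [A' gA' AE'] := test_row.
have S0 : \sum_(j : J) complex.Re (minor (cm l *m cm (val A) *m cm k) (iota_ (tag j).+1) (tagged j) /
    qlim (tag j) (cm (val A)) * w j) = 0.
  apply: big1 => j _; have [no|/AE[z _]] := wt_off j.
    by rewrite /w no mulr0 mul0r mulr0.
  by rewrite -/(rowq (tagged j) (cm (val A))) z mul0r.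
have E := etrans (ext A' gA') (etrans (esym (ext A gA)) S0).
have aux (x y : C) (r s : R) :
    complex.Re (x * (r * s)%:C%C) - complex.Re (y * (r * s)%:C%C) = complex.Re (s%:C%C * (r%:C%C * (x - y))).
  by case: x y => [x x'] [y y'] /=; ring.
apply/eqP; rewrite -subr_eq0 -sumrB; apply/eqP; apply: etrans E.
apply: eq_bigr => j _; rewrite -/(rowq (tagged j) (cm (val A'))) AE' /w.
exact: aux.
Qed.

(** Density in the second variable and [test_col] give a zero sum of the c wt rho^2. Only the maps
    of tag i0 contribute, as rho vanishes off the image for the other tags, and the term of
    [shift_last] is positive. *)
Lemma coefficient_eq0 : i0 \in theta -> (forall j, 0 <= wt j) ->
  0 < wt (Tagged _ (shift_last i0)) -> c i0 = 0.
Proof.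
move=> it wt0 wtp; have [g0 Gg0 gg0] := generic_exists.
pose w j := (c (tag j) * wt j * rho j)%:C%C.
have w0 j : tag j \notin theta -> w j = 0.
  by move=> /negbTE jt; rewrite /w wt_eq0 ?jt // mulr0 mul0r.
have ext := zariski_rowcol (u := fun j => tagged j) (v := fun j => iota_ (tag j).+1) w0
  (fun g Gg gg => col_identity Gg Gg0 gg gg0).
have [A gA AE] := test_diag; have [A' gA' AE'] := test_col.
have S0 : \sum_(j : J) complex.Re (minor (cm l *m cm (val A) *m cm k) (tagged j) (iota_ (tag j).+1) /
    qlim (tag j) (cm (val A)) * w j) = 0.
  apply: big1 => j _; have [no|/AE[_ z]] := wt_off j.
    by rewrite /w no mulr0 mul0r mulr0.
  by rewrite -/(colq (tagged j) (cm (val A))) z mul0r.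
have E := etrans (ext A' gA') (etrans (esym (ext A gA)) S0).
have : c i0 * \sum_j wt j * rho j ^+ 2 = 0.
  rewrite mulr_sumr; apply: etrans E; apply: eq_bigr => j _.
  rewrite -/(colq (tagged j) (cm (val A'))) AE' Re_realM /w /=.
  have [e0|ji] := eqVneq (tag j) i0; first by rewrite e0; ring.
  have [->|jo] := wt_off j; first by ring.
  by rewrite /rho minor_transv_off_image // expr0n /= !mulr0.
move/eqP; rewrite mulf_eq0 => /orP[/eqP //|]; rewrite gt_eqF //.
rewrite (bigD1 (Tagged _ (shift_last i0))) //= {1}/rho /= minor_transv_shift expr1n mulr1.
by apply: ltr_wpDr => //; apply: sumr_ge0 => j _; rewrite mulr_ge0 // sqr_ge0.
Qed.

End CrossTerms.

Lemma normc_minor_unitary_le (R : realType) d k (U A V : 'M[R[i]]_d) (f g : {ffun 'I_k -> 'I_d}) :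
  U \is unitarymx -> V \is unitarymx ->
  normc (minor (U *m A *m V) f g) <= (k`!)%:R * (nT R d k ^+ 4 * cnorm k A).
Proof.
move=> uU uV; rewrite -ler_pdivrMl ?fact_gt0R //; apply: le_trans (cnorm_ge _ f g) _.
exact: (@cnorm_unitary_le R d k U A V uU uV).
Qed.

Section BoundedCombinations.
Variables (R : realType) (b : base_field) (n : nat).
Local Notation K := (field_of R b).
Local Notation C := R[i].
Local Notation G := (PSL K n).
Local Notation iota_ i := (@iota_ n i).
Local Notation KD i := (Kd R n.+1 (nat_of_ord i).+1).
Local Open Scope classical_set_scope.
Opaque PSL_mul PSL_inv.

Lemma ln_sandwich (Kc p N x q w : R) : 1 <= Kc -> 0 < p -> 0 < N -> 0 < q -> ln p = w ->
  q / 2 < x -> p * p * x <= Kc * N -> N <= Kc * (p * p * (2 * q)) ->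
  `|ln N - 2 * w - ln q| <= ln (2 * Kc).
Proof.
move=> K1 p0 N0 q0 pw qx le1 le2; have K0 : 0 < Kc by lra.
have p2 := mulr_gt0 p0 p0; have pE : ln (p * p) = 2 * w by rewrite lnM // pw; ring.
have K2 : 0 < 2 * Kc by lra.
have K20 : 0 <= ln Kc by apply: ln_ge0.
have h1 : ln N <= ln (2 * Kc) + ln (p * p * q).
  apply: ln_submul => //; [exact: mulr_gt0|apply: le_trans le2 _].
  by have -> : Kc * (p * p * (2 * q)) = 2 * Kc * (p * p * q) by ring.
have h2 : ln (p * p * q) <= ln (2 * Kc) + ln N.
  apply: ln_submul => //; first exact: mulr_gt0.
  have : p * p * (q / 2) <= p * p * x by rewrite ler_wpM2l // ltW.
  by have -> : p * p * q = 2 * (p * p * (q / 2)) by [field]; move: (p * p * x) (p * p * _) le1 => u v; lra.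
rewrite (lnM p2 q0) pE in h1 h2.
by rewrite ler_norml; apply/andP; split; lra.
Qed.

Section Sandwich.
Variables (h : nat -> G) (k l : 'M[K]_n.+1) (i : 'I_n).
Hypothesis hk : mcvg (fun m => cm (svdk (h m))) (cm k).
Hypothesis hl : mcvg (fun m => cm (svdl (h m))) (cm l).
Hypothesis sr0 : (fun m => expR (- simple_root i (cartan (h m)))) @ \oo --> (0 : R).

(** The middle minor tends to [qlim] and the gaps to 0, so for large m the lower bound holds with
    half of |qlim| and the upper bound with twice it. *)
Lemma logN_sandwich g : qlim k l i (liftC g) != 0 -> \forall m \near \oo,
  `|logN i (h m * (g * h m))%g - 2 * fund_weight i (cartan (h m)) - ln (normc (qlim k l i (liftC g)))|
    <= ln (2 * KD i).
Proof.
move=> q0; have q0' : 0 < normc (qlim k l i (liftC g)) by rewrite normc_gt0.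
pose x m := normc (minor (cm (svdl (h m)) *m liftC g *m cm (svdk (h m))) (iota_ i.+1) (iota_ i.+1)).
have xc : x @ \oo --> normc (qlim k l i (liftC g)).
  by apply/ccvg_normc/ccvg_minor/mcvgM => //; apply: mcvgM => //; exact: mcvg_cst.
pose M := nT R n.+1 i.+1 ^+ 4 * cnorm i.+1 (liftC g).
have M0 : 0 <= M by rewrite mulr_ge0 ?cnorm_ge0 ?exprn_ge0 //; rewrite /nT.
have xM : (fun m => x m + M * expR (- simple_root i (cartan (h m))) +
    M * expR (- simple_root i (cartan (h m)))) @ \oo --> normc (qlim k l i (liftC g)).
  have E (y : R) : y = y + M * 0 + M * 0 by rewrite mulr0 !addr0.
  rewrite [X in _ --> X]E.
  apply: cvgD; [apply: cvgD => //|]; by apply: cvgM => //; exact: cvg_cst.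
move: q0' xc xM; move: (normc (qlim k l i (liftC g))) => q q0' xc xM.
have qh : q / 2 < q by lra.
have q2 : q < 2 * q by lra.
have [N1 _ P1] := cvgr_gt _ xc _ qh; have [N2 _ P2] := cvgr_lt _ xM _ q2.
exists (N1 + N2)%N; first by [].
move=> m /= Nm.
have l1 : q / 2 < x m := P1 m (leq_trans (leq_addr N2 N1) Nm).
have l2 := P2 m (leq_trans (leq_addl N1 N2) Nm).
have d := decomp_svd i (h m).
have le1 := decomp_mul_ge d d (liftC g).
have bd (f f' : {ffun 'I_i.+1 -> 'I_n.+1}) :
    normc (minor (cm (svdl (h m)) *m liftC g *m cm (svdk (h m))) f f') <= (i.+1`!)%:R * M.
  have [uk ul _ _] := svdP (h m).
  exact: (normc_minor_unitary_le (liftC g) f f' ul uk).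
have le2 := decomp_mul_le d d M0 bd.
have NE : cnorm i.+1 (liftC (h m) *m liftC g *m liftC (h m)) = cnorm i.+1 (liftC (h m * (g * h m))%g).
  by have [z z1 zE] := liftC3 (h m) g (h m); rewrite zE cnormZ.
rewrite NE in le1 le2.
have p0 := pr_gt0 (iota_ i.+1) (ecartan_gt0 (h m)).
apply: (ln_sandwich (KD_ge1 R i) p0 (cnorm_lift_gt0 i (h m * (g * h m))%g) q0' _ l1 le1).
  by rewrite pr_ecartan expRK.
apply: le_trans le2 _; have K0 := KD_gt0 R i.
exact: (ler_wpM2l (ltW K0) (ler_wpM2l (mulr_ge0 (ltW p0) (ltW p0)) (ltW l2))).
Qed.

End Sandwich.

(** A single coefficient is obtained, at a root whose gap keeps a positive share of the sum of the
    gaps along a subsequence. theta may be smaller than Theta so that it can be the support of c. *)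
Lemma bounded_combination (Gamma : set G) (Theta theta : {set 'I_n}) (c : 'I_n -> R)
    (h0 : nat -> G) (B : R) (it : 'I_n) :
  is_subgroup Gamma -> divergent Theta Gamma -> {subset theta <= Theta} -> zariski_dense Gamma ->
  (forall m, Gamma (h0 m)) -> escaping h0 ->
  (forall g, Gamma g -> `|\sum_(i in theta) c i * logN i g| <= B) ->
  it \in theta -> exists2 i, i \in theta & c i = 0.
Proof.
move=> Gsub Gdiv sub dense Gh0 eh0 cB itP.
pose sr (i : 'I_n) m := expR (- simple_root i (cartan (h0 m))).
have sr_gt0 i m : 0 < sr i m by exact: expR_gt0.
(* The scale of first order: every off-image ratio divided by e0 is in [0, 1], and those of the
   [shift_last] add up to 1, so some limit weight is positive. *)
pose e0 m := \sum_(i in theta) sr i m.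
have e0_gt0 m : 0 < e0 m.
  by rewrite /e0 (bigD1 it) //= ltr_pwDl // sumr_ge0 // => i _; exact: ltW.
have sr_cvg i : i \in theta -> sr i @ \oo --> (0 : R).
  move=> iT; apply/cvgrPdist_lt => d d0.
  have [N _ NP] := simple_root_escaping Gdiv (sub i iT) Gh0 eh0 (- ln d + 1).
  exists N; first by []. move=> m Nm; have /= sm := NP m Nm.
  rewrite sub0r normrN ger0_norm ?(ltW (sr_gt0 i m)) // /sr -[ltRHS](lnK d0) ltr_expR.
  by move: (simple_root _ _) (ln d) sm => u v; lra.
have e0_cvg : e0 @ \oo --> (0 : R).
  have -> : 0 = \sum_(i in theta) (0 : R) by rewrite big1.
  by apply: cvg_sum_cond => i; exact: sr_cvg.
have [f fi [L LP]] := unitary_compact (u := fun x : bool => fun m => if x then svdk (h0 m) else svdl (h0 m))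
  (fun x m => let: And4 uk ul _ _ := svdP (h0 m) in
     if x return cm (if x then svdk (h0 m) else svdl (h0 m)) \is unitarymx then uk else ul).
have [hk0 uk] := LP true; have [hl0 ul] := LP false.
pose J := option {i : 'I_n & {ffun 'I_i.+1 -> 'I_n.+1}}.
pose h1 := h0 \o f.
pose x (j : J) m : R := match j with
  | None => kap theta h1 c m
  | Some j => if (tag j \in theta) && off_image (iota_ (tag j).+1) (tagged j)
     then pr (ecartan (h1 m)) (tagged j) / pr (ecartan (h1 m)) (iota_ (tag j).+1) / e0 (f m) else 0
  end.
have ratio (i : 'I_n) m (g : {ffun 'I_i.+1 -> 'I_n.+1}) : i \in theta -> off_image (iota_ i.+1) g ->
    0 <= pr (ecartan (h0 m)) g / pr (ecartan (h0 m)) (iota_ i.+1) / e0 m <= 1.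
  move=> iT /andP[/injectiveP gi go].
  have [_ _ [a0 _ _ aP] _ _] := decomp_svd i (h0 m).
  have pi0 := pr_gt0 (iota_ i.+1) a0; have pg0 := pr_gt0 g a0.
  have [_ /(_ go) le] := aP g gi.
  apply/andP; split; first by rewrite !divr_ge0 // ltW.
  rewrite ler_pdivrMr ?e0_gt0 // mul1r ler_pdivrMr //; apply: le_trans le _.
  rewrite ler_wpM2r ?(ltW pi0) // /e0 (bigD1 i) //= lerDl.
  by apply: sumr_ge0 => i' _; exact: ltW.
pose Kk := B + \sum_(i in theta) `|c i| * ln (3 * KD i ^+ 2) +
  `|\sum_(i in theta) c i * ln ((rearrangements (iota_ i.+1))%:R / (i.+1`!)%:R)|.
have combE (g : G) : `|\sum_(i in theta) c i * fund_weight i (cartan g)| <=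
    `|\sum_(i in theta) c i * logN i g| + \sum_(i in theta) `|c i| * ln (3 * KD i ^+ 2).
  have -> : \sum_(i in theta) c i * fund_weight i (cartan g) = \sum_(i in theta) c i * logN i g
     - \sum_(i in theta) c i * (logN i g - fund_weight i (cartan g)).
    by rewrite -sumrB; apply: eq_bigr => i _; rewrite mulrBr opprB addrCA subrr addr0.
  apply: le_trans (ler_normB _ _) _; rewrite lerD2l; apply: le_trans (ler_norm_sum _ _ _) _.
  by apply: ler_sum => i _; rewrite normrM ler_wpM2l // logN_cartan.
have xB j m : `|x j m| <= `|Kk| + 1.
  case: j => [j|] /=.
    case: ifP => [/andP[jT jo]|_]; last by rewrite normr0 addr_ge0.
    have /andP[r0 r1] := ratio (tag j) (f m) (tagged j) jT jo.
    by rewrite ger0_norm // (le_trans r1) // lerDr.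
  apply: (@le_trans _ _ Kk); last by apply: le_trans (ler_norm _) _; rewrite lerDl.
  rewrite /kap; under eq_bigr do rewrite mulrDr.
  rewrite big_split /=; apply: le_trans (ler_normD _ _) _; rewrite lerD2r.
  apply: le_trans (combE (h0 (f m))) _; rewrite lerD2r; exact: (cB _ (Gh0 (f m))).
have [f' fi' [lim limP]] := bolzano_weierstrass_family xB.
pose h := h1 \o f'; pose e := e0 \o f \o f'.
pose t (i : 'I_n) (g : {ffun 'I_i.+1 -> 'I_n.+1}) : R := lim (Some (Tagged _ g)).
have Gh m : Gamma (h m) by exact: Gh0.
have hk : mcvg (fun m => cm (svdk (h m))) (cm (L true)) := mcvg_subseq fi' hk0.
have hl : mcvg (fun m => cm (svdl (h m))) (cm (L false)) := mcvg_subseq fi' hl0.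
have e_gt0 m : 0 < e m by exact: e0_gt0.
have e_cvg : e @ \oo --> (0 : R) := cvg_subseq fi' (cvg_subseq fi e0_cvg).
have t_cvg (i : 'I_n) (g : {ffun 'I_i.+1 -> 'I_n.+1}) : i \in theta -> off_image (iota_ i.+1) g ->
   (fun m => pr (ecartan (h m)) g / pr (ecartan (h m)) (iota_ i.+1) / e m) @ \oo --> t i g.
  move=> iT go; have := limP (Some (Tagged _ g)); apply: cvg_trans; apply: near_eq_cvg.
  by apply: nearW => m; rewrite /x /= iT go.
have kap_cvg : kap theta h c @ \oo --> lim None by exact: (limP None).
have sr_cvg' i : i \in theta -> (fun m => expR (- simple_root i (cartan (h m)))) @ \oo --> (0 : R).
  by move=> iT; exact: (cvg_subseq fi' (cvg_subseq fi (sr_cvg i iT))).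
have [_ GM _] := Gsub.
pose lk (i : 'I_n) : R := ln (2 * KD i).
pose Bp : R := `|lim None| + (B + 2 * (B + \sum_(i in theta) `|c i| * ln (3 * KD i ^+ 2)) +
  \sum_(i in theta) `|c i| * lk i).
(* [qlim] at g is compared with W_i(h g h) at an index N that depends on g, while the bound B on the
   combination, and hence Bp, does not. *)
have PsiB g : Gamma g -> generic theta (L true) (L false) g ->
    `|Psi theta (L true) (L false) c (lim None) g| <= Bp.
  move=> Gg gg; apply: le_trans (ler_normD _ _) _; rewrite lerD2l.
  have [N _ NP] := near_theta (fun i iT => logN_sandwich hk hl (sr_cvg' i iT) (gg i iT)).
  have {}NP i (iT : i \in theta) := NP N (leqnn N) i iT.
  have Ghgh := GM (h N) _ (Gh N) (GM g _ Gg (Gh N)).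
  have b1 := cB _ Ghgh; have b2 := le_trans (combE (h N)) (lerD (cB _ (Gh N)) (lexx _)).
  pose d i := logN i (h N * (g * h N))%g - 2 * fund_weight i (cartan (h N)) -
    ln (normc (qlim (L true) (L false) i (liftC g))).
  have dB : `|\sum_(i in theta) c i * d i| <= \sum_(i in theta) `|c i| * lk i.
    apply: le_trans (ler_norm_sum _ _ _) _; apply: ler_sum => i iT.
    by rewrite normrM ler_wpM2l //; exact: NP.
  have dE : \sum_(i in theta) c i * d i = \sum_(i in theta) c i * logN i (h N * (g * h N))%g -
      2 * (\sum_(i in theta) c i * fund_weight i (cartan (h N))) - logq theta (L true) (L false) c g.
    rewrite mulr_sumr -!sumrB; apply: eq_bigr => i _; rewrite /d.
    by move: (logN i _) (fund_weight _ _) (ln _) (c i) => u v w z; ring.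
  rewrite dE in dB; move: b1 b2 dB; move: (logq _ _ _ _ _).
  move: (\sum_(i in theta) c i * logN _ _) (\sum_(i in theta) c i * fund_weight _ _).
  move: (\sum_(i in theta) _ * lk i) (\sum_(i in theta) _ * ln (3 * _)) => u v w z y.
  rewrite !ler_norml => /andP[? ?] /andP[? ?] /andP[? ?]; apply/andP; split; lra.
have Psi0 := Psi_eq0 Gsub Gh hk hl e_gt0 e_cvg t_cvg kap_cvg PsiB.
have t_ge0 i g : i \in theta -> off_image (iota_ i.+1) g -> 0 <= t i g.
  move=> iT go; rewrite leNgt; apply/negP => lt.
  have [N _ NP] := cvgr_lt _ (t_cvg i g iT go) _ lt.
  have := NP N (leqnn N); rewrite /= ltNge.
  by have /andP[-> _] := ratio i (f (f' N)) g iT go.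
have wt_ge0 j : 0 <= wt theta t j.
  rewrite /wt; case: ifP => // /andP[jT jo]; rewrite mulr_ge0 ?invr_ge0 //; exact: t_ge0.
have sum1 : \sum_(i in theta) t i (shift_last i) = 1.
  have cv : (fun m => \sum_(i in theta) pr (ecartan (h m)) (shift_last i) /
      pr (ecartan (h m)) (iota_ i.+1) / e m) @ \oo --> \sum_(i in theta) t i (shift_last i).
    by apply: cvg_sum_cond => i iT; apply: t_cvg => //; exact: shift_last_off.
  have E : (fun m => \sum_(i in theta) pr (ecartan (h m)) (shift_last i) /
      pr (ecartan (h m)) (iota_ i.+1) / e m) = fun=> 1.
    apply/funext => m; rewrite -mulr_suml.
    under eq_bigr do rewrite (pr_shift_last _ (ecartan_gt0 (h m))) ecartan_ratio.
    by rewrite divff // lt0r_neq0 //; exact: e_gt0.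
  by rewrite E in cv; exact: (cvg_unique _ cv (cvg_cst _)).
have [i iT ti] : exists2 i, i \in theta & 0 < t i (shift_last i).
  apply: contrapT => no; have : \sum_(i in theta) t i (shift_last i) <= 0.
    apply: sumr_le0 => i iT; rewrite leNgt; apply/negP => lt; apply: no; by exists i.
  by rewrite sum1 leNgt ltr01.
exists i => //; apply: (coefficient_eq0 Gsub Gh hk hl e_gt0 e_cvg t_cvg Psi0 dense uk ul iT wt_ge0).
rewrite /wt /= iT shift_last_off mulr_gt0 // invr_gt0 ltr0n.
by apply: rearrangements_gt0; exact: iota_inj.
Qed.

(** If some c i were nonzero, [bounded_combination] on the support of c would find a zero
    coefficient in it. *)
Lemma bounded_combination_eq0 (Gamma : set G) (theta : {set 'I_n}) (c : 'I_n -> R) (h : nat -> G) B :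
  is_subgroup Gamma -> divergent theta Gamma -> zariski_dense Gamma ->
  (forall m, Gamma (h m)) -> escaping h ->
  (forall g, Gamma g -> `|\sum_(i in theta) c i * logN i g| <= B) ->
  forall i, i \in theta -> c i = 0.
Proof.
move=> Gsub Gdiv dense Gh eh cB i it; apply/eqP/negPn/negP => ci.
pose theta' := [set i in theta | c i != 0]%SET.
have sub : {subset theta' <= theta} by move=> x; rewrite inE => /andP[].
have cB' g : Gamma g -> `|\sum_(i in theta') c i * logN i g| <= B.
  move=> Gg; have := cB g Gg; congr (`|_| <= _).
  rewrite [RHS]big_mkcond [LHS]big_mkcond; apply: eq_bigr => x _; rewrite inE.
  by case: (x \in theta) => //=; case: eqP => //= ->; rewrite mul0r.
have it' : i \in theta' by rewrite inE it.
have [x] := bounded_combination Gsub Gdiv sub dense Gh eh cB' it'.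
by rewrite inE => /andP[_ /eqP].
Qed.

End BoundedCombinations.

(** * Linear forms and the Poincare series *)

Section DualCoordinates.
Variables (R : realType) (n : nat) (theta : {set 'I_n}).
Implicit Types (v : 'rV[R]_n.+1) (i : 'I_n).

Lemma summation_by_parts (v : nat -> R) m : \sum_(j < m.+1) v j ^+ 2 =
  \sum_(i < m) (\sum_(j < i.+1) v j) * (v i - v i.+1) + (\sum_(j < m.+1) v j) * v m.
Proof.
elim: m => [|m IH]; first by rewrite big_ord0 !big_ord1 add0r expr2.
rewrite big_ord_recr /= IH [in RHS]big_ord_recr /= [in X in _ = _ + X * _]big_ord_recr /=.
by set s := \sum_(j < m.+1) v j; ring.
Qed.

Lemma fund_weight_nat i v : fund_weight i v = \sum_(j < i.+1) v 0 (inord j).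
Proof.
have ii : (i.+1 <= n.+1)%N by rewrite ltnS ltnW.
rewrite (big_ord_widen n.+1 (fun j => v 0 (inord j)) ii).
by apply: eq_bigr => j _; rewrite inord_val.
Qed.

Lemma fund_weight_linear i k u v : fund_weight i (k *: u + v) = k * fund_weight i u + fund_weight i v.
Proof.
rewrite /fund_weight mulr_sumr -big_split /=.
by apply: eq_bigr => j _; rewrite !mxE.
Qed.

(** Coordinates adapted to a_theta: on this subspace those outside theta and the last one vanish,
    and the other ones are the weights. *)
Definition coords v : 'rV[R]_n.+1 := \row_x
  match unlift ord_max x with
  | Some i => if i \in theta then fund_weight i v else simple_root i v
  | None => entry_sum v
  end.

Lemma coordsE i v : coords v 0 (lift ord_max i) = if i \in theta then fund_weight i v else simple_root i v.
Proof. by rewrite mxE liftK. Qed.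

Lemma coords_last v : coords v 0 ord_max = entry_sum v.
Proof. by rewrite mxE unlift_none. Qed.

Lemma coords_is_linear : linear coords.
Proof.
move=> k u v; apply/rowP => x; rewrite !mxE; case: (unlift ord_max x) => [i|].
  by case: ifP => _; [exact: fund_weight_linear|exact: (linearP (simple_root i))].
exact: (linearP (@entry_sum R n)).
Qed.
HB.instance Definition _ := GRing.isLinear.Build R 'rV[R]_n.+1 'rV[R]_n.+1 _ coords coords_is_linear.

(* By Abel summation the sum of the squares of the entries of v is the sum of the
   omega_i(v) alpha_i(v), and each product has a zero factor. *)
Lemma coords_eq0 v : coords v = 0 -> v = 0.
Proof.
move=> c0; have z i : fund_weight i v * simple_root i v = 0.
  have := coordsE i v; rewrite c0 mxE.
  by case: ifP => _ <-; rewrite ?mul0r ?mulr0.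
have zn : entry_sum v = 0 by rewrite -coords_last c0 mxE.
pose w (j : nat) := v 0 (inord j).
have := summation_by_parts w n.
rewrite [X in _ = X + _]big1 => [|i _]; last first.
  apply: etrans (z i); rewrite fund_weight_nat /simple_root.
  have -> : widen_ord (leqnSn n) i = inord i.
    by apply/val_inj; rewrite /= inordK // ltnS ltnW.
  have -> : lift ord0 i = inord i.+1 :> 'I_n.+1.
    by apply/val_inj; rewrite /= inordK // ltnS.
  by [].
have -> : \sum_(j < n.+1) w j = 0.
  by apply: etrans zn; apply: eq_bigr => j _; rewrite /w inord_val.
rewrite mul0r add0r => /eqP; rewrite psumr_eq0 => [/allP H|j _]; last exact: sqr_ge0.
apply/rowP => x; have := H x (mem_index_enum x).
by rewrite /= sqrf_eq0 /w inord_val mxE => /eqP.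
Qed.

(** e i has i-th coordinate 1 in [coords] and all the others 0. *)
Lemma dual_basis : exists e : 'I_n -> subvs_of (a_sub R theta),
  (forall v : subvs_of (a_sub R theta), v = \sum_(i in theta) fund_weight i (vsval v) *: e i) /\
  (forall (c : 'I_n -> R) i, i \in theta ->
     fund_weight i (vsval (\sum_(x in theta) c x *: e x)) = c i).
Proof.
pose M := lin1_mx coords.
have ME v : v *m M = coords v by rewrite mul_rV_lin1.
have Mu : M \in unitmx.
  by rewrite -row_free_unit; apply: inj_row_free => v; rewrite ME; exact: coords_eq0.
pose e' x : 'rV[R]_n.+1 := delta_mx 0 x *m invmx M.
have ce' x : coords (e' x) = delta_mx 0 x by rewrite -ME mulmxKV.
have sub i : i \in theta -> e' (lift ord_max i) \in a_sub R theta.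
  move=> it; apply/memv_a_sub; split.
    rewrite -[LHS]/(entry_sum _) -coords_last ce' mxE /=.
    by rewrite (negbTE (neq_lift _ _)).
  move=> j jt; have : simple_root j (e' (lift ord_max i)) = 0.
    have := coordsE j (e' (lift ord_max i)); rewrite (negbTE jt) ce' => <-.
    rewrite mxE /= (inj_eq lift_inj); case: eqP => // ji.
    by move: jt; rewrite ji it.
  by rewrite /simple_root => /eqP; rewrite subr_eq0 => /eqP.
pose e i := vsproj (a_sub R theta) (e' (lift ord_max i)).
have eE i : i \in theta -> vsval (e i) = e' (lift ord_max i) by move=> it; rewrite vsprojK // sub.
have comb (c : 'I_n -> R) : coords (vsval (\sum_(x in theta) c x *: e x)) =
    \sum_(x in theta) c x *: delta_mx 0 (lift ord_max x).
  rewrite raddf_sum /= raddf_sum /=; apply: eq_bigr => x xt.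
  by rewrite !linearZ /= eE // ce'.
have combE (c : 'I_n -> R) i : i \in theta ->
    coords (vsval (\sum_(x in theta) c x *: e x)) 0 (lift ord_max i) = c i.
  move=> it; rewrite comb summxE (bigD1 i) //= !mxE !eqxx mulr1 big1 ?addr0 // => x /andP[_ xi].
  by rewrite !mxE /= (inj_eq lift_inj) eq_sym (negbTE xi) mulr0.
have expand (c : 'I_n -> R) i : i \in theta ->
     fund_weight i (vsval (\sum_(x in theta) c x *: e x)) = c i.
  by move=> it; rewrite -[RHS](combE c i it) coordsE it.
exists e; split=> // v; apply/val_inj.
have inj u u' : coords u = coords u' -> u = u'.
  by move=> uu; apply/eqP; rewrite -subr_eq0; apply/eqP/coords_eq0; rewrite raddfB /= uu subrr.
apply: inj; apply/rowP => x.
have [v0 vt] := memv_a_sub _ _ (subvsP v).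
set u := \sum_(i in theta) _; have [u0 ut] := memv_a_sub _ _ (subvsP u).
case: (unliftP ord_max x) => [i ->|->]; last first.
  by rewrite !coords_last /entry_sum; apply: etrans v0 (esym u0).
rewrite !coordsE; case: ifP => [it|/negbT it]; first by rewrite /u expand.
by rewrite /simple_root vt // ut // !subrr.
Qed.

Lemma a_dual_expansion : exists e : 'I_n -> subvs_of (a_sub R theta),
  (forall b (g : PSL (field_of R b) n) (phi : a_dual R theta),
     phi (pcartan theta g) = \sum_(i in theta) phi (e i) * fund_weight i (cartan g)) /\
  (forall phi1 phi2 : a_dual R theta, (forall i, i \in theta -> phi1 (e i) = phi2 (e i)) -> phi1 = phi2).
Proof.
have [e [eV eS]] := dual_basis.
have phiE (phi : a_dual R theta) (v : subvs_of (a_sub R theta)) :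
    phi v = \sum_(i in theta) phi (e i) * fund_weight i (vsval v).
  rewrite [in LHS](eV v) raddf_sum /=; apply: eq_bigr => i _.
  by rewrite linearZ /= mulrC.
exists e; split=> [b g phi|phi1 phi2 H].
  rewrite phiE; apply: eq_bigr => i it; congr (_ * _); rewrite /pcartan.
  (* The default value of [xget] is excluded: the combination of the e x with the weights of
     kappa(g) belongs to the set that defines [pcartan]. *)
  case: xgetP => [v _ /(_ i it) //|no]; exfalso.
  apply: (no (\sum_(x in theta) fund_weight x (cartan g) *: e x)) => x xt.
  exact: (eS (fun y => fund_weight y (cartan g))).
apply/lfunP => v; rewrite !phiE; apply: eq_bigr => i it.
by rewrite H.
Qed.

End DualCoordinates.

(** * Finite sums, Poincare series and critical exponents *)

Section FiniteSums.
Variables (R : realType) (G : groupType) (Gamma : set G).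
Implicit Types (v : G -> R) (E : seq G).

Lemma wsum_subset v (P : pred G) E (X : seq G) : uniq E -> (forall x, x \in E -> P x -> x \in X) ->
  \sum_(x <- E | P x) expR (- v x) <= \sum_(x <- undup X) expR (- v x).
Proof.
move=> uE EX; rewrite -big_filter; apply: ler_sum_subset => //; rewrite ?filter_uniq ?undup_uniq //.
  by move=> x; rewrite mem_filter mem_undup => /andP[Px xE]; exact: EX.
Qed.

(** Only finitely many g have v g <= 0; the terms of all the others decrease as the exponent
    grows. *)
Lemma wbound_scale v Q (s s' : R) : 0 < s' -> s' <= s -> wbound Gamma (fun g => s' * v g) Q ->
  exists Q', wbound Gamma (fun g => s * v g) Q'.
Proof.
move=> s'0 ss' bQ; have [X XP] := wbound_proper bQ 0.
exists (\sum_(x <- undup X) expR (- (s * v x)) + Q) => E [uE GE].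
rewrite /wsum (bigID (fun x => v x <= 0)) /=; apply: lerD.
  apply: (@wsum_subset (fun g => s * v g) (fun x => v x <= 0)) => // x xE vx.
  by apply: XP; [exact: GE|rewrite pmulr_rle0].
apply: le_trans (bQ E (conj uE GE)).
rewrite /wsum [leRHS](bigID (fun x => v x <= 0)) /=; apply: ler_wpDl.
  by apply: sumr_ge0 => x _; exact: expR_ge0.
apply: ler_sum => x; rewrite -ltNge => vx; rewrite ler_expR lerN2 ler_wpM2r //.
exact: ltW.
Qed.

End FiniteSums.

Section PoincareSeries.
Variables (R : realType) (b : base_field) (n : nat) (theta : {set 'I_n}).
Local Notation K := (field_of R b).
Local Notation G := (PSL K n).
Local Open Scope classical_set_scope.
Variables (Gamma : set G).
Implicit Type phi : a_dual R theta.

Lemma poincare_wbound phi s : (poincare Gamma phi s < +oo)%E ->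
  exists Q, wbound Gamma (fun g => s * phi (pcartan theta g)) Q.
Proof.
move=> fin; exists (fine (poincare Gamma phi s)) => E [uE GE].
have ge0 : (0 <= poincare Gamma phi s)%E by apply: esum_ge0 => x _; rewrite lee_fin expR_ge0.
rewrite -lee_fin fineK; last by rewrite ge0_fin_numE.
apply: esum_ge; exists [set` E]; first by split; [exact: finite_seq|exact: GE].
rewrite -fsbig_seq // sumEFin lee_fin /wsum; apply: ler_sum => x _.
by rewrite mulNr.
Qed.

Lemma wbound_poincare phi s Q : wbound Gamma (fun g => s * phi (pcartan theta g)) Q ->
  (poincare Gamma phi s <= Q%:E)%E.
Proof.
move=> bQ; apply: ge_ereal_sup => _ [A [fA AG] <-].
rewrite fsbig_finite //= sumEFin lee_fin.
have := bQ (finmap.enum_fset (fset_set A)); rewrite /wsum.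
under eq_bigr do rewrite -mulNr; apply.
split; first exact: finmap.fset_uniq.
by move=> x; rewrite in_fset_set // inE => /AG.
Qed.

Lemma critical_exponent_wbound phi s : critical_exponent Gamma phi = 1%E -> 1 < s ->
  exists Q, wbound Gamma (fun g => s * phi (pcartan theta g)) Q.
Proof.
move=> ce s1; have : (critical_exponent Gamma phi < s%:E)%E by rewrite ce lte_fin.
move=> /ereal_inf_lt[_ [s' [s'0 fin] <-]]; rewrite lte_fin => s's.
have [Q bQ] := poincare_wbound fin.
exact: (wbound_scale s'0 (ltW s's) bQ).
Qed.

Lemma critical_exponent_le1 phi :
  (forall s, 1 < s -> exists Q, wbound Gamma (fun g => s * phi (pcartan theta g)) Q) ->
  (critical_exponent Gamma phi <= 1)%E.
Proof.
move=> H; apply/lee_addgt0Pr => e e0; rewrite -EFinD.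
have s1 : 1 < 1 + e by rewrite ltrDl.
have [Q bQ] := H _ s1; apply: ereal_inf_lbound; exists (1 + e) => //; split; first exact: lt_trans s1.
by apply: le_lt_trans (wbound_poincare bQ) _; exact: ltry.
Qed.

Lemma poincare_diverges phi : poincare Gamma phi 1 = +oo%E ->
  forall M, exists2 E, finG Gamma E & M <= wsum (fun g => phi (pcartan theta g)) E.
Proof.
move=> div M; apply: contrapT => no.
have bM : wbound Gamma (fun g => 1 * phi (pcartan theta g)) M.
  move=> E fE; rewrite leNgt; apply/negP => lt; apply: no; exists E => //.
  apply: ltW; move: lt; rewrite /wsum.
  by under eq_bigr do rewrite mul1r.
by have := wbound_poincare bM; rewrite div leye_eq.
Qed.

End PoincareSeries.

Section CartanCombinations.
Variables (R : realType) (b : base_field) (n : nat) (theta : {set 'I_n}).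
Local Notation K := (field_of R b).
Local Notation G := (PSL K n).
Local Notation omega := (@omega R b n theta).
Implicit Types (g h : G) (c : 'I_n -> R).
Local Notation lK i := (ln (3 * Kd R n.+1 (nat_of_ord i).+1 ^+ 2)).
Opaque PSL_mul PSL_inv.

(** The defect of W_i on a good pair lies in [0, C], and each weight is within a bounded distance of
    W_i, which the + 1 in [quasi] absorbs. *)
Lemma quasi_weights (Gamma : set G) c : exists2 L, 0 <= L &
  quasi Gamma omega L (fun g => \sum_(i in theta) c i * fund_weight i (cartan g)).
Proof.
have aux (x y z u v w l C : R) : 0 <= l -> 0 <= C -> x <= y + z -> y + z - x <= C ->
    `|x - u| <= l -> `|y - v| <= l -> `|z - w| <= l -> `|u - v - w| <= (1 + 3 * l) * (C + 1).
  rewrite !ler_norml => l0 C0 h1 h2 /andP[? ?] /andP[? ?] /andP[? ?].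
  have : 0 <= 3 * l * C by rewrite !mulr_ge0.
  by move=> lC; apply/andP; split; lra.
have l0 (i : 'I_n) : 0 <= lK i by apply: le_trans (logN_cartan i (1%g : G)); exact: normr_ge0.
exists (\sum_(i in theta) `|c i| * (1 + 3 * lK i)).
  by apply: sumr_ge0 => i _; rewrite mulr_ge0 // addr_ge0 // mulr_ge0.
move=> Cc g h C0 Gg Gh gd.
rewrite -!sumrB mulr_suml; apply: le_trans (ler_norm_sum _ _ _) _.
apply: ler_sum => i it; rewrite -!mulrBr normrM -mulrA ler_wpM2l //.
exact: (aux _ _ _ _ _ _ _ _ (l0 i) C0 (logN_sub i g h) (gd (exist _ i it))
  (logN_cartan i (g * h)%g) (logN_cartan i g) (logN_cartan i h)).
Qed.

Lemma weights_logN c g : `|\sum_(i in theta) c i * logN i g| <=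
  `|\sum_(i in theta) c i * fund_weight i (cartan g)| + \sum_(i in theta) `|c i| * lK i.
Proof.
have -> : \sum_(i in theta) c i * logN i g = \sum_(i in theta) c i * fund_weight i (cartan g)
   + \sum_(i in theta) c i * (logN i g - fund_weight i (cartan g)).
  by rewrite -big_split; apply: eq_bigr => i _ /=; rewrite mulrBr addrC subrK.
apply: le_trans (ler_normD _ _) _; rewrite lerD2l; apply: le_trans (ler_norm_sum _ _ _) _.
by apply: ler_sum => i _; rewrite normrM ler_wpM2l // logN_cartan.
Qed.

Lemma exhaustion (Gamma : set G) (v : G -> R) Q : wbound Gamma v Q ->
  exists X : nat -> seq G, (forall m f, f \in X m -> Gamma f) /\
    (forall f, Gamma f -> exists N, forall m, (N <= m)%N -> f \in X m).
Proof.
move=> bQ; have [X XP] := choice (fun m : nat => wbound_proper bQ m%:R).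
exists (fun m => [seq x <- X m | `[< Gamma x >]]); split=> [m f|f Gf].
  by rewrite mem_filter => /andP[/asboolP].
exists (Num.bound `|v f|) => m bm; rewrite mem_filter; apply/andP; split; first exact/asboolP.
apply: XP => //; apply: le_trans (ler_norm _) _; apply: ltW.
by apply: lt_le_trans (archi_boundP _) _; rewrite ?ler_nat.
Qed.

(** Divergence makes Gamma infinite, so a term can be chosen outside each finite set X m. *)
Lemma escaping_sequence (Gamma : set G) (v : G -> R) (X : nat -> seq G) :
  (forall M, exists2 E, finG Gamma E & M <= wsum v E) ->
  (forall f, Gamma f -> exists N, forall m, (N <= m)%N -> f \in X m) ->
  exists2 h : nat -> G, (forall m, Gamma (h m)) & escaping h.
Proof.
move=> div XP; have next m : exists x, Gamma x /\ x \notin X m.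
  apply: contrapT => no; pose M := \sum_(x <- undup (X m)) expR (- v x) + 1.
  have [E [uE GE]] := div M; apply/negP; rewrite -ltNge /M.
  apply: (@le_lt_trans _ _ (\sum_(x <- undup (X m)) expR (- v x))); last by rewrite ltrDl.
  apply: (@wsum_subset _ _ v predT) => // x xE _; apply/negPn/negP => xX.
  by apply: no; exists x; split => //; exact: GE.
have [h hP] := choice next; exists h => [m|x]; first by have [] := hP m.
have [Gx|nGx] := pselect (Gamma x); last first.
  by apply: nearW => m hx; apply: nGx; rewrite -hx; have [] := hP m.
have [N NP] := XP x Gx; exists N => // m /= Nm hx.
by have [_] := hP m; rewrite hx NP.
Qed.

End CartanCombinations.

Theorem corollary1p6 (R : realType) (b : base_field) (n : nat)
  (theta : {set 'I_n}) (Gamma : set (PSL (field_of R b) n))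
  (phi1 phi2 : a_dual R theta) (lambda : R) :
  symmetric_roots theta ->
  transverse_subgroup theta Gamma ->
  zariski_dense Gamma ->
  phi1 <> phi2 ->
  critical_exponent Gamma phi1 = 1%E ->
  critical_exponent Gamma phi2 = 1%E ->
  0 < lambda < 1 ->
  diverges_at_critical_exponent Gamma (lambda *: phi1 + (1 - lambda) *: phi2)%R ->
  (critical_exponent Gamma (lambda *: phi1 + (1 - lambda) *: phi2)%R < 1)%E.
Proof.
move=> tsym [Gsub Gdiv Gtrans] dense neq ce1 ce2 lam01.
set phi := (lambda *: phi1 + _)%R => -[s0 cephi divphi].
rewrite ltNge; apply/negP => ge1; apply: neq.
have phiE v : phi v = lambda * phi1 v + (1 - lambda) * phi2 v.
  by rewrite add_lfunE !scale_lfunE.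
pose f1 (g : PSL (field_of R b) n) : R := phi1 (pcartan theta g).
pose f2 (g : PSL (field_of R b) n) : R := phi2 (pcartan theta g).
have sum1 := critical_exponent_wbound ce1; have sum2 := critical_exponent_wbound ce2.
have fE (g : PSL (field_of R b) n) :
  phi (pcartan theta g) = lambda * f1 g + (1 - lambda) * f2 g by exact: phiE.
have le1 : (critical_exponent Gamma phi <= 1)%E.
  apply: critical_exponent_le1 => s s1.
  have [Q bQ] := phi_summable (phi1 := f1) (phi2 := f2) lam01 sum1 sum2 s1; exists Q.
  by move=> E fE'; apply: le_trans (bQ E fE'); rewrite /wsum; under eq_bigr do rewrite fE.
have s01 : s0 = 1.
  by apply/EFin_inj; rewrite -cephi; apply/eqP; rewrite eq_le le1 ge1.
rewrite s01 in divphi.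
have div M : exists2 E, finG Gamma E & M <= wsum (fun g => lambda * f1 g + (1 - lambda) * f2 g) E.
  have [E fE' ME] := poincare_diverges divphi M; exists E => //; apply: le_trans ME _.
  by rewrite /wsum; under eq_bigr do rewrite fE.
have [e [eE eI]] := a_dual_expansion R theta.
have f1E : f1 = (fun g => \sum_(i in theta) phi1 (e i) * fund_weight i (cartan g)).
  by apply/funext => g; exact: eE.
have f2E : f2 = (fun g => \sum_(i in theta) phi2 (e i) * fund_weight i (cartan g)).
  by apply/funext => g; exact: eE.
have [L1 L10 q1] := quasi_weights theta Gamma (fun i => phi1 (e i)).
have [L2 L20 q2] := quasi_weights theta Gamma (fun i => phi2 (e i)).
have qW (L L' : R) v : L <= L' -> quasi Gamma (@omega R b n theta) L v ->
    quasi Gamma (@omega R b n theta) L' v.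
  move=> LL qv C g h C0 Gg Gh gh; apply: le_trans (qv C g h C0 Gg Gh gh) _.
  by rewrite ler_wpM2r // addr_ge0.
rewrite -f1E in q1; rewrite -f2E in q2.
have l12 : (1 : R) < 2 by rewrite ltr1n.
(* Convergence at the exponent 2 yields the exhaustion of Gamma by finite sets. *)
have [Q2 bQ2] := sum1 2 l12; have [X [XG XP]] := exhaustion bQ2.
have [F [Cf [FG Cf0 Fgood]]] := good_finite_set theta dense XG XP.
have [h Gh eh] := escaping_sequence div XP.
have hyp := hyperbolic_triples tsym Gsub Gdiv Gtrans.
have [B BP] := ratio_bounded Gsub (@omega_sub R b n theta) FG Cf0 (fun g h _ _ => Fgood g h) hyp
  (addr_ge0 L10 L20) (qW _ _ _ (ler_wpDr L20 (lexx _)) q1) (qW _ _ _ (ler_wpDl L10 (lexx _)) q2)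
  lam01 sum1 sum2 div.
(* The coefficients of psi in the weights are the differences of those of phi1 and phi2; psi being
   bounded on Gamma, they vanish. *)
apply: eI => i it; apply/eqP; rewrite -subr_eq0; apply/eqP.
pose c i := phi1 (e i) - phi2 (e i).
apply: (bounded_combination_eq0 (c := c) Gsub Gdiv dense Gh eh _ it) => g Gg.
apply: le_trans (weights_logN theta c g) (lerD _ (lexx _)).
have -> : \sum_(i in theta) c i * fund_weight i (cartan g) = f1 g - f2 g.
  by rewrite f1E f2E -sumrB; apply: eq_bigr => x _; rewrite mulrBl.
exact: BP.
Qed.
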